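(* Let $(X_t,\ t\ge0)$ be the bivariate stationary Ornstein-Uhlenbeck process with parameter $\theta=(\alpha,\beta)'\in\Theta$, let $h>0$, $r(x,\theta)=e^{-hQ(\theta)}x$, and let $\widehat\theta_T$ be the maximum likelihood estimator of $\theta$ based on $(X_t,\ 0\le t\le T)$. Then the plug-in predictor $r(X_T,\widehat\theta_T)=e^{-hQ(\widehat\theta_T)}X_T$ is asymptotically efficient for predicting $r(X_T,\theta)=\mathrm E_\theta(X_{T+h}\mid X_T)$, i.e. for all $\theta\in\Theta$, $$\lim_{T\to\infty}T\,\mathrm E_\theta\Big[\big(r(X_T,\widehat\theta_T)-r(X_T,\theta)\big)\big(r(X_T,\widehat\theta_T)-r(X_T,\theta)\big)'\Big]=\int_{\mathbb R^2}(\mathrm J_\theta r(x,\theta))\,I(\theta)^{-1}(\mathrm J_\theta r(x,\theta))'\,d\mu_\theta(x)=h^2e^{-2hQ(\theta)},$$ where $I(\theta)=Q(\theta)^{-1}$ and $\mu_\theta=\mathcal N\big(0,\tfrac12Q(\theta)^{-1}\big)$.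
   Context: $Q(\theta)=\begin{pmatrix}\alpha&\beta\\ \beta&\alpha\end{pmatrix}$ for $\theta=(\alpha,\beta)'$, and $\Theta=\{\theta\in\mathbb R^2: Q(\theta)\text{ is positive definite}\}$. Under $\mathrm P_\theta$, $(X_t,\ t\ge0)$ is the stationary solution in $\mathbb R^2$ of $dX_t=-Q(\theta)X_t\,dt+dW_t$, with $W$ a standard bivariate Wiener process; thus $X_T\sim\mathcal N(0,\frac12Q(\theta)^{-1})=\mu_\theta$ for all $T$. The likelihood of the path $X_{(T)}=(X_t,\ 0\le t\le T)$ is, up to a factor not depending on $\theta$, $$2\sqrt{\det Q(\theta)}\,\exp\Big\{\alpha T-\tfrac12\big(X_0'Q(\theta)X_0+X_T'Q(\theta)X_T\big)-\tfrac12\int_0^T\|Q(\theta)X_t\|^2dt\Big\},$$ and $\widehat\theta_T$ is its maximizer over $\Theta$. $\mathrm J_\theta r(x,\theta)$ is the Jacobian matrix of $\theta\mapsto r(x,\theta)$; $'$ denotes transpose. $I(\theta)$ is the asymptotic Fisher information matrix of the model. *)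

(* Defs.v *)
From HB Require Import structures.
From mathcomp Require Import all_boot all_order all_algebra.
From mathcomp Require Import all_classical all_reals all_analysis.
From mathcomp Require Import measurable_realfun.

Set Implicit Arguments.
Unset Strict Implicit.
Unset Printing Implicit Defensive.

Import Order.TTheory GRing.Theory Num.Theory.
Import numFieldNormedType.Exports.

Local Open Scope classical_set_scope.
Local Open Scope ring_scope.

(* Points of the plane are column vectors; measurability and laws are expressed
   through the identification of 'cV[R]_2 with R * R, which carries the product
   (Borel) sigma-algebra. *)
Definition pair_of {R : realType} (v : 'cV[R]_2) : R * R := (v 0 0, v 1 0).

Definition col_of {R : realType} (z : R * R) : 'cV[R]_2 :=
  \col_i (if i == 0 then z.1 else z.2).

Definition dotv {R : realType} (u v : 'cV[R]_2) : R := (u^T *m v) 0 0.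

Definition posdef {R : realType} (A : 'M[R]_2) : Prop :=
  A^T = A /\ forall v : 'cV[R]_2, v != 0 -> 0 < dotv v (A *m v).

Definition expmx {R : realType} (A : 'M[R]_2) : 'M[R]_2 :=
  limn (series (fun k : nat => (k`!%:R)^-1 *: A ^+ k)).

(* Partial derivative with respect to the j-th coordinate. *)
Definition partial {R : realType} (j : 'I_2) (f : 'cV[R]_2 -> R)
    (a : 'cV[R]_2) : R :=
  'D_(delta_mx j 0) (f : 'cV[R]_2 -> R^o) a.

(* The usual Jacobian matrix for column vectors; the library's [jacobian], made
   for row vectors, is its transpose. *)
Definition jacobian_col {R : realType} (f : 'cV[R]_2 -> 'cV[R]_2)
    (a : 'cV[R]_2) : 'M[R]_2 :=
  \matrix_(i, j) partial j (fun u => f u i 0) a.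

Definition integral_col {R : realType} (t : R) (f : R -> 'cV[R]_2) :
    'cV[R]_2 :=
  \col_i (\int[lebesgue_measure]_(s in `[0, t]) f s i 0).

(** Bivariate normal laws N(0, S) with S positive definite *)

Definition normal2_pdf {R : realType} (S : 'M[R]_2) (z : R * R) : R :=
  (2 * pi * Num.sqrt (\det S))^-1 *
  expR (- (2^-1 * dotv (col_of z) (invmx S *m col_of z))).

Definition normal2 {R : realType} (S : 'M[R]_2) : set (R * R) -> \bar R :=
  fun A => (\int[(@lebesgue_measure R \x @lebesgue_measure R)]_(z in A)
              (normal2_pdf S z)%:E)%E.

Section normal2_measure.
Context {R : realType} (S : 'M[R]_2).

Lemma measurable_normal2_pdf : measurable_fun setT (normal2_pdf S).
Proof.
have -> : normal2_pdf S = (fun z : R * R =>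
    (2 * pi * Num.sqrt (\det S))^-1 * expR (- (2^-1 *
     (z.1 * (invmx S 0 0 * z.1 + invmx S 0 1 * z.2) +
      z.2 * (invmx S 1 0 * z.1 + invmx S 1 1 * z.2))))).
  apply/funext => z; rewrite /normal2_pdf /dotv.
  congr (_ * expR (- (_ * _))).
  by rewrite !mxE !big_ord_recl big_ord0 !mxE !big_ord_recl !big_ord0 !mxE /=
     !addr0 (_ : lift ord0 ord0 = 1 :> 'I_2) //; apply/val_inj.
apply: measurable_funM => //; apply: measurableT_comp => //.
apply: measurableT_comp => //; apply: measurable_funM => //.
by apply: measurable_funD; apply: measurable_funM => //;
  apply: measurable_funD; apply: measurable_funM.
Qed.

Lemma normal2_pdf_ge0 z : 0 <= normal2_pdf S z.
Proof.
by rewrite mulr_ge0 ?expR_ge0// invr_ge0 !mulr_ge0// ?pi_ge0// sqrtr_ge0.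
Qed.

Let normal2_0 : normal2 S set0 = 0%E.
Proof. by rewrite /normal2 integral_set0. Qed.

Let normal2_ge0 A : (0 <= normal2 S A)%E.
Proof. by apply: integral_ge0 => z _; rewrite lee_fin normal2_pdf_ge0. Qed.

Let normal2_sigma_additive : semi_sigma_additive (normal2 S).
Proof.
move=> F mF tF mUF; rewrite /normal2 ge0_integral_bigcup//=; last 2 first.
- by apply/measurable_EFinP/measurable_funTS; exact: measurable_normal2_pdf.
- by move=> z _; rewrite lee_fin normal2_pdf_ge0.
apply: is_cvg_ereal_nneg_natsum_cond => n _ _.
by apply: integral_ge0 => z _; rewrite lee_fin normal2_pdf_ge0.
Qed.

HB.instance Definition _ := isMeasure.Build _ _ _ (normal2 S)
  normal2_0 normal2_ge0 normal2_sigma_additive.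

End normal2_measure.

(** Random vectors *)

Definition random_vector {d} {T : measurableType d} {R : realType}
    (Y : T -> 'cV[R]_2) : Prop :=
  measurable_fun setT (pair_of \o Y).

Definition has_law {d} {T : measurableType d} {R : realType}
    (P : probability T R) (Y : T -> 'cV[R]_2) (mu : set (R * R) -> \bar R) :
    Prop :=
  forall A, measurable A -> P ((pair_of \o Y) @^-1` A) = mu A.

Definition sigma_of {d} {T : measurableType d} {R : realType}
    (Y : T -> 'cV[R]_2) : set (set T) :=
  preimage_set_system setT (pair_of \o Y) measurable.

Definition sigma_of_family {d} {T : measurableType d} {R : realType}
    (I : set R) (Y : R -> T -> 'cV[R]_2) : set (set T) :=
  <<s \bigcup_(t in I) sigma_of (Y t) >>.

Definition independent {d} {T : measurableType d} {R : realType}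
    (P : probability T R) (F G : set (set T)) : Prop :=
  forall A B, F A -> G B -> P (A `&` B) = (P A * P B)%E.

(* g(Z) is a version of the conditional expectation E(Y | Z). *)
Definition is_cond_exp {d} {T : measurableType d} {R : realType}
    (P : probability T R) (Y Z : T -> 'cV[R]_2) (g : 'cV[R]_2 -> 'cV[R]_2) :
    Prop :=
  measurable_fun setT (pair_of \o g \o col_of) /\
  forall i : 'I_2,
    [/\ P.-integrable setT (fun w => (Y w i 0)%:E),
        P.-integrable setT (fun w => (g (Z w) i 0)%:E) &
        forall A, sigma_of Z A ->
          (\int[P]_(w in A) (g (Z w) i 0)%:E = \int[P]_(w in A) (Y w i 0)%:E)%E].

(** Processes are indexed by R, but only their values at times t >= 0 matter. *)

Definition stationary {d} {T : measurableType d} {R : realType}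
    (P : probability T R) (X : R -> T -> 'cV[R]_2) : Prop :=
  forall (n : nat) (t : 'I_n -> R) (A : 'I_n -> set (R * R)) (s : R),
    (forall i, 0 <= t i) -> (forall i, measurable (A i)) -> 0 <= s ->
    P (\bigcap_(i in [set: 'I_n]) (pair_of \o X (t i + s)) @^-1` A i) =
    P (\bigcap_(i in [set: 'I_n]) (pair_of \o X (t i)) @^-1` A i).

Record wiener {d} {T : measurableType d} {R : realType}
    (P : probability T R) (W : R -> T -> 'cV[R]_2) : Prop := Wiener {
  wiener_meas : forall t, 0 <= t -> random_vector (W t) ;
  wiener_cont : forall w, {within `[0, +oo[, continuous (W ^~ w)} ;
  wiener_0 : \forall w \ae P, W 0 w = 0 ;
  wiener_incr : forall s t, 0 <= s -> s < t ->
    has_law P (fun w => W t w - W s w) (normal2 (t - s)%:M) ;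
  wiener_indep : forall s t, 0 <= s -> s < t ->
    independent P (sigma_of (fun w => W t w - W s w))
                  (sigma_of_family `[0, s] W) }.

(** The Ornstein-Uhlenbeck model *)

Definition Qmx {R : realType} (theta : 'cV[R]_2) : 'M[R]_2 :=
  \matrix_(i, j) (if i == j then theta 0 0 else theta 1 0).

Definition Theta {R : realType} : set 'cV[R]_2 :=
  [set theta | posdef (Qmx theta)].

Definition mu_ {R : realType} (theta : 'cV[R]_2) : set (R * R) -> \bar R :=
  normal2 (2^-1 *: invmx (Qmx theta)).

(* As the noise is additive, dX = - Q X dt + dW is the pathwise integral
   equation [ou_sde].  [ou_law0] records the known one-dimensional marginal of the
   stationary solution; it is implied by the other fields when theta is in
   Theta. *)
Record stationary_ou {d} {T : measurableType d} {R : realType}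
    (P : probability T R) (theta : 'cV[R]_2) (W X : R -> T -> 'cV[R]_2) :
    Prop := StationaryOU {
  ou_wiener : wiener P W ;
  ou_meas : forall t, 0 <= t -> random_vector (X t) ;
  ou_cont : forall w, {within `[0, +oo[, continuous (X ^~ w)} ;
  ou_indep : independent P (sigma_of (X 0)) (sigma_of_family `[0, +oo[ W) ;
  ou_sde : \forall w \ae P, forall t, 0 <= t ->
    X t w = X 0 w - integral_col t (fun s => Qmx theta *m X s w) + W t w ;
  ou_stationary : stationary P X ;
  ou_law0 : has_law P (X 0) (mu_ theta) }.

(* The likelihood at u of a path x observed on [0, t], up to a factor that does
   not depend on u; such a factor affects neither maximizers nor the score.  The
   norm in the exponent is Euclidean, unlike the sup norm `|_| on matrices. *)
Definition likelihood {R : realType} (t : R) (x : R -> 'cV[R]_2)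
    (u : 'cV[R]_2) : R :=
  2 * Num.sqrt (\det (Qmx u)) *
  expR (u 0 0 * t
        - 2^-1 * (dotv (x 0) (Qmx u *m x 0) + dotv (x t) (Qmx u *m x t))
        - 2^-1 * \int[lebesgue_measure]_(s in `[0, t])
                   dotv (Qmx u *m x s) (Qmx u *m x s)).

Definition is_mle {R : realType} (t : R) (x : R -> 'cV[R]_2)
    (u : 'cV[R]_2) : Prop :=
  Theta u /\ forall v, Theta v -> likelihood t x v <= likelihood t x u.

Definition score {R : realType} (t : R) (x : R -> 'cV[R]_2)
    (theta : 'cV[R]_2) : 'cV[R]_2 :=
  \col_i partial i (fun u => ln (likelihood t x u)) theta.

Definition fisher_info {d} {T : measurableType d} {R : realType}
    (P : probability T R) (X : R -> T -> 'cV[R]_2) (theta : 'cV[R]_2)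
    (t : R) (i j : 'I_2) : \bar R :=
  ('E_P[fun w => (score t (X ^~ w) theta *m (score t (X ^~ w) theta)^T) i j])%E.

(* I is the limit of the Fisher information per unit of time. *)
Definition is_asymptotic_fisher_info {d} {T : measurableType d} {R : realType}
    (P : probability T R) (X : R -> T -> 'cV[R]_2) (theta : 'cV[R]_2)
    (I : 'M[R]_2) : Prop :=
  forall i j : 'I_2,
    (((t^-1)%:E * fisher_info P X theta t i j)%E @[t --> +oo%R] --> (I i j)%:E).

Definition predictor {R : realType} (h : R) (x theta : 'cV[R]_2) : 'cV[R]_2 :=
  expmx (- h *: Qmx theta) *m x.

(* Main.v *)
Require Import Defs.
From HB Require Import structures.
From mathcomp Require Import all_boot all_order all_algebra.
From mathcomp Require Import all_classical all_reals all_analysis.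
From mathcomp Require Import measurable_realfun ring lra.

(** In the eigenbasis (1, 1), (1, -1) of Q(theta) the process splits into two
    uncorrelated scalar Ornstein-Uhlenbeck processes U_i of rates lam_i, driven
    by noises N_i of variance 2 t, and the log-likelihood is a sum of two
    functions of one eigenvalue each.  The likelihood equation for lam_i sees
    the path mainly through
      M_i(t) = U_i(t)^2 - U_i(0)^2 + 2 lam_i int_0^t U_i^2 - 2 t,
    a martingale with E M_i(t)^2 ~ 8 t / lam_i, and linearizing it gives
      exp(- h hat_i) - exp(- h lam_i) ~ h lam_i exp(- h lam_i) M_i(t) / (2 t).
    Over the last sqrt t units of time M_i hardly moves while U_i forgets its
    past, so E (M_i(t)^2 U_i(t)^2) ~ E M_i(t)^2 E U_i(t)^2, which yields the
    limit of the prediction error; E (M_i M_j) yields the Fisher information.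

    No stochastic integral is needed: the moments are read off from Euler steps
    of the integral equation, because a function of time whose increments are
    o(t - s) is constant.  The increments of N_i after time s are independent of
    the history generated by X_0 and W on [0, s], to which U_i(s) belongs up to
    a null set since the linear equation is solved pathwise by an explicit
    formula. *)

Set Implicit Arguments.
Unset Strict Implicit.
Unset Printing Implicit Defensive.

Import Order.TTheory GRing.Theory Num.Theory.
Import numFieldNormedType.Exports.

Local Open Scope classical_set_scope.
Local Open Scope ring_scope.

(** * Moments and path integrals *)

(** The estimator itself may have large moments; what enters is exp(- h hat_i), which lies between 0
    and 1. The linearization is an inequality between real numbers, valid on every path that
    satisfies the likelihood equation, with a remainder polynomial in M_i(t), U_i(0) and U_i(t). It
    covers the paths on which int U_i^2 is abnormally small: there |M_i| plus the squared end points
    exceeds t, and the bound is crude but sufficient. Probability is thus reduced to moments of M_i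
    and U_i. Remainder and decoupling both call for E M_i(t)^8 = O(t^4), which an elementary
    Gronwall argument supplies. The eigenvectors have squared length 2, whence the noise variance 2
    t; stationarity then forces E U_i^2 = 1 / lam_i, and dM_i = 2 U_i dN_i gives the factor 4 * 2 =
    8. The window sqrt t is a compromise: M_i moves by t^(1/4) over it, against its size t^(1/2), so
    the prediction error converges at rate t^(-1/4). *)

Lemma norm_addX_le {R : realDomainType} (x y : R) n : `|x + y| ^+ n <= 2 ^+ n * (`|x| ^+ n + `|y| ^+ n).
Proof.
rewrite mulrDr -!exprMn; case: (leP `|x| `|y|) => h.
- rewrite (@le_trans _ _ ((2 * `|y|) ^+ n))// ?lerDr ?exprn_ge0// ?mulr_ge0//.
  apply: lerXn2r; rewrite ?nnegrE ?mulr_ge0//.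
  by rewrite (le_trans (ler_normD _ _))// mulr_natl mulr2n lerD2r.
- rewrite (@le_trans _ _ ((2 * `|x|) ^+ n))// ?lerDl ?exprn_ge0// ?mulr_ge0//.
  apply: lerXn2r; rewrite ?nnegrE ?mulr_ge0//.
  by rewrite (le_trans (ler_normD _ _))// mulr_natl mulr2n lerD2l ltW.
Qed.

Lemma norm_mulX_le {R : realFieldType} (x y : R) n : `|x * y| ^+ n <= `|x| ^+ (n * 2) + `|y| ^+ (n * 2).
Proof.
rewrite normrM exprMn !exprM.
by have := sqr_ge0 (`|x| ^+ n - `|y| ^+ n); have := sqr_ge0 (`|x| ^+ n + `|y| ^+ n); nra.
Qed.

Section Moments.
Context {d} {T : measurableType d} {R : realType} (P : probability T R).
Implicit Types X Y Z : T -> R.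

(** Asking for all absolute moments at once gives a class closed under products, so that every
    polynomial in the process is integrable without further argument. *)
Definition moments Y := measurable_fun setT Y /\
  forall n, P.-integrable setT (fun w => (`|Y w| ^+ n)%:E).

Definition mean Y : R := \int[P]_w Y w.

Lemma moments_meas Y : moments Y -> measurable_fun setT Y.
Proof. by case. Qed.

Lemma moments_integrable Y : moments Y -> P.-integrable setT (EFin \o Y).
Proof.
move=> [mY /(_ 1%N)]; apply: le_integrable => //; first exact/measurable_EFinP.
by move=> w _ /=; rewrite expr1 normr_id.
Qed.

Lemma meas_norm Y : measurable_fun setT Y -> measurable_fun setT (fun w => `|Y w|).
Proof. by move=> mY; apply: measurableT_comp mY. Qed.

Lemma moments_le X Y : measurable_fun setT X -> moments Y ->
  (forall w, `|X w| <= `|Y w|) -> moments X.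
Proof.
move=> mX [mY iY] XY; split=> // n; apply: le_integrable (iY n) => //.
- by apply/measurable_EFinP; apply: measurable_funX; apply: meas_norm.
- move=> w _ /=; rewrite lee_fin !normrX !normr_id.
  by apply: lerXn2r; rewrite ?nnegrE.
Qed.

Lemma momentsD X Y : moments X -> moments Y -> moments (fun w => X w + Y w).
Proof.
move=> [mX iX] [mY iY]; split=> [|n]; first exact: measurable_funD.
have /= i2 := integrableZl measurableT (2 ^+ n) (integrableD measurableT (iX n) (iY n)).
apply: (le_integrable measurableT _ _ i2).
- apply/measurable_EFinP/measurable_funX/meas_norm; exact: measurable_funD.
- move=> w _ /=; rewrite lee_fin normrX normr_id.
  rewrite [leRHS]ger0_norm ?mulr_ge0 ?addr_ge0 ?exprn_ge0//.
  exact: norm_addX_le.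
Qed.

Lemma momentsM X Y : moments X -> moments Y -> moments (fun w => X w * Y w).
Proof.
move=> [mX iX] [mY iY]; split=> [|n]; first exact: measurable_funM.
have /= i2 := integrableD measurableT (iX (n * 2)%N) (iY (n * 2)%N).
apply: (le_integrable measurableT _ _ i2).
- apply/measurable_EFinP/measurable_funX/meas_norm; exact: measurable_funM.
- move=> w _ /=; rewrite lee_fin normrX normr_id.
  rewrite [leRHS]ger0_norm ?addr_ge0 ?exprn_ge0//.
  exact: norm_mulX_le.
Qed.

Lemma moments_cst (c : R) : moments (fun=> c).
Proof.
split=> [|n]; first exact: measurable_cst.
have /integrableP[? ?] := finite_measure_integrable_cst P (`|c| ^+ n) measurableT.
exact/integrableP.
Qed.

Lemma momentsN X : moments X -> moments (fun w => - X w).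
Proof.
move=> mX; apply: moments_le (mX) _ => [|w]; last by rewrite normrN.
by apply: measurableT_comp => //; case: mX.
Qed.

Lemma momentsB X Y : moments X -> moments Y -> moments (fun w => X w - Y w).
Proof. by move=> mX mY; apply: momentsD => //; exact: momentsN. Qed.

Lemma momentsX n X : moments X -> moments (fun w => X w ^+ n).
Proof.
move=> mX; elim: n => [|n IH]; first exact: moments_cst.
by under eq_fun do rewrite exprS; exact: momentsM.
Qed.

Lemma moments_norm X : moments X -> moments (fun w => `|X w|).
Proof.
move=> mX; apply: moments_le (mX) _ => [|w]; last by rewrite normr_id.
by apply: meas_norm; case: mX.
Qed.

Lemma moments_bounded (c : R) X : measurable_fun setT X ->
  (forall w, `|X w| <= c) -> moments X.
Proof.
move=> mX Xc; apply: moments_le mX (moments_cst c) _ => w.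
by rewrite (le_trans (Xc w))// ler_norm.
Qed.

(** [|Y| ^+ n <= 1 + |Y| ^+ e n]. Used for path integrals, where iterated Cauchy-Schwarz reaches
    only exponents that are powers of two. *)
Lemma moments_cofinal (e : nat -> nat) Y : (forall n, (n <= e n)%N) ->
  measurable_fun setT Y ->
  (forall n, P.-integrable setT (fun w => (`|Y w| ^+ e n)%:E)) -> moments Y.
Proof.
move=> en mY iY; split=> // n.
have /= i2 := integrableD measurableT (moments_integrable (moments_cst 1)) (iY n).
apply: (le_integrable measurableT _ _ i2).
- exact/measurable_EFinP/measurable_funX/meas_norm.
- move=> w _ /=; rewrite lee_fin normrX normr_id.
  rewrite [leRHS]ger0_norm ?addr_ge0 ?exprn_ge0//.
  have [h|h] := leP `|Y w| 1.
    by rewrite (@le_trans _ _ 1) ?exprn_ile1// lerDl exprn_ge0.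
  rewrite (@le_trans _ _ (`|Y w| ^+ e n))// ?lerDr//.
  by rewrite ler_weXn2l// ltW.
Qed.

Lemma mean_ext X Y : (forall w, X w = Y w) -> mean X = mean Y.
Proof. by move=> XY; congr (mean _); apply/funext. Qed.

Lemma meanD X Y : moments X -> moments Y ->
  mean (fun w => X w + Y w) = mean X + mean Y.
Proof. by move=> mX mY; apply: RintegralD => //; exact: moments_integrable. Qed.

Lemma meanB X Y : moments X -> moments Y ->
  mean (fun w => X w - Y w) = mean X - mean Y.
Proof. by move=> mX mY; apply: RintegralB => //; exact: moments_integrable. Qed.

Lemma meanZ c X : moments X -> mean (fun w => c * X w) = c * mean X.
Proof. by move=> mX; apply: RintegralZl => //; exact: moments_integrable. Qed.

Lemma mean_cst c : mean (fun=> c) = c.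
Proof. by rewrite /mean Rintegral_cst//= probability_setT /= mulr1. Qed.

Lemma mean_le_ae X Y : moments X -> moments Y ->
  (\forall w \ae P, X w <= Y w) -> mean X <= mean Y.
Proof.
move=> mX mY XY; rewrite -subr_ge0 -meanB//.
pose Z w := Order.max 0 (Y w - X w).
have mYX : measurable_fun setT (fun w => Y w - X w).
  by apply: measurable_funB; [case: mY|case: mX].
have -> : mean (fun w => Y w - X w) = mean Z.
  congr fine; apply: ae_eq_integral => //; try exact/measurable_EFinP.
    by apply/measurable_EFinP; apply: measurable_maxr.
  by apply: filterS XY => w h _; rewrite /Z max_r// subr_ge0.
by apply: Rintegral_ge0 => w _; rewrite /Z le_max lexx.
Qed.

Lemma mean_le X Y : moments X -> moments Y -> (forall w, X w <= Y w) ->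
  mean X <= mean Y.
Proof. by move=> mX mY XY; apply: mean_le_ae => //; apply: aeW. Qed.

Lemma mean_eq_ae X Y : measurable_fun setT X -> measurable_fun setT Y ->
  (\forall w \ae P, X w = Y w) -> mean X = mean Y.
Proof.
move=> mX mY XY; congr fine; apply: ae_eq_integral => //; try exact/measurable_EFinP.
by apply: filterS XY => w /= ->.
Qed.

Lemma mean_ge0 X : (forall w, 0 <= X w) -> 0 <= mean X.
Proof. by move=> h; apply: Rintegral_ge0. Qed.

Lemma mean_norm X : moments X -> `|mean X| <= mean (fun w => `|X w|).
Proof. by move=> mX; apply: le_normr_Rintegral => //; exact: moments_integrable. Qed.

(** Expansion of [c^-1 * (c * |X| - |Y|) ^+ 2 >= 0]. The free weight [c] replaces Cauchy-Schwarz and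
    its square roots: each use picks it to balance two factors of different size. *)
Lemma mean_young (c : R) X Y : 0 < c -> moments X -> moments Y ->
  mean (fun w => `|X w * Y w|) <=
  c * mean (fun w => X w ^+ 2) + c^-1 * mean (fun w => Y w ^+ 2).
Proof.
move=> c0 mX mY.
rewrite -!meanZ -?meanD; try by do ?[apply: momentsM|apply: momentsX|apply: moments_cst].
  apply: mean_le => [||w].
  - exact/moments_norm/momentsM.
  - apply: momentsD; apply: momentsM; do ?exact: moments_cst; exact: momentsX.
  - have h : 2 * `|X w * Y w| <= c * X w ^+ 2 + c^-1 * Y w ^+ 2.
      rewrite normrM -(real_normK (num_real (X w))) -(real_normK (num_real (Y w))).
      have : 0 <= c^-1 * (c * `|X w| - `|Y w|) ^+ 2 by rewrite mulr_ge0 ?sqr_ge0// invr_ge0 ltW.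
      suff -> : c^-1 * (c * `|X w| - `|Y w|) ^+ 2 =
        c * `|X w| ^+ 2 + c^-1 * `|Y w| ^+ 2 - 2 * (`|X w| * `|Y w|) by rewrite subr_ge0.
      by field; rewrite gt_eqF.
    by apply: le_trans h; rewrite ler_peMl// ler1n.
Qed.

End Moments.

(** * Path integrals of continuous functions *)

Section PathIntegrals.
Context {R : realType}.
Local Notation mu := (@lebesgue_measure R).
Implicit Types (f g : R -> R).

(** Continuity on [0, +oo[, encoded as continuity on the whole line of the function frozen at its
    value at 0 for negative times, so that lemmas on globally continuous functions apply. *)
Definition cpos g := continuous (fun r : R => g (Order.max 0 r) : R).

Definition pathint s t g : R := \int[mu]_(r in `[s, t]) g r.

Lemma cvg_max0 (x : R) : (Order.max 0 z) @[z --> x] --> Order.max 0 x.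
Proof.
by apply: (@continuous_max R R (fun=> 0) id x); [exact: cvg_cst|exact: cvg_id].
Qed.

Lemma cpos_within g : {within `[0, +oo[, continuous (g : R -> R)} -> cpos g.
Proof.
move=> cg x; set y := Order.max 0 x.
have y0 : `[0, +oo[%classic y by rewrite /= in_itv /= andbT /y le_max lexx.
have cy : (Order.max 0 z) @[z --> x] --> y by exact: cvg_max0.
have gy : g r @[r --> within `[0, +oo[%classic (nbhs y)] --> g y.
  by have := cg y; rewrite /continuous_at /nbhs/= /nbhs_subspace /= mem_set.
have max0 z : `[0, +oo[%classic (Order.max 0 (z : R)).
  have h : 0 <= Order.max 0 z by rewrite le_max lexx.
  by rewrite /mkset /= in_itv /= h.
move=> A /gy hA.
rewrite nbhs_filterE; have := cy _ hA; rewrite nbhs_filterE.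
by apply: (@filterS _ (nbhs x)) => z h; exact: h (max0 z).
Qed.

Lemma cposD f g : cpos f -> cpos g -> cpos (fun r => f r + g r).
Proof. by move=> cf cg x; apply: cvgD; [exact: cf|exact: cg]. Qed.

Lemma cposM f g : cpos f -> cpos g -> cpos (fun r => f r * g r).
Proof. by move=> cf cg x; apply: cvgM; [exact: cf|exact: cg]. Qed.

Lemma cpos_cst c : cpos (fun=> c).
Proof. by move=> x; apply: cvg_cst. Qed.

Lemma cposB f g : cpos f -> cpos g -> cpos (fun r => f r - g r).
Proof. by move=> cf cg x; apply: cvgB; [exact: cf|exact: cg]. Qed.

Lemma cposX n f : cpos f -> cpos (fun r => f r ^+ n).
Proof.
move=> cf; elim: n => [|n IH]; first exact: cpos_cst.
have -> : (fun r => f r ^+ n.+1) = (fun r => f r * f r ^+ n).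
  by apply/funext => r; rewrite exprS.
exact: cposM.
Qed.

Lemma cpos_continuous f : continuous (f : R -> R) -> cpos f.
Proof.
move=> cf x; exact: (@continuous_comp R R R (fun z => Order.max 0 z) f x (@cvg_max0 x) (cf _)).
Qed.

Lemma cpos_integrable s t g : 0 <= s -> cpos g -> mu.-integrable `[s, t] (EFin \o g).
Proof.
move=> s0 cg.
have : mu.-integrable `[s, t] (EFin \o (fun r => g (Order.max 0 r))).
  apply: continuous_compact_integrable; first exact: segment_compact.
  exact/continuous_subspaceT.
apply: eq_integrable => // r; rewrite inE /= in_itv /= => /andP[sr _].
by rewrite max_r// (le_trans s0).
Qed.

Lemma pathintD s t f g : 0 <= s -> cpos f -> cpos g ->
  pathint s t (fun r => f r + g r) = pathint s t f + pathint s t g.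
Proof. by move=> s0 cf cg; apply: RintegralD => //; exact: cpos_integrable. Qed.

Lemma pathintB s t f g : 0 <= s -> cpos f -> cpos g ->
  pathint s t (fun r => f r - g r) = pathint s t f - pathint s t g.
Proof. by move=> s0 cf cg; apply: RintegralB => //; exact: cpos_integrable. Qed.

Lemma pathintZ s t c f : 0 <= s -> cpos f ->
  pathint s t (fun r => c * f r) = c * pathint s t f.
Proof. by move=> s0 cf; apply: RintegralZl => //; exact: cpos_integrable. Qed.

Lemma pathint_cst s t c : s <= t -> pathint s t (fun=> c) = c * (t - s).
Proof.
move=> st; rewrite /pathint Rintegral_cst//= lebesgue_measure_itv /= lte_fin.
by move: st; rewrite le_eqVlt => /predU1P[->|->//]; rewrite ltxx subrr.
Qed.

Lemma eq_pathint s t f g : (forall r, s <= r <= t -> f r = g r) ->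
  pathint s t f = pathint s t g.
Proof.
by move=> fg; apply: eq_Rintegral => r; rewrite inE /= in_itv /=; exact: fg.
Qed.

Lemma pathint_split s t u f : 0 <= s -> s <= t -> t <= u -> cpos f ->
  pathint s u f = pathint s t f + pathint t u f.
Proof.
move=> s0 st tu cf.
have := @Rintegral_itvB R f (BLeft s) (BRight u) t (cpos_integrable _ s0 cf).
rewrite !bnd_simp => /(_ st tu) h.
apply/eqP; rewrite addrC -subr_eq; apply/eqP; rewrite /pathint h Rintegral_itv_obnd_cbnd//.
apply: integrableS (cpos_integrable u s0 cf) => //.
by move=> r /=; rewrite !in_itv /= => /andP[tr ->]; rewrite (le_trans st (ltW tr)).
Qed.

Lemma pathint_ge0 s t f : (forall r, s <= r <= t -> 0 <= f r) -> 0 <= pathint s t f.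
Proof.
by move=> f0; apply: Rintegral_ge0 => r /=; rewrite in_itv /=; exact: f0.
Qed.

(** Cauchy-Schwarz, from the nonnegative integral of [(f - c) ^+ 2] with [c] the average of [f] over
    [s, t]. *)
Lemma pathint_sqr s t f : 0 <= s -> s <= t -> cpos f ->
  pathint s t f ^+ 2 <= (t - s) * pathint s t (fun r => f r ^+ 2).
Proof.
move=> s0; rewrite le_eqVlt => /predU1P[<- cf|st cf].
  by rewrite /pathint set_itv1 !Rintegral_set1 expr0n /= mulr0.
have ts0 : 0 < t - s by rewrite subr_gt0.
set I := pathint s t f; pose c := I / (t - s).
have : 0 <= pathint s t (fun r => f r ^+ 2 + ((- (2 * c)) * f r + c ^+ 2)).
  apply: pathint_ge0 => r _; rewrite (_ : _ + _ = (f r - c) ^+ 2) ?sqr_ge0//; ring.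
have c1 : cpos (fun r => - (2 * c) * f r) by apply: cposM cf; exact: cpos_cst.
have c2 : cpos (fun=> c ^+ 2) by exact: cpos_cst.
rewrite (pathintD _ s0 (@cposX 2 _ cf) (cposD c1 c2)) (pathintD _ s0 c1 c2).
rewrite (pathintZ _ _ s0 cf) pathint_cst ?(ltW st)// -/I => h.
set J := pathint s t _ in h *.
rewrite -subr_ge0 (_ : _ - _ = (t - s) * (J + (- (2 * c) * I + c ^+ 2 * (t - s)))).
  by rewrite mulr_ge0// ltW.
by rewrite /c; field; rewrite gt_eqF.
Qed.

(** Jensen's inequality for exponents that are powers of two, by iterating Cauchy-Schwarz; the
    factor [t - s] on the left avoids the exponent p - 1 on the right. *)
Lemma pathint_pow j s t f : 0 <= s -> s <= t -> cpos f ->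
  (t - s) * pathint s t f ^+ (2 ^ j.+1) <=
  (t - s) ^+ (2 ^ j.+1) * pathint s t (fun r => f r ^+ (2 ^ j.+1)).
Proof.
move=> s0; rewrite le_eqVlt => /predU1P[<- cf|st cf].
  by rewrite subrr mul0r expr0n expn_eq0 /= mul0r.
have ts0 : 0 < t - s by rewrite subr_gt0.
elim: j => [|j IH].
  by rewrite expn1 expr2 -mulrA (ler_pM2l ts0) (pathint_sqr s0 (ltW st)).
rewrite expnSr !exprM; under [in leRHS]eq_fun do rewrite exprM.
set a := pathint s t f ^+ _ in IH *; set b := pathint s t _ in IH *.
set L := (t - s) ^+ _ in IH *.
have := pathint_sqr s0 (ltW st) (@cposX (2 ^ j.+1) _ cf); rewrite -/b => hb.
rewrite -(ler_pM2l ts0).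
have h2 : (t - s) ^+ 2 * a ^+ 2 <= L ^+ 2 * b ^+ 2.
  rewrite -!exprMn; apply: lerXn2r; rewrite ?nnegrE//; last first.
    by rewrite mulr_ge0 ?exprn_ge0 ?(ltW ts0)// pathint_ge0// => r _; rewrite expnS exprM exprn_ge0 ?sqr_ge0.
  by rewrite mulr_ge0 ?(ltW ts0)// /a expnS exprM exprn_ge0 ?sqr_ge0.
rewrite mulrA -expr2 (le_trans h2)// [leRHS]mulrCA.
by apply: ler_wpM2l hb; exact: sqr_ge0.
Qed.

End PathIntegrals.

(** * Joint measurability of continuous processes *)

Section JointMeasurability.
Context {d} {T : measurableType d} {R : realType}.
Local Notation mu := (@lebesgue_measure R).

Lemma measurable_truncn_fiber (c : R) k : 0 < c ->
  measurable [set r : R | Num.trunc (c * r) = k].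
Proof.
move=> c0; case: k => [|k].
  rewrite (_ : [set _ | _] = `]-oo, c^-1[%classic)//.
  apply/seteqP; split => r /=; rewrite in_itv /=.
  - move=> h; rewrite ltNge; apply/negP => cr; move: h.
    apply/eqP; rewrite -lt0n truncn_gt0 -(mulfV (lt0r_neq0 c0)).
    by rewrite ler_pM2l.
  - move=> h; apply/eqP; rewrite -leqn0 leqNgt truncn_gt0 -ltNge.
    by rewrite -(mulfV (lt0r_neq0 c0)) ltr_pM2l.
rewrite (_ : [set _ | _] = `[c^-1 * k.+1%:R, c^-1 * k.+2%:R[%classic)//.
apply/seteqP; split => r /=; rewrite in_itv /=.
- move=> h.
  have cr0 : 0 <= c * r.
    rewrite leNgt; apply/negP => neg.
    have : (0 < Num.trunc (c * r))%N by rewrite h.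
    by rewrite truncn_gt0 leNgt (lt_trans neg).
  have /andP[] := truncn_itv cr0; rewrite h => h1 h2.
  by rewrite ler_pdivrMl// h1 ltr_pdivlMl.
- rewrite ler_pdivrMl// ltr_pdivlMl// => /andP[h1 h2].
  apply/eqP; rewrite eqn_leq -ltnS truncn_lt_nat ?h2 ?(le_trans _ h1)//=.
  by rewrite truncn_gt_nat.
Qed.

Lemma cvg_truncn_div (x : R) : 0 <= x ->
  (Num.trunc (n.+1%:R * x))%:R / n.+1%:R @[n --> \oo] --> x.
Proof.
move=> x0; apply/cvgrPdist_le => e e0.
near=> n.
have n0 : 0 < n.+1%:R :> R by rewrite ltr0n.
have /andP[h1 h2] := truncn_itv (mulr_ge0 (ltW n0) x0).
have n0' : n.+1%:R != 0 :> R by rewrite gt_eqF.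
set k := (Num.trunc _)%:R in h1 h2 *.
have {}h2 : n.+1%:R * x < k + 1 by rewrite /k natr1.
have -> : x - k / n.+1%:R = (n.+1%:R * x - k) / n.+1%:R by field.
rewrite ger0_norm ?divr_ge0 ?subr_ge0// ?(ltW n0)//.
apply: (@le_trans _ _ (1 / n.+1%:R)).
  by rewrite ler_wpM2r ?invr_ge0 ?(ltW n0)// lerBlDl ltW.
rewrite div1r ltW//; near: n; exact: near_infty_natSinv_lt (PosNum e0).
Unshelve. all: by end_near.
Qed.

(** By continuity in time the process is the limit of its values at the grid points k / (n + 1), and
    each approximation has countable unions of rectangles as preimages. [Num.trunc] sends negative
    times to 0, in agreement with [Order.max 0]. *)
Lemma measurable_process (f : R -> T -> R) :
  (forall r, 0 <= r -> measurable_fun setT (f r)) ->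
  (forall w, cpos (f ^~ w)) ->
  measurable_fun setT (fun z : R * T => f (Order.max 0 z.1) z.2).
Proof.
move=> mf cf.
pose h n (z : R * T) := f ((Num.trunc (n.+1%:R * z.1))%:R / n.+1%:R) z.2.
apply: (@measurable_fun_cvg _ _ _ _ h) => [n|[r w] _] /=.
- move=> _ A mA; rewrite setTI.
  rewrite (_ : _ @^-1` _ = \bigcup_k ([set r : R | Num.trunc (n.+1%:R * r) = k] `*`
      (f (k%:R / n.+1%:R) @^-1` A))); last first.
    apply/seteqP; split => [[r w]|[r w] [k _ [/= <-]]]//= h1.
    by exists (Num.trunc (n.+1%:R * r)).
  apply: bigcup_measurable => k _; apply: measurableX.
    by apply: measurable_truncn_fiber; rewrite ltr0n.
  by rewrite -[X in measurable X]setTI; apply: mf => //; rewrite divr_ge0.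
- rewrite /h /=; have [r0|r0] := leP 0 r.
    have := cvg_comp _ _ (cvg_truncn_div r0) (cf w r).
    rewrite max_r//; apply: cvg_trans; apply: near_eq_cvg; near=> n.
    by rewrite /= max_r// divr_ge0.
  rewrite (_ : (fun _ => _) = fun=> f 0 w); first exact: cvg_cst.
  apply/funext => n; rewrite (_ : Num.trunc _ = 0%N) ?mul0r//.
  apply/eqP; rewrite -leqn0 leqNgt truncn_gt0 -ltNge.
  by rewrite (@le_lt_trans _ _ 0)// pmulr_rle0 ?ltr0n// ltW.
Unshelve. all: by end_near.
Qed.

Lemma measurable_process_itv (f : R -> T -> R) s t :
  (forall r, 0 <= r -> measurable_fun setT (f r)) ->
  (forall w, cpos (f ^~ w)) ->
  measurable_fun setT (fun z : R * T =>
    if z.1 \in `[s, t] then (f (Order.max 0 z.1) z.2)%:E else 0%E).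
Proof.
move=> mf cf; apply: measurable_fun_if => //=.
  - have : measurable ([set r : R | r \in `[s, t]] `*` [set: T]).
      by apply: measurableX => //; exact: measurable_itv.
    move=> h; apply: (measurable_fun_bool true); rewrite setTI.
    rewrite (_ : _ @^-1` _ = [set r : R | r \in `[s, t]] `*` [set: T])//.
    by apply/seteqP; split => [[r w]|[r w]] //= [].
  - by apply/measurable_EFinP; apply: measurable_funTS; exact: measurable_process.
Qed.

(** Tonelli's measurability statement requires a nonnegative integrand and is applied to the
    positive and negative parts separately; no joint integrability is assumed. *)
Lemma measurable_pathint (f : R -> T -> R) s t : 0 <= s ->
  (forall r, 0 <= r -> measurable_fun setT (f r)) ->
  (forall w, cpos (f ^~ w)) ->
  measurable_fun setT (fun w => pathint s t (f ^~ w)).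
Proof.
move=> s0 mf cf; rewrite /pathint /Rintegral.
apply: (measurableT_comp (fine_measurable _)) => //.
pose g (z : R * T) : \bar R := if z.1 \in `[s, t] then (f (Order.max 0 z.1) z.2)%:E else 0%E.
have mg : measurable_fun setT g by exact: measurable_process_itv.
rewrite (_ : (fun _ => _) = (fun w => (fubini_G mu g^\+ w - fubini_G mu g^\- w)%E)).
  apply: emeasurable_funB; apply: measurable_fun_fubini_tonelli_G.
  - exact: measurable_funepos.
  - by move=> z; exact: funepos_ge0.
  - exact: measurable_funeneg.
  - by move=> z; exact: funeneg_ge0.
apply/funext => w; rewrite integral_mkcond integralE /fubini_G.
have fg (r : R) : ((fun x : R => (f x w)%:E) \_ `[s, t]) r = g (r, w).
  rewrite patchE /g /= mem_setE.
  case: ifPn => //; rewrite in_itv /= => /andP[sr _]; rewrite max_r//.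
  exact: le_trans sr.
by congr (_ - _)%E; apply: eq_integral => r _; rewrite ?funeposE ?funenegE fg.
Qed.

(** Tonelli bounds the extended-real integral first; its finiteness then yields the integrability as
    well as the bound on the real mean. *)
Lemma mean_pathint_le (P : probability T R) (f : R -> T -> R) s t (C : R) :
  0 <= s -> s <= t ->
  (forall r, 0 <= r -> measurable_fun setT (f r)) ->
  (forall w, cpos (f ^~ w)) -> (forall r w, 0 <= f r w) ->
  (forall r, s <= r <= t -> P.-integrable setT (EFin \o f r)) ->
  (forall r, s <= r <= t -> mean P (f r) <= C) ->
  P.-integrable setT (fun w => (pathint s t (f ^~ w))%:E) /\
  mean P (fun w => pathint s t (f ^~ w)) <= (t - s) * C.
Proof.
move=> s0 st mf cf f0 fi fC.
have mI := measurable_pathint t s0 mf cf.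
suff key : (\int[P]_w (pathint s t (f ^~ w))%:E <= ((t - s) * C)%:E)%E.
  have I0 w : 0 <= pathint s t (f ^~ w) by apply: pathint_ge0 => r _.
  split.
    apply/integrableP; split; first exact/measurable_EFinP.
    apply: le_lt_trans (ltry ((t - s) * C)); apply: le_trans key.
    apply: ge0_le_integral => //.
    + by apply/measurable_EFinP; exact: meas_norm.
    + exact/measurable_EFinP.
    + by move=> w _; rewrite lee_fin ger0_norm.
  have fin : (\int[P]_w (pathint s t (f^~ w))%:E)%E \is a fin_num.
    rewrite ge0_fin_numE; first by rewrite (le_lt_trans key)// ltry.
    by apply: integral_ge0 => w _; rewrite lee_fin.
  by rewrite -lee_fin /mean /Rintegral fineK.
pose g (z : R * T) : \bar R := if z.1 \in `[s, t] then (f (Order.max 0 z.1) z.2)%:E else 0%E.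
have mg : measurable_fun setT g by exact: measurable_process_itv.
have g0 z : (0 <= g z)%E by rewrite /g; case: ifP => // _; rewrite lee_fin.
have -> : (\int[P]_w (pathint s t (f ^~ w))%:E = \int[P]_w \int[mu]_r g (r, w))%E.
  apply: eq_integral => w _; rewrite /pathint /Rintegral fineK; last first.
    by apply: integrable_fin_num => //; exact: (@cpos_integrable _ s t (f ^~ w)).
  rewrite integral_mkcond; apply: eq_integral => r _; rewrite patchE /g /= mem_setE.
  by case: ifPn => //; rewrite in_itv /= => /andP[sr _]; rewrite max_r// (le_trans s0).
rewrite -(@fubini_tonelli _ _ _ _ R mu P g mg g0).
apply: (@le_trans _ _ (\int[mu]_(r in `[s, t]) C%:E)%E); last first.
  rewrite integral_cst//= lebesgue_measure_itv /= lte_fin.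
  move: st; rewrite le_eqVlt => /predU1P[->|st]; first by rewrite ltxx mule0 subrr mul0r.
  by rewrite st -EFinD -EFinM mulrC.
rewrite [leRHS]integral_mkcond; apply: ge0_le_integral => //.
- by move=> r _; apply: integral_ge0.
- exact: (@measurable_fun_fubini_tonelli_F _ _ _ _ _ P g).
- by apply/(measurable_restrictT _ _).1 => //; exact: measurable_cst.
- move=> r _; rewrite patchE mem_setE /g /=; case: ifPn => [rst|_]; last by rewrite integral0.
  have rst' : s <= r <= t by move: rst; rewrite in_itv.
  have -> : Order.max 0 r = r by rewrite max_r//; case/andP: rst' => /(le_trans s0).
  by have := fC _ rst'; rewrite -lee_fin /mean /Rintegral fineK//; exact: integrable_fin_num (fi _ rst').
Qed.

End JointMeasurability.

Section TameProcesses.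
Context {d} {T : measurableType d} {R : realType} (P : probability T R).
Implicit Types f g : R -> T -> R.

(** Moments bounded uniformly in time, together with continuous paths: exactly what makes the
    integral over [s, t] of size t - s in every L^p. *)
Record tame f : Prop := Tame {
  tame_moments : forall r, 0 <= r -> moments P (f r) ;
  tame_cpos : forall w, cpos (f ^~ w) ;
  tame_bound : forall n, exists C, forall r, 0 <= r ->
    mean P (fun w => `|f r w| ^+ n) <= C }.

Lemma tame_meas f r : tame f -> 0 <= r -> measurable_fun setT (f r).
Proof. by move=> tf r0; apply: moments_meas (tame_moments tf r0). Qed.

Lemma tameD f g : tame f -> tame g -> tame (fun r w => f r w + g r w).
Proof.
move=> [mf cf bf] [mg cg bg]; split=> [r r0|w|n].
- by apply: momentsD; [exact: mf|exact: mg].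
- by apply: cposD; [exact: cf|exact: cg].
- have [C hC] := bf n; have [D hD] := bg n.
  exists (2 ^+ n * (C + D)) => r r0.
  apply: (@le_trans _ _ (mean P (fun w => 2 ^+ n * (`|f r w| ^+ n + `|g r w| ^+ n)))).
    apply: mean_le => [||w]; last exact: norm_addX_le.
    + by apply/momentsX/moments_norm/momentsD; [exact: mf|exact: mg].
    + apply: momentsM; first exact: moments_cst.
      by apply: momentsD; apply/momentsX/moments_norm; [exact: mf|exact: mg].
  rewrite meanZ ?meanD; last 3 first.
  + by apply/momentsX/moments_norm; exact: mf.
  + by apply/momentsX/moments_norm; exact: mg.
  + by apply: momentsD; apply/momentsX/moments_norm; [exact: mf|exact: mg].
  by apply: ler_wpM2l; [exact: exprn_ge0|apply: lerD; [exact: hC|exact: hD]].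
Qed.

Lemma tameM f g : tame f -> tame g -> tame (fun r w => f r w * g r w).
Proof.
move=> [mf cf bf] [mg cg bg]; split=> [r r0|w|n].
- by apply: momentsM; [exact: mf|exact: mg].
- by apply: cposM; [exact: cf|exact: cg].
- have [C hC] := bf (n * 2)%N; have [D hD] := bg (n * 2)%N.
  exists (C + D) => r r0.
  apply: (@le_trans _ _ (mean P (fun w => `|f r w| ^+ (n * 2) + `|g r w| ^+ (n * 2)))).
    apply: mean_le => [||w]; last exact: norm_mulX_le.
    + by apply/momentsX/moments_norm/momentsM; [exact: mf|exact: mg].
    + by apply: momentsD; apply/momentsX/moments_norm; [exact: mf|exact: mg].
  rewrite meanD; last 2 first.
  + by apply/momentsX/moments_norm; exact: mf.
  + by apply/momentsX/moments_norm; exact: mg.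
  by apply: lerD; [exact: hC|exact: hD].
Qed.

Lemma tame_const (Y : T -> R) : moments P Y -> tame (fun=> Y).
Proof.
move=> mY; split=> // [w|n]; first exact: cpos_cst.
by exists (mean P (fun w => `|Y w| ^+ n)).
Qed.

Lemma tame_cst c : tame (fun _ _ => c).
Proof. exact/tame_const/moments_cst. Qed.

Lemma tameB f g : tame f -> tame g -> tame (fun r w => f r w - g r w).
Proof.
move=> tf tg; rewrite (_ : (fun _ => _) = (fun r w => f r w + (-1) * g r w)).
  by apply: tameD => //; apply: tameM => //; exact: tame_cst.
by apply/funext => r; apply/funext => w; rewrite mulN1r.
Qed.

Lemma tameX n f : tame f -> tame (fun r w => f r w ^+ n).
Proof.
move=> tf; elim: n => [|n IH]; first exact: tame_cst.
rewrite (_ : (fun _ => _) = (fun r w => f r w * f r w ^+ n)); first exact: tameM.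
by apply/funext => r; apply/funext => w; rewrite exprS.
Qed.

Lemma pathint_integrable_pow j f s t C : tame f -> 0 <= s -> s <= t ->
  (forall r, s <= r <= t -> mean P (fun w => f r w ^+ (2 ^ j.+1)) <= C) ->
  P.-integrable setT (fun w => (pathint s t (f ^~ w) ^+ (2 ^ j.+1))%:E) /\
  mean P (fun w => pathint s t (f ^~ w) ^+ (2 ^ j.+1)) <= (t - s) ^+ (2 ^ j.+1) * C.
Proof.
move=> tf s0; rewrite le_eqVlt => /predU1P[<-|st] hC.
  rewrite /pathint set_itv1.
  under eq_fun do rewrite Rintegral_set1 expr0n expn_eq0 /=.
  under [X in mean _ X]eq_fun do rewrite Rintegral_set1 expr0n expn_eq0 /=.
  rewrite mean_cst subrr expr0n expn_eq0 mul0r; split=> //.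
  exact: (moments_integrable (moments_cst P 0)).
have ts0 : 0 < t - s by rewrite subr_gt0.
have tfX := @tameX (2 ^ j.+1) _ tf.
have e0 (x : R) : 0 <= x ^+ (2 ^ j.+1) by rewrite expnS exprM exprn_ge0// sqr_ge0.
have [iI mI] := @mean_pathint_le _ _ _ P (fun r w => f r w ^+ (2 ^ j.+1)) s t C s0 (ltW st)
  (fun r => @tame_meas _ r tfX) (tame_cpos tfX) (fun r w => e0 _)
  (fun r rst => moments_integrable (tame_moments tfX (le_trans s0 (proj1 (andP rst))))) hC.
(* The power p - 1 of t - s for p = 2^(j+1): Jensen contributes this factor, and the integral of the
   bound [C] the missing one. *)
pose L := (t - s) ^+ (2 ^ j.+1) / (t - s).
have L0 : 0 <= L by rewrite divr_ge0 ?(ltW ts0).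
have IL w : pathint s t (f ^~ w) ^+ (2 ^ j.+1) <=
    L * pathint s t (fun r => f r w ^+ (2 ^ j.+1)).
  have := pathint_pow j s0 (ltW st) (@tame_cpos f tf w).
  by rewrite /L mulrAC ler_pdivlMr// mulrC.
have iL := integrableZl measurableT L iI.
have mIp : measurable_fun setT (fun w => pathint s t (f ^~ w)).
  by apply: measurable_pathint => // [r r0|w]; [exact: tame_meas|exact: tame_cpos].
have iJ : P.-integrable setT (fun w => (pathint s t (f ^~ w) ^+ (2 ^ j.+1))%:E).
  apply: (le_integrable measurableT _ _ iL).
  - by apply/measurable_EFinP; exact: measurable_funX.
  - by move=> w _ /=; rewrite lee_fin !ger0_norm// (le_trans _ (IL w)).
split=> //.
apply: (@le_trans _ _ (mean P (fun w => L * pathint s t (fun r => f r w ^+ (2 ^ j.+1))))).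
  by apply: le_Rintegral => //; exact: iL.
rewrite {1}/mean RintegralZl// (le_trans (ler_wpM2l L0 mI))//.
by rewrite /L mulrA divfK// gt_eqF.
Qed.

Lemma moments_pathint f s t : tame f -> 0 <= s -> s <= t ->
  moments P (fun w => pathint s t (f ^~ w)).
Proof.
move=> tf s0 st; apply: (@moments_cofinal _ _ _ P (fun j => 2 ^ j.+1)%N).
- by move=> n; rewrite (leq_trans (leqnSn n))// (ltnW (ltn_expl _ _)).
- by apply: measurable_pathint => // [r r0|w]; [exact: tame_meas|exact: tame_cpos].
- move=> n; have [C hC] := tame_bound tf (2 ^ n.+1).
  have [|+ _] := @pathint_integrable_pow n f s t C tf s0 st.
    move=> r /andP[sr _]; apply: le_trans (hC r (le_trans s0 sr)).
    have mX : moments P (fun w => f r w ^+ (2 ^ n.+1)).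
      by apply: momentsX; apply: tame_moments => //; exact: le_trans sr.
    apply: mean_le => // [|w]; last by rewrite -normrX ler_norm.
    by apply/momentsX/moments_norm; apply: tame_moments => //; exact: le_trans sr.
  congr (P.-integrable _ _); apply/funext => w; congr (_%:E).
  by rewrite expnS !exprM real_normK// num_real.
Qed.

End TameProcesses.

(** * Second-order calculus without stochastic integrals *)

(** Over n + 1 equal steps the increments add up to (n + 1) O((n + 1)^(-3/2)), which tends to 0. The
    exponent 3/2, rather than 2, is the order in L^2 of the remainders of an Euler step driven by
    noise of order 1/2. *)
Lemma small_increments_const {R : realType} (f : R -> R) (K a b : R) : a <= b ->
  (forall u v, a <= u -> u < v -> v <= b -> v <= u + 1 ->
     `|f v - f u| <= K * ((v - u) * Num.sqrt (v - u))) -> f b = f a.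
Proof.
rewrite le_eqVlt => /predU1P[->//|ab] fK.
set L := b - a; have L0 : 0 < L by rewrite subr_gt0.
pose C := K * (L * Num.sqrt L).
have key n : L <= n.+1%:R -> n.+1%:R * `|f b - f a| ^+ 2 <= C ^+ 2.
  move=> Ln; set h := L / n.+1%:R.
  have n0 : 0 < n.+1%:R :> R by rewrite ltr0n.
  have h0 : 0 < h by rewrite divr_gt0.
  have h1 : h <= 1 by rewrite ler_pdivrMr// mul1r.
  have hn : n.+1%:R * h = L by rewrite /h mulrC divfK// gt_eqF.
  have step k : (k <= n.+1)%N -> `|f (a + k%:R * h) - f a| <= k%:R * (K * (h * Num.sqrt h)).
    elim: k => [_|k IH kn]; first by rewrite !mul0r addr0 subrr normr0.
    have {}IH := IH (ltnW kn).
    have -> : f (a + k.+1%:R * h) - f a =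
      (f (a + k.+1%:R * h) - f (a + k%:R * h)) + (f (a + k%:R * h) - f a) by ring.
    rewrite (le_trans (ler_normD _ _))// -natr1 [(_ + 1) * (K * _)]mulrDl mul1r addrC lerD//.
    have := fK (a + k%:R * h) (a + (k%:R + 1) * h).
    have -> : a + (k%:R + 1) * h - (a + k%:R * h) = h by ring.
    apply.
    - by rewrite lerDl mulr_ge0 ?(ltW h0).
    - by rewrite ltrD2l ltr_pM2r// ltrDl.
    - rewrite -lerBrDl -/L -hn ler_pM2r// natr1 ler_nat//.
    - by rewrite mulrDl mul1r addrA lerD2l.
  have := step n.+1 (leqnn _); rewrite hn /L subrKC => le1.
  have e1 : n.+1%:R * (K * (h * Num.sqrt h)) = C / Num.sqrt n.+1%:R.
    rewrite /C /h sqrtrM ?(ltW L0)// sqrtrV ?(ltW n0)//.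
    by field; rewrite !gt_eqF ?sqrtr_gt0.
  rewrite e1 in le1.
  have : `|f b - f a| * Num.sqrt n.+1%:R <= C.
    by rewrite -ler_pdivlMr ?sqrtr_gt0.
  move=> le2; have : (`|f b - f a| * Num.sqrt n.+1%:R) ^+ 2 <= C ^+ 2.
    have p0 : 0 <= `|f b - f a| * Num.sqrt n.+1%:R by rewrite mulr_ge0 ?sqrtr_ge0.
    by apply: lerXn2r => //; rewrite nnegrE (le_trans p0).
  by rewrite exprMn sqr_sqrtr ?(ltW n0)// mulrC.
apply/eqP; rewrite -subr_eq0 -normr_eq0 -[_ == _]orbb -mulf_eq0 -expr2.
rewrite eq_le sqr_ge0 andbT leNgt; apply/negP => D0.
set D := `|f b - f a| ^+ 2 in key D0.
(* Large enough for steps of length at most 1 and for [n.+1%:R * D] to exceed [C ^+ 2]. *)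
pose n := Num.trunc (L + C ^+ 2 / D + 1).
have := key n; rewrite leNgt.
have CD : 0 <= C ^+ 2 / D by rewrite divr_ge0 ?sqr_ge0 ?ltW.
have nb : L + C ^+ 2 / D + 1 < n.+1%:R.
  by have /andP[] := @truncn_itv _ (L + C ^+ 2 / D + 1) ltac:(lra).
have -> : (n.+1%:R < L) = false by apply/negbTE; rewrite -leNgt; lra.
move=> /(_ isT); rewrite leNgt => /negP; apply.
by rewrite -ltr_pdivrMr//; lra.
Qed.

Section Orders.
Context {d} {T : measurableType d} {R : realType} (P : probability T R).
Implicit Types Y Z : R -> R -> T -> R.

(** [Y s t] is of order n / p in L^p as t - s tends to 0: noise increments satisfy [ordp 4 2], order
    1/2, and negligible remainders [ordp 2 3], order 3/2. Keeping p and n apart avoids fractional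
    powers. *)
Definition ordp p n Y :=
  (forall s t, 0 <= s -> s < t -> moments P (Y s t)) /\
  exists2 K, 0 <= K & forall s t, 0 <= s -> s < t -> t <= s + 1 ->
    mean P (fun w => `|Y s t w| ^+ p) <= K * (t - s) ^+ n.

Lemma ordp_moments p n Y s t : ordp p n Y -> 0 <= s -> s < t -> moments P (Y s t).
Proof. by move=> [h _]; exact: h. Qed.

Lemma ordp_weaken p m n Y : (m <= n)%N -> ordp p n Y -> ordp p m Y.
Proof.
move=> mn [mY [K K0 hK]]; split=> //; exists K => // s t s0 st st1.
apply: le_trans (hK s t s0 st st1) _; apply: ler_wpM2l => //.
by apply: ler_wiXn2l => //; [rewrite subr_ge0 ltW|rewrite lerBlDl].
Qed.

Lemma ordpD p n Y Z : ordp p n Y -> ordp p n Z ->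
  ordp p n (fun s t w => Y s t w + Z s t w).
Proof.
move=> [mY [K K0 hK]] [mZ [L L0 hL]]; split=> [s t s0 st|].
  by apply: momentsD; [exact: mY|exact: mZ].
exists (2 ^+ p * (K + L)) => [|s t s0 st st1].
  by rewrite mulr_ge0 ?exprn_ge0 ?addr_ge0.
have m1 := @momentsX _ _ _ _ p _ (moments_norm (mY s t s0 st)).
have m2 := @momentsX _ _ _ _ p _ (moments_norm (mZ s t s0 st)).
apply: (@le_trans _ _ (mean P (fun w => 2 ^+ p * (`|Y s t w| ^+ p + `|Z s t w| ^+ p)))).
  apply: mean_le => [||w]; last exact: norm_addX_le.
  + by apply/momentsX/moments_norm/momentsD; [exact: mY|exact: mZ].
  + by apply: momentsM (momentsD m1 m2); exact: moments_cst.
rewrite meanZ ?meanD//; last exact: momentsD.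
rewrite -mulrA; apply: ler_wpM2l; first exact: exprn_ge0.
by rewrite mulrDl; apply: lerD; [exact: hK|exact: hL].
Qed.

Lemma ordpZ p n c Y : ordp p n Y -> ordp p n (fun s t w => c * Y s t w).
Proof.
move=> [mY [K K0 hK]]; split=> [s t s0 st|].
  by apply: momentsM; [exact: moments_cst|exact: mY].
exists (`|c| ^+ p * K) => [|s t s0 st st1]; first by rewrite mulr_ge0 ?exprn_ge0.
under eq_fun do rewrite normrM exprMn.
rewrite meanZ; last by apply/momentsX/moments_norm; exact: mY.
by rewrite -mulrA; apply: ler_wpM2l; [exact: exprn_ge0|exact: hK].
Qed.

Lemma ordpB p n Y Z : ordp p n Y -> ordp p n Z ->
  ordp p n (fun s t w => Y s t w - Z s t w).
Proof.
move=> oY oZ; have := ordpD oY (ordpZ (-1) oZ).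
congr (ordp _ _ _); apply/funext => s; apply/funext => t; apply/funext => w.
by rewrite mulN1r.
Qed.

Lemma ordp_step p n Y : ordp p n Y -> ordp p (n + p) (fun s t w => (t - s) * Y s t w).
Proof.
move=> [mY [K K0 hK]]; split=> [s t s0 st|].
  by apply: momentsM; [exact: moments_cst|exact: mY].
exists K => // s t s0 st st1.
under eq_fun do rewrite normrM exprMn.
rewrite meanZ; last by apply/momentsX/moments_norm; exact: mY.
rewrite ger0_norm ?subr_ge0 ?(ltW st)// exprD mulrA [leRHS]mulrC.
by apply: ler_wpM2l; [rewrite exprn_ge0// subr_ge0 ltW|exact: hK].
Qed.

(** Orders add up while the exponent is halved: Young's inequality with weight (t - s)^k brings the
    2p-th moments, of sizes (t - s)^n and (t - s)^(n + 2k), to the common size (t - s)^(n + k). *)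
Lemma ordpM p n k Y Z : ordp (p * 2) n Y -> ordp (p * 2) (n + k * 2) Z ->
  ordp p (n + k) (fun s t w => Y s t w * Z s t w).
Proof.
move=> [mY [K K0 hK]] [mZ [L L0 hL]]; split=> [s t s0 st|].
  by apply: momentsM; [exact: mY|exact: mZ].
exists (K + L) => [|s t s0 st st1]; first exact: addr_ge0.
have h0 : 0 < t - s by rewrite subr_gt0.
have hk0 : 0 < (t - s) ^+ k by rewrite exprn_gt0.
have m1 := @momentsX _ _ _ _ p _ (moments_norm (mY s t s0 st)).
have m2 := @momentsX _ _ _ _ p _ (moments_norm (mZ s t s0 st)).
have {m1 m2} := mean_young hk0 m1 m2.
rewrite [X in X <= _](@mean_ext _ _ _ P _ (fun w => `|Y s t w * Z s t w| ^+ p)); last first.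
  by move=> w; rewrite normrM !normrX !normr_id -exprMn -normrM.
rewrite [X in _ * X + _](@mean_ext _ _ _ P _ (fun w => `|Y s t w| ^+ (p * 2))); last first.
  by move=> w; rewrite exprM.
rewrite [X in _ + _ * X](@mean_ext _ _ _ P _ (fun w => `|Z s t w| ^+ (p * 2))); last first.
  by move=> w; rewrite exprM.
move/le_trans; apply.
have e1 : (t - s) ^+ (n + k) = (t - s) ^+ k * (t - s) ^+ n by rewrite addnC exprD.
have e2 : (t - s) ^+ (n + k) = ((t - s) ^+ k)^-1 * (t - s) ^+ (n + k * 2).
  by rewrite muln2 -addnn addnA [in RHS]exprD mulrC mulfK// gt_eqF.
rewrite mulrDl {1}e1 e2; apply: lerD; rewrite mulrCA; apply: ler_wpM2l.
- exact: ltW.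
- exact: hK.
- by rewrite invr_ge0 ltW.
- exact: hL.
Qed.

(** Orders n / 2 and (3 - n) / 2 in L^2 add up to 3/2, the rate that [small_increments_const] asks
    for. The weight in Young's inequality is h^(3/2) / h^n with h = t - s. *)
Lemma ordp_prod_bound n Y Z : (n <= 3)%N -> ordp 2 n Y -> ordp 2 (3 - n) Z ->
  exists2 K, 0 <= K & forall s t, 0 <= s -> s < t -> t <= s + 1 ->
    mean P (fun w => `|Y s t w * Z s t w|) <= K * ((t - s) * Num.sqrt (t - s)).
Proof.
move=> n3 [mY [K K0 hK]] [mZ [L L0 hL]]; exists (K + L) => [|s t s0 st st1]; first exact: addr_ge0.
have h0 : 0 < t - s by rewrite subr_gt0.
set h := t - s in h0 *; set e := h * Num.sqrt h.
have e0 : 0 < e by rewrite mulr_gt0// sqrtr_gt0.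
have hn0 : 0 < h ^+ n by rewrite exprn_gt0.
have ee : e * e = h ^+ n * h ^+ (3 - n).
  rewrite -exprD subnKC// /e mulrACA -[Num.sqrt h * _]expr2 sqr_sqrtr ?(ltW h0)//.
  by rewrite !exprS expr0 mulr1 mulrA.
have c0 : 0 < e / h ^+ n by rewrite divr_gt0.
have := mean_young c0 (mY s t s0 st) (mZ s t s0 st) => /le_trans; apply.
have hK' : mean P (fun w => Y s t w ^+ 2) <= K * h ^+ n.
  rewrite (@mean_ext _ _ _ P _ (fun w => `|Y s t w| ^+ 2)); first exact: hK.
  by move=> w; rewrite real_normK// num_real.
have hL' : mean P (fun w => Z s t w ^+ 2) <= L * h ^+ (3 - n).
  rewrite (@mean_ext _ _ _ P _ (fun w => `|Z s t w| ^+ 2)); first exact: hL.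
  by move=> w; rewrite real_normK// num_real.
rewrite mulrDl; apply: lerD.
  apply: le_trans (ler_wpM2l (ltW c0) hK') _.
  by rewrite mulrCA divfK// gt_eqF.
apply: le_trans (ler_wpM2l _ hL') _; first by rewrite invr_ge0 ltW.
rewrite invf_div mulrCA; apply: ler_wpM2l => //.
by rewrite mulrAC -ee mulfK// gt_eqF.
Qed.

End Orders.

Ltac solve_moments :=
  first [ assumption | exact: moments_cst |
  lazymatch goal with
  | |- moments ?P (fun w => (@?X w + @?Y w)%R) => apply: (@momentsD _ _ _ P X Y); solve_moments
  | |- moments ?P (fun w => (- @?X w)%R) => apply: (@momentsN _ _ _ P X); solve_moments
  | |- moments ?P (fun w => (@?X w * @?Y w)%R) => apply: (@momentsM _ _ _ P X Y); solve_moments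
  | |- moments ?P (fun w => (@?X w ^+ ?n)%R) => apply: (@momentsX _ _ _ P n X); solve_moments
  | |- moments ?P (fun w => `|@?X w|%R) => apply: (@moments_norm _ _ _ P X); solve_moments
  end ].

(** The interface between the stochastic model and the calculus. [past s G] says that [G] is known
    at time s; it is kept abstract so that null sets and sub-sigma-algebras stay out of the
    computations. [N_mean1] and [N_mean2] are the martingale properties of the noises and of their
    products, the latter with bracket 2 t for i = j and 0 otherwise. *)
Record ou_pair {d} {T : measurableType d} {R : realType} (P : probability T R)
    (lam : bool -> R) (U N : bool -> R -> T -> R)
    (past : R -> (T -> R) -> Prop) : Prop := OUPair {
  lam_gt0 : forall i, 0 < lam i ;
  past_moments : forall s G, 0 <= s -> past s G -> moments P G ;
  past_cst : forall s c, past s (fun=> c) ;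
  pastD : forall s G H, past s G -> past s H -> past s (fun w => G w + H w) ;
  pastM : forall s G H, past s G -> past s H -> past s (fun w => G w * H w) ;
  past_mono : forall s t G, 0 <= s -> s <= t -> past s G -> past t G ;
  U_tame : forall i, tame P (U i) ;
  U_past : forall i s, 0 <= s -> past s (U i s) ;
  UU_past : forall i j s, 0 <= s -> past s (fun w => pathint 0 s (fun r => U i r w * U j r w)) ;
  U_sde : forall i s t, 0 <= s -> s <= t -> \forall w \ae P,
    U i t w = U i s w - lam i * pathint s t (fun r => U i r w) + (N i t w - N i s w) ;
  N_moments : forall i s t, 0 <= s -> s < t -> moments P (fun w => N i t w - N i s w) ;
  N_mean1 : forall i s t G, 0 <= s -> s < t -> past s G ->
    mean P (fun w => G w * (N i t w - N i s w)) = 0 ;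
  N_mean2 : forall i j s t G, 0 <= s -> s < t -> past s G ->
    mean P (fun w => G w * ((N i t w - N i s w) * (N j t w - N j s w))) =
    (i == j)%:R * 2 * (t - s) * mean P G ;
  N_mean4 : forall i, exists2 K, 0 <= K & forall s t, 0 <= s -> s < t ->
    mean P (fun w => `|N i t w - N i s w| ^+ 4) <= K * (t - s) ^+ 2 ;
  U_stat : forall i j t, 0 <= t ->
    mean P (fun w => U i t w * U j t w) = mean P (fun w => U i 0 w * U j 0 w) }.

(** * Euler steps and martingale brackets *)

Section OUPairTheory.
Context {d} {T : measurableType d} {R : realType} (P : probability T R)
  (lam : bool -> R) (U N : bool -> R -> T -> R) (past : R -> (T -> R) -> Prop)
  (ou : ou_pair P lam U N past).
Implicit Types (i j : bool) (G : T -> R).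

Local Notation inc i s t w := (N i t w - N i s w).

Lemma U_moments i s : 0 <= s -> moments P (U i s).
Proof. exact: (tame_moments (U_tame ou i)). Qed.

Lemma ordp_U p i : ordp P p 0 (fun s _ => U i s) /\ ordp P p 0 (fun _ t => U i t).
Proof.
have [C hC] := tame_bound (U_tame ou i) p.
have C0 : 0 <= C by apply: le_trans (hC 0 (lexx 0)); apply: mean_ge0 => w; exact: exprn_ge0.
split; split=> [s t s0 st|].
- exact: U_moments.
- by exists C => // s t s0 st _; rewrite expr0 mulr1; exact: hC.
- by apply: U_moments; rewrite (le_trans s0) ?ltW.
- by exists C => // s t s0 st _; rewrite expr0 mulr1; apply: hC; rewrite (le_trans s0) ?ltW.
Qed.

Lemma ordp_inc4 i : ordp P 4 2 (fun s t w => inc i s t w).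
Proof.
split=> [s t s0 st|]; first exact: (N_moments ou).
by have [K K0 hK] := N_mean4 ou i; exists K => // s t s0 st _; exact: hK.
Qed.

Lemma ordp_pathint (k : nat) (f : R -> T -> R) : tame P f ->
  ordp P (2 ^ k.+1) (2 ^ k.+1) (fun s t w => pathint s t (fun r => f r w)).
Proof.
move=> tf; split=> [s t s0 st|]; first exact: (moments_pathint tf s0 (ltW st)).
have [C hC] := tame_bound tf (2 ^ k.+1).
have C0 : 0 <= C by apply: le_trans (hC 0 (lexx 0)); apply: mean_ge0 => w; exact: exprn_ge0.
have eN (x : R) : `|x| ^+ (2 ^ k.+1) = x ^+ (2 ^ k.+1).
  by rewrite expnS !exprM real_normK// num_real.
exists C => // s t s0 st _.
rewrite (@mean_ext _ _ _ P _ (fun w => pathint s t (fun r => f r w) ^+ (2 ^ k.+1))) => [|w]; last exact: eN.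
rewrite mulrC; apply: (proj2 (pathint_integrable_pow tf s0 (ltW st) _)).
move=> r /andP[sr _]; apply: le_trans (hC r (le_trans s0 sr)).
by rewrite (@mean_ext _ _ _ P _ (fun w => `|f r w| ^+ (2 ^ k.+1))).
Qed.

Lemma ordp_ae p n Y Z : (forall s t, 0 <= s -> s < t -> moments P (Y s t)) ->
  (forall s t, 0 <= s -> s < t -> \forall w \ae P, Y s t w = Z s t w) ->
  ordp P p n Z -> ordp P p n Y.
Proof.
move=> mY YZ [mZ [K K0 hK]]; split=> //; exists K => // s t s0 st st1.
rewrite (@mean_eq_ae _ _ _ P _ (fun w => `|Z s t w| ^+ p)); first exact: hK.
- by apply: (@moments_meas _ _ _ P); apply/momentsX/moments_norm; exact: mY.
- by apply: (@moments_meas _ _ _ P); apply/momentsX/moments_norm; exact: mZ.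
- by apply: filterS (YZ s t s0 st) => w ->.
Qed.

Lemma ordp_dU i : ordp P 4 2 (fun s t w => U i t w - U i s w).
Proof.
apply: (@ordp_ae _ _ _ (fun s t w => inc i s t w - lam i * pathint s t (fun r => U i r w))).
- by move=> s t s0 st; apply: momentsB; apply: U_moments => //; rewrite (le_trans s0) ?ltW.
- by move=> s t s0 st; apply: filterS (U_sde ou i s0 (ltW st)) => w ->; ring.
- apply: ordpB; first exact: ordp_inc4.
  apply: ordpZ; apply: (@ordp_weaken _ _ _ _ 4 2 4) => //; exact: (ordp_pathint 1%N (U_tame ou i)).
Qed.

(* The error of the Euler step [U_t ~ (1 - lam (t - s)) U_s + dN]. *)
Definition euler i s t w := - lam i * pathint s t (fun r => U i r w - U i s w).

Lemma tame_increment i s : 0 <= s -> tame P (fun r w => U i r w - U i s w).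
Proof. by move=> s0; apply: (tameB (U_tame ou i)); exact/tame_const/U_moments. Qed.

(** The integrand [U i r - U i s] has order 1/2 and integrating over [s, t] adds 1: order 3/2 =
    6/4. *)
Lemma ordp_euler i : ordp P 4 6 (euler i).
Proof.
apply: ordpZ; split=> [s t s0 st|].
  exact: (moments_pathint (tame_increment i s0) s0 (ltW st)).
have [_ [K K0 hK]] := ordp_dU i.
have eN (x : R) : `|x| ^+ 4 = x ^+ 4.
  by rewrite -[4%N]/(2 * 2)%N !exprM real_normK// num_real.
exists K => // s t s0 st st1.
rewrite (@mean_ext _ _ _ P _ (fun w => pathint s t (fun r => U i r w - U i s w) ^+ 4)) => [|w]; last exact: eN.
rewrite -[6%N]/(4 + 2)%N exprD mulrCA; apply: (proj2 (@pathint_integrable_pow _ _ _ P 1 _ s t _ (tame_increment i s0) s0 (ltW st) _)).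
move=> r /andP[]; rewrite le_eqVlt => /predU1P[<- _|sr rt].
  rewrite (@mean_ext _ _ _ P _ (fun=> 0)) => [|w]; last by rewrite subrr expr0n.
  by rewrite mean_cst; apply: mulr_ge0 => //; apply: exprn_ge0; rewrite subr_ge0 ltW.
rewrite (@mean_ext _ _ _ P _ (fun w => `|U i r w - U i s w| ^+ 4)) => [|w]; last by rewrite eN.
apply: le_trans (hK s r s0 sr (le_trans rt st1)) _; apply: ler_wpM2l => //.
by apply: lerXn2r; rewrite ?nnegrE ?lerD2r// subr_ge0 ltW// (lt_le_trans sr).
Qed.

Lemma U_euler i s t : 0 <= s -> s < t -> \forall w \ae P,
  U i t w = (1 - lam i * (t - s)) * U i s w + inc i s t w + euler i s t w.
Proof.
move=> s0 st; apply: filterS (U_sde ou i s0 (ltW st)) => w ->.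
rewrite /euler pathintB ?pathint_cst ?(ltW st)//; [ring| |exact: cpos_cst].
exact: (tame_cpos (U_tame ou i)).
Qed.

(** The error of freezing [U i * U j] at time s inside its time integral. *)
Definition quad_err i j s t w :=
  pathint s t (fun r => U i r w * U j r w - U i s w * U j s w).

Lemma tame_quad_increment i j s : 0 <= s ->
  tame P (fun r w => U i r w * U j r w - U i s w * U j s w).
Proof.
move=> s0; apply: tameB; first exact: tameM (U_tame ou i) (U_tame ou j).
by apply/tame_const/momentsM; exact: U_moments.
Qed.

Lemma ordp_dUU i j : ordp P 2 1 (fun s t w => U i t w * U j t w - U i s w * U j s w).
Proof.
have h1 : ordp P 2 1 (fun s t w => U j t w * (U i t w - U i s w)).
  exact: (@ordpM _ _ _ P 2 0 1 _ _ (proj2 (ordp_U 4 j)) (ordp_dU i)).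
have h2 : ordp P 2 1 (fun s t w => U i s w * (U j t w - U j s w)).
  exact: (@ordpM _ _ _ P 2 0 1 _ _ (proj1 (ordp_U 4 i)) (ordp_dU j)).
have := ordpD h1 h2; congr (ordp _ _ _ _).
by apply/funext => s; apply/funext => t; apply/funext => w; ring.
Qed.

Lemma ordp_quad_err i j : ordp P 2 3 (quad_err i j).
Proof.
split=> [s t s0 st|]; first exact: (moments_pathint (tame_quad_increment i j s0) s0 (ltW st)).
have [_ [K K0 hK]] := ordp_dUU i j.
have eN (x : R) : `|x| ^+ 2 = x ^+ 2 by rewrite real_normK// num_real.
exists K => // s t s0 st st1.
rewrite (@mean_ext _ _ _ P _ (fun w => quad_err i j s t w ^+ 2)) => [|w]; last exact: eN.
rewrite -[3%N]/(2 + 1)%N exprD mulrCA; apply: (proj2 (@pathint_integrable_pow _ _ _ P 0 _ s t _ (tame_quad_increment i j s0) s0 (ltW st) _)).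
move=> r /andP[]; rewrite le_eqVlt => /predU1P[<- _|sr rt].
  rewrite (@mean_ext _ _ _ P _ (fun=> 0)) => [|w]; last by rewrite subrr expr0n.
  by rewrite mean_cst; apply: mulr_ge0 => //; apply: exprn_ge0; rewrite subr_ge0 ltW.
rewrite (@mean_ext _ _ _ P _ (fun w => `|U i r w * U j r w - U i s w * U j s w| ^+ 2)) => [|w]; last by rewrite eN.
apply: le_trans (hK s r s0 sr (le_trans rt st1)) _; apply: ler_wpM2l => //.
by apply: lerXn2r; rewrite ?nnegrE ?lerD2r// subr_ge0 ltW// (lt_le_trans sr).
Qed.

(* Up to the remainder [rem], a martingale increment of order 1/2. *)
Definition bracket i j t w :=
  U i t w * U j t w - U i 0 w * U j 0 w +
  (lam i + lam j) * pathint 0 t (fun r => U i r w * U j r w) - (i == j)%:R * 2 * t.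

(** What is left of a bracket increment once the terms with noise increments and their compensator
    are set apart: the product of the two drifts, whose first-order part cancels against the time
    integral; the cross terms with the Euler errors; and the error on the time integral itself. *)
Definition rem i j s t w :=
  lam i * lam j * ((t - s) * ((t - s) * (U i s w * U j s w))) +
  (euler i s t w * U j t w + U i t w * euler j s t w - euler i s t w * euler j s t w) +
  (lam i + lam j) * quad_err i j s t w.

Lemma ordp_rem i j : ordp P 2 3 (rem i j).
Proof.
apply: ordpD; last exact/ordpZ/ordp_quad_err.
apply: ordpD.
  apply: ordpZ; apply: (@ordp_weaken _ _ _ P 2 3 4) => //.
  apply: (@ordp_step _ _ _ P 2 2); apply: (@ordp_step _ _ _ P 2 0).
  exact: (@ordpM _ _ _ P 2 0 0 _ _ (proj1 (ordp_U 4 i)) (proj1 (ordp_U 4 j))).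
apply: ordpB.
  apply: ordpD.
    have := @ordpM _ _ _ P 2 0 3 _ _ (proj2 (ordp_U 4 j)) (ordp_euler i).
    congr (ordp _ _ _ _).
    by apply/funext => s; apply/funext => t; apply/funext => w; rewrite mulrC.
  exact: (@ordpM _ _ _ P 2 0 3 _ _ (proj2 (ordp_U 4 i)) (ordp_euler j)).
apply: (@ordp_weaken _ _ _ P 2 3 6) => //.
exact: (@ordpM _ _ _ P 2 6 0 _ _ (ordp_euler i) (ordp_euler j)).
Qed.

Lemma tame_UU i j : tame P (fun r w => U i r w * U j r w).
Proof. exact: tameM (U_tame ou i) (U_tame ou j). Qed.

Lemma bracket_step i j s t : 0 <= s -> s < t -> \forall w \ae P,
  bracket i j t w - bracket i j s w =
  (1 - lam i * (t - s)) * (U i s w * inc j s t w) +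
  (1 - lam j * (t - s)) * (U j s w * inc i s t w) +
  (inc i s t w * inc j s t w - (i == j)%:R * 2 * (t - s)) + rem i j s t w.
Proof.
move=> s0 st; apply: filterS2 (U_euler i s0 st) (U_euler j s0 st) => w ei ej.
rewrite /bracket (@pathint_split _ 0 s t _ (lexx 0) s0 (ltW st)); last exact: (tame_cpos (tame_UU i j)).
have -> : pathint s t (fun r => U i r w * U j r w) =
    quad_err i j s t w + (t - s) * (U i s w * U j s w).
  rewrite /quad_err pathintB ?pathint_cst ?(ltW st)//; [ring| |exact: cpos_cst].
  exact: (tame_cpos (tame_UU i j)).
rewrite /rem; set x := euler i s t w in ei *; set y := euler j s t w in ej *.
by rewrite ei ej; ring.
Qed.

Lemma bracket_past i j s : 0 <= s -> past s (bracket i j s).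
Proof.
move=> s0; rewrite /bracket.
apply: (pastD ou); last exact: (past_cst ou).
apply: (pastD ou); last first.
  by apply: (pastM ou); [exact: (past_cst ou)|exact: (UU_past ou)].
apply: (pastD ou); first by apply: (pastM ou); exact: (U_past ou).
have -> : (fun w => - (U i 0 w * U j 0 w)) = (fun w => -1 * (U i 0 w * U j 0 w)).
  by apply/funext => w; rewrite mulN1r.
apply: (pastM ou); first exact: (past_cst ou).
by apply: (past_mono ou (lexx 0) s0); apply: (pastM ou); exact: (U_past ou).
Qed.

Lemma bracket_moments i j s : 0 <= s -> moments P (bracket i j s).
Proof. by move=> s0; apply: (past_moments ou s0); exact: bracket_past. Qed.

Lemma inc_moments i s t : 0 <= s -> s < t -> moments P (fun w => inc i s t w).
Proof. exact: (N_moments ou). Qed.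

(** The coefficients of the noise terms in [bracket_step] belong to the past at s, so these terms
    have mean zero against [G], the quadratic one after its compensator is subtracted. *)
Lemma mean_past_bracket_step i j G s t : 0 <= s -> s < t -> past s G ->
  mean P (fun w => G w * (bracket i j t w - bracket i j s w)) =
  mean P (fun w => G w * rem i j s t w).
Proof.
move=> s0 st pG; have mG := past_moments ou s0 pG.
have t0 : 0 <= t by rewrite (le_trans s0) ?ltW.
have mUi := U_moments i s0; have mUj := U_moments j s0.
have mi := inc_moments i s0 st; have mj := inc_moments j s0 st.
have mr := ordp_moments (ordp_rem i j) s0 st.
have mBt := bracket_moments i j t0; have mBs := bracket_moments i j s0.
pose a := 1 - lam i * (t - s); pose b := 1 - lam j * (t - s); pose c := (i == j)%:R * 2 * (t - s).
pose X w := a * ((G w * U i s w) * inc j s t w) + b * ((G w * U j s w) * inc i s t w) +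
  (G w * (inc i s t w * inc j s t w) - c * G w) + G w * rem i j s t w.
rewrite (@mean_eq_ae _ _ _ P _ X); last 3 first.
- by apply: (@moments_meas _ _ _ P); solve_moments.
- by apply: (@moments_meas _ _ _ P); rewrite /X; solve_moments.
- by apply: filterS (bracket_step i j s0 st) => w ->; rewrite /X /a /b /c; ring.
rewrite /X meanD; [|solve_moments|solve_moments].
rewrite meanD; [|solve_moments|solve_moments].
rewrite meanB; [|solve_moments|solve_moments].
rewrite meanD; [|solve_moments|solve_moments].
rewrite !meanZ; [|solve_moments|solve_moments|solve_moments].
rewrite (N_mean1 ou j s0 st); last by apply: (pastM ou) => //; exact: (U_past ou).
rewrite (N_mean1 ou i s0 st); last by apply: (pastM ou) => //; exact: (U_past ou).
by rewrite (N_mean2 ou i j s0 st pG) -/c; ring.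
Qed.

Lemma ordp_fixed p G : moments P G -> ordp P p 0 (fun _ _ => G).
Proof.
move=> mG; split=> //; exists (mean P (fun w => `|G w| ^+ p)).
  by apply: mean_ge0 => w; exact: exprn_ge0.
by move=> s t _ _ _; rewrite expr0 mulr1.
Qed.

Lemma mean_ord3_bound Y G : moments P G -> ordp P 2 3 Y -> exists2 K, 0 <= K &
  forall s t, 0 <= s -> s < t -> t <= s + 1 ->
  `|mean P (fun w => G w * Y s t w)| <= K * ((t - s) * Num.sqrt (t - s)).
Proof.
move=> mG oY; have [K K0 hK] := @ordp_prod_bound _ _ _ P 0 _ _ isT (ordp_fixed 2 mG) oY.
exists K => // s t s0 st st1; apply: le_trans (hK s t s0 st st1).
apply: mean_norm; apply: momentsM => //; exact: (ordp_moments oY).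
Qed.

(** As a function of t the mean has increments of order 3/2, since only [rem] survives; hence it is
    constant. *)
Lemma bracket_martingale i j G s t : 0 <= s -> s <= t -> past s G ->
  mean P (fun w => G w * bracket i j t w) = mean P (fun w => G w * bracket i j s w).
Proof.
move=> s0 st pG; have mG := past_moments ou s0 pG.
have [K K0 hK] := mean_ord3_bound mG (ordp_rem i j).
apply: (@small_increments_const _ (fun t => mean P (fun w => G w * bracket i j t w)) K s t st).
move=> u v su uv vt vu1; have u0 := le_trans s0 su; have v0 := le_trans u0 (ltW uv).
have mBu := bracket_moments i j u0; have mBv := bracket_moments i j v0.
rewrite -meanB; [|solve_moments|solve_moments].
rewrite (@mean_ext _ _ _ P _ (fun w => G w * (bracket i j v w - bracket i j u w))) => [|w]; last by rewrite -mulrBr.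
rewrite mean_past_bracket_step//; first exact: hK.
exact: (past_mono ou s0 su).
Qed.

End OUPairTheory.

Lemma expR_euler_err {R : realType} (x : R) : 0 <= x -> `|expR (- x) - (1 - x)| <= x ^+ 2.
Proof.
move=> x0; have h1 := expR_ge1Dx (- x); have h2 := expR_ge1Dx x.
rewrite ger0_norm; last by lra.
have e : expR (- x) * expR x = 1 by rewrite -expRD addNr expR0.
have p := expR_gt0 (- x).
have : expR (- x) * (1 + x) <= 1 by rewrite -[leRHS]e ler_wpM2l// ltW.
move: h1 p x0; set y := expR (- x) => h1 p x0 h3.
suff : (1 + x) * (y - (1 - x)) <= (1 + x) * x ^+ 2 by rewrite ler_pM2l//; lra.
by nra.
Qed.

(** The differential equation p' = - lam p in Euler form: [expR (lam * u) * p u] has increments of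
    order 3/2, hence is constant. The a priori bound [B] absorbs the O(h^2) gap between exp(- lam h)
    and 1 - lam h. *)
Lemma relaxation {R : realType} (p : R -> R) (lam B K s t : R) : 0 <= lam -> 0 <= B -> 0 <= K ->
  s <= t -> (forall u, s <= u -> u <= t -> `|p u| <= B) ->
  (forall u v, s <= u -> u < v -> v <= t -> v <= u + 1 ->
     `|p v - (1 - lam * (v - u)) * p u| <= K * ((v - u) * Num.sqrt (v - u))) ->
  p t = expR (- lam * (t - s)) * p s.
Proof.
move=> lam0 B0 K0 st pB pK.
pose C := expR (lam * t) * (K + lam ^+ 2 * B).
have := @small_increments_const R (fun u => expR (lam * u) * p u) C s t st.
move=> h; have {}h : expR (lam * t) * p t = expR (lam * s) * p s.
  apply: h => u v su uv vt vu1; set h := v - u.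
  have h0 : 0 < h by rewrite subr_gt0.
  have h1 : h <= 1 by rewrite lerBlDl.
  have hh : h ^+ 2 <= h * Num.sqrt h.
    rewrite expr2 ler_pM2l// -{1}(sqr_sqrtr (ltW h0)) expr2 -[leRHS]mulr1 ler_wpM2l ?sqrtr_ge0//.
    by rewrite -[leRHS]sqrtr1; apply: ler_wsqrtr.
  have -> : expR (lam * v) * p v - expR (lam * u) * p u =
      expR (lam * v) * ((p v - (1 - lam * h) * p u) - (expR (- (lam * h)) - (1 - lam * h)) * p u).
    have -> : expR (lam * u) = expR (lam * v) * expR (- (lam * h)).
      by rewrite -expRD /h; congr expR; ring.
    by ring.
  rewrite normrM ger0_norm ?expR_ge0// -mulrA.
  apply: ler_pM; rewrite ?expR_ge0//; first by rewrite ler_expR ler_wpM2l.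
  rewrite (le_trans (ler_normB _ _))// [leRHS]mulrDl; apply: lerD; first exact: pK.
  rewrite normrM; apply: (@le_trans _ _ ((lam * h) ^+ 2 * B)).
    apply: ler_pM => //; first by apply: expR_euler_err; rewrite mulr_ge0// ltW.
    by apply: pB => //; rewrite (le_trans (ltW uv)).
  by rewrite exprMn mulrAC ler_wpM2l// mulr_ge0 ?exprn_ge0.
have -> : - lam * (t - s) = - (lam * t) + lam * s by ring.
by rewrite expRD -mulrA -h mulrA -expRD addNr expR0 mul1r.
Qed.

(** * Stationary covariances and exponential relaxation *)

Section OUPairRelaxation.
Context {d} {T : measurableType d} {R : realType} (P : probability T R)
  (lam : bool -> R) (U N : bool -> R -> T -> R) (past : R -> (T -> R) -> Prop)
  (ou : ou_pair P lam U N past).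
Implicit Types (i j : bool) (G : T -> R).

Local Notation inc i s t w := (N i t w - N i s w).
Local Notation rem := (rem lam U).
Local Notation bracket := (bracket lam U).
Local Notation euler := (euler lam U).

(** The stationary covariance of [U i] and [U j]: the balance 2 lam v = 2 between drift and noise
    gives v = 1 / lam. *)
Definition ucov i j : R := (i == j)%:R / lam i.

Lemma mean_mul_le Y Z : moments P Y -> moments P Z ->
  `|mean P (fun w => Y w * Z w)| <= mean P (fun w => Y w ^+ 2) + mean P (fun w => Z w ^+ 2).
Proof.
move=> mY mZ; apply: le_trans (mean_norm (momentsM mY mZ)) _.
by have := mean_young (@ltr01 R) mY mZ; rewrite invr1 !mul1r.
Qed.

Lemma mean_past_bounded G (Y : R -> T -> R) : moments P G -> tame P Y ->
  exists2 B, 0 <= B & forall u, 0 <= u -> `|mean P (fun w => G w * Y u w)| <= B.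
Proof.
move=> mG tY; have [C hC] := tame_bound tY 2.
have C0 : 0 <= C by apply: le_trans (hC 0 (lexx 0)); apply: mean_ge0 => w; exact: exprn_ge0.
exists (mean P (fun w => G w ^+ 2) + C) => [|u u0].
  by rewrite addr_ge0// mean_ge0// => w; exact: sqr_ge0.
apply: le_trans (mean_mul_le mG (tame_moments tY u0)) _; rewrite lerD2l.
apply: le_trans (hC u u0); rewrite (@mean_ext _ _ _ P _ (fun w => `|Y u w| ^+ 2))// => w.
by rewrite real_normK// num_real.
Qed.

(** By stationarity the mean of a bracket increment over [u, v] is (L c - sg)(v - u) up to order
    3/2, with c the unknown covariance, and it is itself of order 3/2. So the linear function (L c -
    sg) u is constant and its slope vanishes, which determines c. *)
Lemma mean_UU i j t : 0 <= t -> mean P (fun w => U i t w * U j t w) = ucov i j.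
Proof.
move=> t0; rewrite (U_stat ou)//.
set c := mean P _; pose L := lam i + lam j; pose sg : R := (i == j)%:R * 2.
have L0 : 0 < L by rewrite addr_gt0// (lam_gt0 ou).
have m1 := moments_cst P 1.
have [K K0 hK] := mean_ord3_bound m1 (ordp_rem ou i j).
have [K' K'0 hK'] := mean_ord3_bound m1 (ordp_quad_err ou i j).
have := @small_increments_const R (fun u => (L * c - sg) * u) (K + L * K') 0 1 ler01.
rewrite mulr1 mulr0 => h; suff : L * c - sg = 0.
  move=> /eqP; rewrite subr_eq0 => /eqP e; rewrite /ucov.
  apply: (mulfI (lt0r_neq0 L0)); rewrite e /L /sg.
  have [<-|_] := eqVneq i j; last by rewrite !mul0r mulr0.
  by field; rewrite gt_eqF// (lam_gt0 ou).
apply: h => u v u0 uv v1 vu1; have v0 := le_trans u0 (ltW uv).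
rewrite -mulrBr; set h := v - u.
have mq := ordp_moments (ordp_quad_err ou i j) u0 uv.
have mUUu := tame_moments (tame_UU ou i j) u0; have mUUv := tame_moments (tame_UU ou i j) v0.
have mU0 := tame_moments (tame_UU ou i j) (lexx 0).
have mI := moments_pathint (tame_UU ou i j) u0 (ltW uv).
have mI0 := moments_pathint (tame_UU ou i j) (lexx 0) v0.
have mI0u := moments_pathint (tame_UU ou i j) (lexx 0) u0.
have e1 : L * (h * c) - sg * h + L * mean P (quad_err U i j u v) = mean P (rem i j u v).
  rewrite -[RHS](@mean_ext _ _ _ P (fun w => 1 * rem i j u v w)) => [|w]; last by rewrite mul1r.
  rewrite -(mean_past_bracket_step ou i j u0 uv (past_cst ou u 1)).
  rewrite [RHS](@mean_ext _ _ _ P _ (fun w => (U i v w * U j v w - U i u w * U j u w) +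
    ((L * quad_err U i j u v w + (L * h) * (U i u w * U j u w)) - sg * h))); last first.
    move=> w; rewrite mul1r /bracket.
    rewrite (@pathint_split _ 0 u v _ (lexx 0) u0 (ltW uv)); last exact: (tame_cpos (tame_UU ou i j)).
    have -> : pathint u v (fun r => U i r w * U j r w) =
        quad_err U i j u v w + h * (U i u w * U j u w).
      rewrite /quad_err pathintB ?pathint_cst ?(ltW uv)//; [rewrite /h; ring| |exact: cpos_cst].
      exact: (tame_cpos (tame_UU ou i j)).
    by rewrite /L /sg /h; ring.
  rewrite meanD; [|solve_moments|solve_moments].
  rewrite meanB; [|solve_moments|solve_moments].
  rewrite meanB; [|solve_moments|solve_moments].
  rewrite meanD; [|solve_moments|solve_moments].
  rewrite mean_cst !meanZ; [|solve_moments|solve_moments].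
  by rewrite !(U_stat ou)// -/c; ring.
have -> : (L * c - sg) * h = mean P (rem i j u v) - L * mean P (quad_err U i j u v).
  by rewrite -e1; ring.
rewrite (le_trans (ler_normB _ _))// [leRHS]mulrDl; apply: lerD.
  rewrite -[X in `|X|](@mean_ext _ _ _ P (fun w => 1 * rem i j u v w)) => [|w]; last by rewrite mul1r.
  exact: hK.
rewrite normrM ger0_norm ?(ltW L0)// -mulrA ler_pM2l//.
rewrite -[X in `|X|](@mean_ext _ _ _ P (fun w => 1 * quad_err U i j u v w)) => [|w]; last by rewrite mul1r.
exact: hK'.
Qed.

(** The conditional mean of the process: against a past variable the noise drops out of the Euler
    step and [relaxation] applies. *)
Lemma mean_past_U i G s t : 0 <= s -> s <= t -> past s G ->
  mean P (fun w => G w * U i t w) = expR (- lam i * (t - s)) * mean P (fun w => G w * U i s w).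
Proof.
move=> s0 st pG; have mG := past_moments ou s0 pG.
have [B B0 hB] := mean_past_bounded mG (U_tame ou i).
(* Multiplying by the constant 1 lets [ordpM] trade the order 6/4 in L^4 for 3/2 in L^2. *)
have oe : ordp P 2 3 (euler i).
  have o1 := @ordpM _ _ _ P 2 0 3 (fun _ _ _ => 1) (euler i).
  have -> : euler i = (fun s t w => 1 * euler i s t w).
    by apply/funext => ?; apply/funext => ?; apply/funext => ?; rewrite mul1r.
  apply: o1; last exact: (ordp_euler ou i).
  split=> [*|]; first exact: moments_cst.
  exists 1 => // *; rewrite (@mean_ext _ _ _ P _ (fun=> 1)) => [|w]; last by rewrite normr1 expr1n.
  by rewrite mean_cst expr0 mulr1.
have [K K0 hK] := mean_ord3_bound mG oe.
apply: (@relaxation R (fun t => mean P (fun w => G w * U i t w)) (lam i) B K s t (ltW (lam_gt0 ou i))) => //.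
  by move=> u su ut; apply: hB; rewrite (le_trans s0).
move=> u v su uv vt vu1; have u0 := le_trans s0 su; have v0 := le_trans u0 (ltW uv).
have pGu := past_mono ou s0 su pG.
have mUu := U_moments ou i u0; have mUv := U_moments ou i v0.
have mi := inc_moments ou i u0 uv; have me := ordp_moments oe u0 uv.
rewrite (@mean_eq_ae _ _ _ P _ (fun w => (1 - lam i * (v - u)) * (G w * U i u w) + G w * inc i u v w + G w * euler i u v w)); last 3 first.
- by apply: (@moments_meas _ _ _ P); solve_moments.
- by apply: (@moments_meas _ _ _ P); solve_moments.
- by apply: filterS (U_euler ou i u0 uv) => w ->; ring.
rewrite meanD; [|solve_moments|solve_moments].
rewrite meanD; [|solve_moments|solve_moments].
rewrite meanZ; [|solve_moments].
rewrite (N_mean1 ou i u0 uv pGu) addr0 addrAC subrr add0r.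
exact: hK.
Qed.

(** Centring at [ucov i j] makes the drift homogeneous, as the compensator of the bracket is (lam i
    + lam j) times this covariance; the rate is therefore the sum of the two rates. *)
Lemma mean_past_UU i j G s t : 0 <= s -> s <= t -> past s G ->
  mean P (fun w => G w * (U i t w * U j t w - ucov i j)) =
  expR (- (lam i + lam j) * (t - s)) * mean P (fun w => G w * (U i s w * U j s w - ucov i j)).
Proof.
move=> s0 st pG; have mG := past_moments ou s0 pG.
have tUU : tame P (fun r w => U i r w * U j r w - ucov i j).
  exact: (tameB (tame_UU ou i j) (tame_cst P (ucov i j))).
have [B B0 hB] := mean_past_bounded mG tUU.
pose L := lam i + lam j.
have L0 : 0 < L by rewrite addr_gt0// (lam_gt0 ou).
have [K K0 hK] := mean_ord3_bound mG (ordp_rem ou i j).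
have [K' K'0 hK'] := mean_ord3_bound mG (ordp_quad_err ou i j).
apply: (@relaxation R (fun t => mean P (fun w => G w * (U i t w * U j t w - ucov i j))) L B (K + L * K') s t (ltW L0)) => //.
- by rewrite addr_ge0// mulr_ge0// ltW.
- by move=> u su ut; apply: hB; rewrite (le_trans s0).
move=> u v su uv vt vu1; have u0 := le_trans s0 su; have v0 := le_trans u0 (ltW uv).
have pGu := past_mono ou s0 su pG.
have mUUu := tame_moments (tame_UU ou i j) u0; have mUUv := tame_moments (tame_UU ou i j) v0.
have mq := ordp_moments (ordp_quad_err ou i j) u0 uv.
have mr := ordp_moments (ordp_rem ou i j) u0 uv.
have mBu := bracket_moments ou i j u0; have mBv := bracket_moments ou i j v0.
have Lc : L * ucov i j = (i == j)%:R * 2.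
  rewrite /L /ucov; have [<-|_] := eqVneq i j; last by rewrite !mul0r mulr0.
  by field; rewrite gt_eqF// (lam_gt0 ou).
set h := v - u.
rewrite (@mean_ext _ _ _ P _ (fun w => (1 - L * h) * (G w * (U i u w * U j u w - ucov i j)) +
   (G w * (bracket i j v w - bracket i j u w) - L * (G w * quad_err U i j u v w)))); last first.
  move=> w; rewrite /bracket.
  rewrite (@pathint_split _ 0 u v _ (lexx 0) u0 (ltW uv)); last exact: (tame_cpos (tame_UU ou i j)).
  have -> : pathint u v (fun r => U i r w * U j r w) =
      quad_err U i j u v w + h * (U i u w * U j u w).
    rewrite /quad_err pathintB ?pathint_cst ?(ltW uv)//; [rewrite /h; ring| |exact: cpos_cst].
    exact: (tame_cpos (tame_UU ou i j)).
  rewrite /h -Lc /L; ring.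
rewrite meanD; [|solve_moments|solve_moments].
rewrite meanB; [|solve_moments|solve_moments].
rewrite !meanZ; [|solve_moments|solve_moments].
rewrite (mean_past_bracket_step ou i j u0 uv pGu) addrC addKr.
rewrite (le_trans (ler_normB _ _))// [leRHS]mulrDl; apply: lerD; first exact: hK.
by rewrite normrM ger0_norm ?(ltW L0)// -mulrA ler_pM2l//; exact: hK'.
Qed.

Lemma bracket0 i j w : bracket i j 0 w = 0.
Proof. by rewrite /bracket /pathint set_itv1 Rintegral_set1 subrr !mulr0 addr0 subrr. Qed.

(** An increment of [bracket i i] is [Z + Y] with [Z = 2 U dN] of order 1/2 and [Y] of order 1, so
    E(dM_i dM_j) equals E(Z_i Z_j) up to order 3/2, and E(Z_i Z_j) = 4 E(U_i U_j dN_i dN_j) = 8 ucov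
    (v - u). The martingale property turns the increment of E(M_i M_j) into the mean of the product
    of increments. *)
Lemma mean_bracketM i j t : 0 <= t ->
  mean P (fun w => bracket i i t w * bracket j j t w) = 8 * ucov i j * t.
Proof.
move=> t0.
pose Z i (s t : R) w := 2 * (U i s w * inc i s t w).
pose Y i (s t : R) w := (- (2 * lam i)) * (((t - s) * U i s w) * inc i s t w) +
  (inc i s t w * inc i s t w - (t - s) * 2) + rem i i s t w.
have oZ k : ordp P 2 1 (Z k).
  by apply: ordpZ; exact: (@ordpM _ _ _ P 2 0 1 _ _ (proj1 (ordp_U ou 4 k)) (ordp_inc4 ou k)).
have o2 : ordp P 2 0 (fun _ _ _ => 2 : R) by apply: ordp_fixed; exact: moments_cst.
have oY k : ordp P 2 2 (Y k).
  apply: ordpD; last by apply: ordp_weaken (ordp_rem ou k k).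
  apply: ordpD; last first.
    apply: ordpB; last exact: (@ordp_step _ _ _ P 2 0 _ o2).
    exact: (@ordpM _ _ _ P 2 2 0 _ _ (ordp_inc4 ou k) (ordp_inc4 ou k)).
  apply: ordpZ; apply: (@ordp_weaken _ _ _ P 2 2 3) => //.
  have oU := @ordp_step _ _ _ P 4 0 _ (proj1 (ordp_U ou 4 k)).
  have := @ordpM _ _ _ P 2 2 1 _ _ (ordp_inc4 ou k) oU.
  congr (ordp _ _ _ _).
  by apply/funext => s; apply/funext => u; apply/funext => w; rewrite mulrC.
have [K1 K10 hK1] := @ordp_prod_bound _ _ _ P 1 _ _ isT (oZ i) (oY j).
have [K2 K20 hK2] := @ordp_prod_bound _ _ _ P 2 _ _ isT (oY i) (oZ j).
have [K3 K30 hK3] := @ordp_prod_bound _ _ _ P 2 _ _ isT (oY i) (ordp_weaken (isT : 1 <= 2)%N (oY j)).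
have := @small_increments_const R (fun u => mean P (fun w => bracket i i u w * bracket j j u w) - 8 * ucov i j * u)
  (K1 + K2 + K3) 0 t t0.
move=> h; suff : mean P (fun w => bracket i i t w * bracket j j t w) - 8 * ucov i j * t =
    mean P (fun w => bracket i i 0 w * bracket j j 0 w) - 8 * ucov i j * 0.
  rewrite (@mean_ext _ _ _ P (fun w => bracket i i 0 w * _) (fun=> 0)) => [|w]; last by rewrite bracket0 mul0r.
  by rewrite mean_cst mulr0 subrr => /eqP; rewrite subr_eq0 => /eqP.
apply: h => u v u0 uv vt vu1; have v0 := le_trans u0 (ltW uv).
have mBu k := bracket_moments ou k k u0; have mBv k := bracket_moments ou k k v0.
have mBui := mBu i; have mBuj := mBu j; have mBvi := mBv i; have mBvj := mBv j.
have mZi := ordp_moments (oZ i) u0 uv; have mZj := ordp_moments (oZ j) u0 uv.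
have mYi := ordp_moments (oY i) u0 uv; have mYj := ordp_moments (oY j) u0 uv.
have qE k : \forall w \ae P, bracket k k v w - bracket k k u w = Z k u v w + Y k u v w.
  by apply: filterS (bracket_step ou k k u0 uv) => w ->; rewrite eqxx mulr1n /Z /Y; ring.
have e : mean P (fun w => bracket i i v w * bracket j j v w) - mean P (fun w => bracket i i u w * bracket j j u w) =
  mean P (fun w => (bracket i i v w - bracket i i u w) * (bracket j j v w - bracket j j u w)).
  rewrite [RHS](@mean_ext _ _ _ P _ (fun w => bracket i i v w * bracket j j v w -
    bracket j j u w * bracket i i v w - bracket i i u w * bracket j j v w + bracket i i u w * bracket j j u w)); last first.
    move=> w; move: (bracket i i v w) (bracket i i u w) (bracket j j v w) (bracket j j u w) => ? ? ? ?; ring.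
  rewrite meanD; [|solve_moments|solve_moments].
  rewrite meanB; [|solve_moments|solve_moments].
  rewrite meanB; [|solve_moments|solve_moments].
  rewrite (bracket_martingale ou i i u0 (ltW uv) (bracket_past ou j j u0)).
  rewrite (bracket_martingale ou j j u0 (ltW uv) (bracket_past ou i i u0)).
  rewrite [in RHS](@mean_ext _ _ _ P (fun w => bracket j j u w * bracket i i u w) (fun w => bracket i i u w * bracket j j u w)) => [|w]; last by rewrite mulrC.
  by rewrite subrK.
have -> : mean P (fun w => bracket i i v w * bracket j j v w) - 8 * ucov i j * v -
   (mean P (fun w => bracket i i u w * bracket j j u w) - 8 * ucov i j * u) =
   mean P (fun w => (bracket i i v w - bracket i i u w) * (bracket j j v w - bracket j j u w)) - 8 * ucov i j * (v - u).
  by rewrite -e; ring.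
rewrite (@mean_eq_ae _ _ _ P _ (fun w => Z i u v w * Z j u v w + (Z i u v w * Y j u v w + Y i u v w * Z j u v w + Y i u v w * Y j u v w))); last 3 first.
- by apply: (@moments_meas _ _ _ P); solve_moments.
- by apply: (@moments_meas _ _ _ P); solve_moments.
- apply: filterS2 (qE i) (qE j) => w -> ->.
  move: (Z i u v w) (Z j u v w) (Y i u v w) (Y j u v w) => ? ? ? ?; ring.
rewrite meanD; [|solve_moments|solve_moments].
rewrite meanD; [|solve_moments|solve_moments].
rewrite meanD; [|solve_moments|solve_moments].
have -> : mean P (fun w => Z i u v w * Z j u v w) = 8 * ucov i j * (v - u).
  have mi := inc_moments ou i u0 uv; have mj := inc_moments ou j u0 uv.
  have mUi := U_moments ou i u0; have mUj := U_moments ou j u0.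
  rewrite (@mean_ext _ _ _ P _ (fun w => 4 * ((U i u w * U j u w) * (inc i u v w * inc j u v w)))) => [|w]; last by rewrite /Z; ring.
  rewrite meanZ; [|solve_moments].
  rewrite (N_mean2 ou i j u0 uv); last by apply: (pastM ou); exact: (U_past ou).
  rewrite mean_UU// /ucov; case: (i == j); rewrite /=; ring.
rewrite addrC addKr [leRHS]mulrDl [X in _ <= X + _]mulrDl; apply: le_trans (ler_normD _ _) _; apply: lerD.
  apply: le_trans (ler_normD _ _) _; apply: lerD.
    by apply: le_trans (mean_norm _) (hK1 _ _ u0 uv vu1); solve_moments.
  by apply: le_trans (mean_norm _) (hK2 _ _ u0 uv vu1); solve_moments.
by apply: le_trans (mean_norm _) (hK3 _ _ u0 uv vu1); solve_moments.
Qed.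

End OUPairRelaxation.

(** * Eighth moments of the martingales *)

Lemma expand8_le {R : realFieldType} (x q : R) :
  (x + q) ^+ 8 <= x ^+ 8 + 8 * (x ^+ 7 * q) + 247 * ((x ^+ 6 + q ^+ 6) * q ^+ 2).
Proof.
have q2 : 0 <= q ^+ 2 by exact: sqr_ge0.
have mono a b : (a + b = 6)%N -> x ^+ a * q ^+ b <= x ^+ 6 + q ^+ 6.
  move=> ab; apply: le_trans (ler_norm _) _; rewrite normrM !normrX.
  have e6 (y : R) : y ^+ 6 = `|y| ^+ 6.
    by rewrite -[6%N]/(2 * 3)%N !exprM real_normK// num_real.
  rewrite (e6 x) (e6 q); case: (leP `|x| `|q|) => h.
  - rewrite (@le_trans _ _ (`|q| ^+ 6)) ?lerDr ?exprn_ge0// -ab exprD.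
    by apply: ler_wpM2r; [exact: exprn_ge0|apply: lerXn2r; rewrite ?nnegrE].
  - rewrite (@le_trans _ _ (`|x| ^+ 6)) ?lerDl ?exprn_ge0// -ab exprD.
    by apply: ler_wpM2l; [exact: exprn_ge0|apply: lerXn2r; rewrite ?nnegrE//; exact: ltW].
set B := x ^+ 6 + q ^+ 6 in mono *.
(* The terms with at least two factors q have coefficients summing to 2^8 - 1 - 8 = 247. The term
   linear in q is kept exact: its mean vanishes when q is a martingale increment. *)
have -> : (x + q) ^+ 8 = x ^+ 8 + 8 * (x ^+ 7 * q) +
  (28 * (x ^+ 6 * q ^+ 0) + 56 * (x ^+ 5 * q ^+ 1) + 70 * (x ^+ 4 * q ^+ 2) + 56 * (x ^+ 3 * q ^+ 3)
   + 28 * (x ^+ 2 * q ^+ 4) + 8 * (x ^+ 1 * q ^+ 5) + x ^+ 0 * q ^+ 6) * q ^+ 2 by ring.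
rewrite lerD2l [leRHS]mulrA; apply: ler_wpM2r => //.
have h60 := mono 6%N 0%N erefl; have h51 := mono 5%N 1%N erefl; have h42 := mono 4%N 2%N erefl.
have h33 := mono 3%N 3%N erefl; have h24 := mono 2%N 4%N erefl; have h15 := mono 1%N 5%N erefl.
have h06 := mono 0%N 6%N erefl.
move: h60 h51 h42 h33 h24 h15 h06; clear mono; clearbody B.
move: (x ^+ 6 * q ^+ 0) (x ^+ 5 * q ^+ 1) (x ^+ 4 * q ^+ 2) (x ^+ 3 * q ^+ 3)
 (x ^+ 2 * q ^+ 4) (x ^+ 1 * q ^+ 5) (x ^+ 0 * q ^+ 6) B => *; lra.
Qed.

(** One of the two terms suffices, according to whether n q^2 is below or above x^2. With n the
    number of time steps, the coefficient 1 / n of x^8 is what Gronwall's argument tolerates at each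
    step. *)
Lemma young62 {R : realFieldType} (n x q : R) : 0 < n ->
  x ^+ 6 * q ^+ 2 <= x ^+ 8 / n + n ^+ 3 * q ^+ 8.
Proof.
move=> n0; have x8 : 0 <= x ^+ 8 by rewrite -[8%N]/(2 * 4)%N exprM exprn_ge0// sqr_ge0.
have q8 : 0 <= q ^+ 8 by rewrite -[8%N]/(2 * 4)%N exprM exprn_ge0// sqr_ge0.
have x6 : 0 <= x ^+ 6 by rewrite -[6%N]/(2 * 3)%N exprM exprn_ge0// sqr_ge0.
have n30 : 0 <= n ^+ 3 * q ^+ 8 by apply: mulr_ge0 => //; rewrite exprn_ge0// ltW.
have xn0 : 0 <= x ^+ 8 / n by rewrite divr_ge0// ltW.
case: (leP (n * q ^+ 2) (x ^+ 2)) => h.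
- apply: (@le_trans _ _ (x ^+ 8 / n)); last by rewrite lerDl.
  by rewrite ler_pdivlMr// -mulrA [q ^+ 2 * n]mulrC -[8%N]/(6 + 2)%N exprD ler_wpM2l.
- apply: (@le_trans _ _ (n ^+ 3 * q ^+ 8)); last by rewrite lerDr.
  have -> : n ^+ 3 * q ^+ 8 = (n * q ^+ 2) ^+ 3 * q ^+ 2 by ring.
  apply: ler_wpM2r; first exact: sqr_ge0.
  rewrite -[6%N]/(2 * 3)%N exprM.
  apply: lerXn2r; rewrite ?nnegrE ?sqr_ge0//; last exact: ltW.
  by rewrite mulr_ge0 ?sqr_ge0// ltW.
Qed.

Lemma discrete_gronwall {R : realType} (m : nat -> R) (n : nat) (c D : R) : 0 <= c -> 0 <= D ->
  m 0%N = 0 -> (forall k, (k < n.+1)%N -> m k.+1 <= (1 + c / n.+1%:R) * m k + D) ->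
  m n.+1 <= expR c * (n.+1%:R * D).
Proof.
move=> c0 D0 m0 mS; set N := n.+1%:R : R; have N0 : 0 < N by rewrite ltr0n.
set a := 1 + c / N; have a1 : 1 <= a by rewrite lerDl divr_ge0// ltW.
have step k : (k <= n.+1)%N -> m k <= a ^+ k * (k%:R * D).
  elim: k => [_|k IH kn]; first by rewrite m0 mul0r mulr0.
  apply: le_trans (mS k kn) _; rewrite -/N -/a.
  have a0 : 0 <= a by rewrite (le_trans ler01).
  have := ler_wpM2l a0 (IH (ltnW kn)) => h.
  apply: (@le_trans _ _ (a * (a ^+ k * (k%:R * D)) + D)); first by rewrite lerD2r.
  rewrite -natr1 [(_ + 1) * D]mulrDl mul1r mulrDr mulrA -exprS lerD2l.
  by rewrite ler_peMl// exprn_ege1.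
apply: le_trans (step n.+1 (leqnn _)) _; apply: ler_wpM2r; first by rewrite mulr_ge0// ltW.
have -> : expR c = expR (c / N) ^+ n.+1.
  by rewrite -expRM_natl; congr expR; rewrite mulrC divfK// gt_eqF.
apply: lerXn2r; rewrite ?nnegrE ?expR_ge0 ?(le_trans ler01)//.
exact: expR_ge1Dx.
Qed.

Section OUPairMoments.
Context {d} {T : measurableType d} {R : realType} (P : probability T R)
  (lam : bool -> R) (U N : bool -> R -> T -> R) (past : R -> (T -> R) -> Prop)
  (ou : ou_pair P lam U N past).
Implicit Types (i j : bool) (G : T -> R).

Local Notation bracket := (bracket lam U).

Lemma ordp_bracket8 i : ordp P 8 0 (fun s t w => bracket i i t w - bracket i i s w).
Proof.
pose Z (s t : R) w := (U i t w * U i t w - U i s w * U i s w) +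
  (lam i + lam i) * pathint s t (fun r => U i r w * U i r w) - (t - s) * ((i == i)%:R * 2).
apply: (@ordp_ae _ _ _ P 8 0 _ Z).
- by move=> s t s0 st; apply: momentsB; apply: (bracket_moments ou) => //; rewrite (le_trans s0) ?ltW.
- move=> s t s0 st; apply: aeW => w; rewrite /bracket /Z.
  rewrite (@pathint_split _ 0 s t _ (lexx 0) s0 (ltW st)); last exact: (tame_cpos (tame_UU ou i i)).
  by ring.
- have oU := ordp_U ou 16 i.
  apply: ordpB.
    apply: ordpD.
      apply: ordpB.
        exact: (@ordpM _ _ _ P 8 0 0 _ _ (proj2 oU) (proj2 oU)).
      exact: (@ordpM _ _ _ P 8 0 0 _ _ (proj1 oU) (proj1 oU)).
    have oP := ordp_weaken (isT : 0 <= 8)%N (ordp_pathint 2%N (tame_UU ou i i)).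
    exact: (ordpZ (lam i + lam i) oP).
  apply: (@ordp_weaken _ _ _ P 8 0 8) => //.
  by apply: (@ordp_step _ _ _ P 8 0); apply: ordp_fixed; exact: moments_cst.
Qed.

(** An elementary substitute for the Burkholder-Davis-Gundy inequality. Cut [s, t] into N steps of
    length at most 1; the eighth moment m_k after k steps satisfies m_(k+1) <= (1 + c / N) m_k +
    O(N^3), because the term linear in the new increment has mean zero. Hence m_N = O(N^4). *)
Lemma bracket_moment8 i : exists2 K, 0 <= K & forall s t, 0 <= s -> s + 1 <= t ->
  mean P (fun w => (bracket i i t w - bracket i i s w) ^+ 8) <= K * (t - s) ^+ 4.
Proof.
have [_ [C C0 hC]] := ordp_bracket8 i.
pose c : R := 247.
exists (expR c * (2 * c * C) * 16) => [|s t s0 st].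
  by rewrite !mulr_ge0 ?expR_ge0 ?ler0n.
set L := t - s; have L1 : 1 <= L by rewrite lerBrDl.
(* The number of steps lies between L and 2 L, as 1 <= L: the steps have length at most 1 and the
   final bound loses the factor 2^4 = 16. *)
pose n := Num.trunc L; pose Nn : R := n.+1%:R.
have L0 : 0 <= L by rewrite (le_trans ler01).
have /andP[nL Ln] := truncn_itv L0.
have Nn0 : 0 < Nn by rewrite ltr0n.
have Nn1 : 1 <= Nn by rewrite ler1n.
have NnL : Nn <= 2 * L by rewrite /Nn -natr1; lra.
pose h := L / Nn; have h0 : 0 < h by rewrite divr_gt0// (lt_le_trans ltr01).
have h1 : h <= 1 by rewrite ler_pdivrMr// mul1r ltW.
pose m k := mean P (fun w => (bracket i i (s + k%:R * h) w - bracket i i s w) ^+ 8).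
have -> : mean P (fun w => (bracket i i t w - bracket i i s w) ^+ 8) = m n.+1.
  by rewrite /m -/Nn mulrC /h divfK ?gt_eqF// /L subrKC.
have D0 : 0 <= 2 * c * C * Nn ^+ 3 by rewrite !mulr_ge0 ?exprn_ge0 ?ler0n// ltW.
have c0 : 0 <= c by rewrite ler0n.
apply: le_trans (@discrete_gronwall R m n c _ c0 D0 _ _) _.
- rewrite /m (@mean_ext _ _ _ P _ (fun=> 0)) => [|w]; first by rewrite mean_cst.
  by rewrite mul0r addr0 subrr expr0n.
- move=> k _; rewrite /m.
  set u := s + k%:R * h; have -> : s + k.+1%:R * h = u + h by rewrite /u -natr1; ring.
  have u0 : 0 <= u by rewrite addr_ge0// mulr_ge0// ltW.
  have su : s <= u by rewrite lerDl mulr_ge0// ltW.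
  have uh : u < u + h by rewrite ltrDl.
  have uh0 : 0 <= u + h by rewrite addr_ge0// ltW.
  have m1 := bracket_moments ou i i u0; have m2 := bracket_moments ou i i uh0.
  have m3 := bracket_moments ou i i s0.
  pose x w := bracket i i u w - bracket i i s w.
  pose q w := bracket i i (u + h) w - bracket i i u w.
  have mx : moments P x by rewrite /x; solve_moments.
  have mq : moments P q by rewrite /q; solve_moments.
  have px : past u (fun w => x w ^+ 7).
    have px1 : past u x.
      have -> : x = (fun w => bracket i i u w + -1 * bracket i i s w).
        by apply/funext => w; rewrite mulN1r.
      apply: (pastD ou); first exact: (bracket_past ou).
      apply: (pastM ou); first exact: (past_cst ou).
      by apply: (past_mono ou s0 su); exact: (bracket_past ou).
    have pX k' : past u (fun w => x w ^+ k').
      elim: k' => [|k' IH]; first exact: (past_cst ou).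
      have -> : (fun w => x w ^+ k'.+1) = (fun w => x w * x w ^+ k').
        by apply/funext => w; rewrite exprS.
      exact: (pastM ou).
    exact: pX.
  have xq0 : mean P (fun w => x w ^+ 7 * q w) = 0.
    rewrite (@mean_ext _ _ _ P _ (fun w => x w ^+ 7 * bracket i i (u + h) w - x w ^+ 7 * bracket i i u w)) => [|w]; last by rewrite -mulrBr.
    rewrite meanB; [|solve_moments|solve_moments].
    by rewrite (bracket_martingale ou i i u0 (ltW uh) px) subrr.
  have e8 : mean P (fun w => q w ^+ 8) <= C.
    have := hC u (u + h) u0 uh; rewrite lerD2l expr0 mulr1 => /(_ h1).
    rewrite (@mean_ext _ _ _ P _ (fun w => q w ^+ 8))// => w.
    by rewrite -[8%N]/(2 * 4)%N !exprM real_normK// num_real.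
  have e80 : 0 <= mean P (fun w => q w ^+ 8).
    by apply: mean_ge0 => w; rewrite -[8%N]/(2 * 4)%N exprM exprn_ge0// sqr_ge0.
  apply: (@le_trans _ _ (mean P (fun w => (1 + c / Nn) * x w ^+ 8 + 8 * (x w ^+ 7 * q w) +
      (c * (Nn ^+ 3 + 1)) * q w ^+ 8))).
    apply: mean_le => [||w].
    + rewrite (_ : (fun w => _) = (fun w => (x w + q w) ^+ 8)); first by solve_moments.
      by apply/funext => w; rewrite /x /q; congr (_ ^+ 8); move: (bracket i i _ w) (bracket i i _ w) (bracket i i _ w) => ? ? ?; ring.
    + by solve_moments.
    + have -> : bracket i i (u + h) w - bracket i i s w = x w + q w.
        by rewrite /x /q; move: (bracket i i _ w) (bracket i i _ w) (bracket i i _ w) => ? ? ?; ring.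
      apply: le_trans (expand8_le _ _) _.
      have y := young62 (x w) (q w) Nn0; rewrite -subr_ge0.
      rewrite (_ : _ - _ = 247 * (x w ^+ 8 / Nn + Nn ^+ 3 * q w ^+ 8 - x w ^+ 6 * q w ^+ 2)).
        by rewrite mulr_ge0// subr_ge0.
      by rewrite /c; ring.
  rewrite meanD; [|solve_moments|solve_moments].
  rewrite meanD; [|solve_moments|solve_moments].
  rewrite !meanZ; [|solve_moments|solve_moments|solve_moments].
  rewrite xq0 mulr0 addr0 -/Nn lerD2l.
  have N3 : 1 <= Nn ^+ 3 by rewrite exprn_ege1.
  rewrite (_ : 2 * c * C * Nn ^+ 3 = c * (Nn ^+ 3 + Nn ^+ 3) * C); last by ring.
  apply: ler_pM => //; first by rewrite mulr_ge0// addr_ge0// (le_trans ler01).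
  by rewrite ler_wpM2l// lerD2l.
- rewrite -!mulrA ler_wpM2l ?expR_ge0// -/Nn.
  rewrite (_ : _ * _ = 2 * c * C * Nn ^+ 4); last by ring.
  rewrite [leRHS](_ : _ = 2 * c * C * (2 * L) ^+ 4); last by ring.
  rewrite ler_wpM2l ?mulr_ge0//.
  by apply: lerXn2r; rewrite ?nnegrE ?(ltW Nn0)// mulr_ge0.
Qed.

End OUPairMoments.

(** * Asymptotics of the score and of the plug-in error *)

Section OUPairAsymptotics.
Context {d} {T : measurableType d} {R : realType} (P : probability T R)
  (lam : bool -> R) (U N : bool -> R -> T -> R) (past : R -> (T -> R) -> Prop)
  (ou : ou_pair P lam U N past).
Implicit Types (i j : bool) (G X Y V : T -> R).

Local Notation M i := (bracket lam U i i).
Local Notation ucov := (ucov lam).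
Local Notation rt t := (Num.sqrt (Num.sqrt t)).

Lemma bracket_moment8_0 i : exists2 K, 0 <= K & forall t, 1 <= t ->
  mean P (fun w => M i t w ^+ 8) <= K * t ^+ 4.
Proof.
have [K K0 hK] := bracket_moment8 ou i; exists K => // t t1.
have := hK 0 t (lexx 0); rewrite add0r subr0 => /(_ t1).
rewrite (@mean_ext _ _ _ P _ (fun w => M i t w ^+ 8))// => w.
by rewrite bracket0 subr0.
Qed.

Lemma norm_mul3_le (x y v : R) : `|x * y * v| <= 2 + x ^+ 8 + y ^+ 8 + v ^+ 2.
Proof.
have sq2 (a b : R) : `|a * b| <= a ^+ 2 + b ^+ 2.
  rewrite normrM; have := norm_mulX_le a b 1%N; rewrite expr1 normrM mul1n.
  by rewrite !real_normK ?num_real.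
apply: le_trans (sq2 _ _) _; rewrite lerD2r exprMn.
have h1 := sq2 (x ^+ 2) (y ^+ 2); have h2 := sq2 1 (x ^+ 4); have h3 := sq2 1 (y ^+ 4).
apply: le_trans (ler_norm _) _; apply: le_trans h1 _.
have e (z : R) : z ^+ 2 ^+ 2 <= 1 + z ^+ 8.
  have -> : z ^+ 2 ^+ 2 = z ^+ 4 by ring.
  have := sq2 1 (z ^+ 4); rewrite mul1r expr1n => /(le_trans (ler_norm _)).
  by have -> : z ^+ 4 ^+ 2 = z ^+ 8 by ring.
by have := e x; have := e y; lra.
Qed.

(** The scale-free bound [norm_mul3_le] applied to X / p and Y / q, where p and q are the sizes of X
    and Y in L^8. *)
Lemma mean_mul3_le X Y V (p q a b c : R) : 0 < p -> 0 < q ->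
  moments P X -> moments P Y -> moments P V ->
  mean P (fun w => X w ^+ 8) <= a * p ^+ 8 -> mean P (fun w => Y w ^+ 8) <= b * q ^+ 8 ->
  mean P (fun w => V w ^+ 2) <= c ->
  `|mean P (fun w => X w * Y w * V w)| <= p * q * (2 + a + b + c).
Proof.
move=> p0 q0 mX mY mV hX hY hV.
have p8 : 0 < p ^+ 8 by rewrite exprn_gt0.
have q8 : 0 < q ^+ 8 by rewrite exprn_gt0.
have pq : 0 < p * q by rewrite mulr_gt0.
apply: le_trans (mean_norm (momentsM (momentsM mX mY) mV)) _.
apply: (@le_trans _ _ (mean P (fun w => p * q *
   (2 + (p ^+ 8)^-1 * X w ^+ 8 + (q ^+ 8)^-1 * Y w ^+ 8 + V w ^+ 2)))).
  apply: mean_le => [||w]; [solve_moments|solve_moments|].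
  have := norm_mul3_le (X w / p) (Y w / q) (V w).
  have -> : X w / p * (Y w / q) * V w = (p * q)^-1 * (X w * Y w * V w).
    by field; rewrite !gt_eqF.
  rewrite normrM ger0_norm ?invr_ge0 ?(ltW pq)// mulrC ler_pdivrMr// !exprMn !exprVn.
  by rewrite [_ * (p * q)]mulrC [X w ^+ 8 / _]mulrC [Y w ^+ 8 / _]mulrC.
rewrite meanZ; [|solve_moments].
rewrite meanD; [|solve_moments|solve_moments].
rewrite meanD; [|solve_moments|solve_moments].
rewrite meanD; [|solve_moments|solve_moments].
rewrite mean_cst !meanZ; [|solve_moments|solve_moments].
rewrite ler_pM2l//; apply: lerD => //; apply: lerD; first apply: lerD => //.
- by rewrite mulrC ler_pdivrMr.
- by rewrite mulrC ler_pdivrMr.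
Qed.

Lemma U_moment_bound i n : exists2 K, 0 <= K & forall t, 0 <= t ->
  mean P (fun w => U i t w ^+ n) <= K.
Proof.
have [C hC] := tame_bound (U_tame ou i) n.
have C0 : 0 <= C by apply: le_trans (hC 0 (lexx 0)); apply: mean_ge0 => w; exact: exprn_ge0.
exists C => // t t0; apply: le_trans (hC t t0).
have mU := U_moments ou i t0.
apply: mean_le => [||w]; [solve_moments|solve_moments|].
by rewrite -normrX ler_norm.
Qed.

Lemma UU_moment2 i j (c : R) : exists2 K, 0 <= K & forall t, 0 <= t ->
  mean P (fun w => (U i t w * U j t w - c) ^+ 2) <= K.
Proof.
have [C hC] := tame_bound (tameB (tame_UU ou i j) (tame_cst P c)) 2.
have C0 : 0 <= C by apply: le_trans (hC 0 (lexx 0)); apply: mean_ge0 => w; exact: exprn_ge0.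
exists C => // t t0; apply: le_trans (hC t t0).
rewrite (@mean_ext _ _ _ P _ (fun w => `|U i t w * U j t w - c| ^+ 2))// => w.
by rewrite real_normK// num_real.
Qed.

(* [M_t] and [U_t] decouple: over the last [sqrt t] units of time [M] hardly
   moves, while [U] forgets its past. *)
Lemma mean_bracketM_UU i j : exists2 K, 0 <= K & forall t, 4 <= t ->
  `|mean P (fun w => M i t w * M j t w * (U i t w * U j t w)) / t - 8 * ucov i j ^+ 2| <= K / rt t.
Proof.
have [Ki Ki0 hKi] := bracket_moment8 ou i; have [Kj Kj0 hKj] := bracket_moment8 ou j.
have [C C0 hC] := UU_moment2 i j (ucov i j).
pose L := lam i + lam j; have L0 : 0 < L by rewrite addr_gt0// (lam_gt0 ou).
pose K := 2 + Ki + Kj + C.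
have K0 : 0 <= K by rewrite !addr_ge0.
exists (K / L + K + K + K) => [|t t4]; first by rewrite !addr_ge0// divr_ge0// ltW.
have t0 : 0 < t by rewrite (lt_le_trans _ t4).
(* With r = t^(1/4) the window has length r^2; [A] is of size r^2 in L^8 and [mu] of size r. Every
   error term below is then O(r^3) = O(t / r). The assumption 4 <= t gives 1 <= s and s + 1 <= t, as
   the eighth-moment bounds require. *)
set r := rt t; have r0 : 0 < r by rewrite !sqrtr_gt0.
have r2 : r ^+ 2 = Num.sqrt t by rewrite sqr_sqrtr// sqrtr_ge0.
have r4 : r ^+ 4 = t by rewrite -[4%N]/(2 * 2)%N exprM r2 sqr_sqrtr// ltW.
have r22 : 2 <= r ^+ 2.
  rewrite r2 -[leLHS](@ger0_norm R)// -sqrtr_sqr; apply: ler_wsqrtr.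
  by rewrite (le_trans _ t4)// -natrX ler_nat.
have r1 : 1 <= r.
  rewrite -(@ler_pXn2r _ 2%N)// ?nnegrE ?(ltW r0)// expr1n.
  by rewrite (le_trans _ r22)// ler1n.
have r42 : r ^+ 2 + r ^+ 2 <= r ^+ 4.
  rewrite -[4%N]/(2 * 2)%N exprM [leRHS]expr2 -mulr2n -mulr_natl ler_pM2r// exprn_gt0//.
pose s := t - r ^+ 2.
have s2 : 2 <= s by rewrite /s -r4; lra.
have s0 : 0 <= s by rewrite (le_trans _ s2).
have st : s <= t by rewrite /s lerBlDr lerDl sqr_ge0.
have ts : t - s = r ^+ 2 by rewrite /s; ring.
have sr4 : s <= r ^+ 4 by rewrite r4.
have s1t : s + 1 <= t by rewrite -lerBrDl ts; lra.
pose A k w := M k s w; pose mu k w := M k t w - M k s w.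
pose V w := U i t w * U j t w - ucov i j.
pose Vs w := U i s w * U j s w - ucov i j.
have mA k : moments P (A k) by exact: (bracket_moments ou).
have mMt k : moments P (M k t) by apply: (bracket_moments ou); exact: ltW.
have mmu k : moments P (mu k) by exact: momentsB (mMt k) (mA k).
have mUU := tame_moments (tame_UU ou i j).
have mV : moments P V by exact: momentsB (mUU t (ltW t0)) (moments_cst P _).
have mVs : moments P Vs by exact: momentsB (mUU s s0) (moments_cst P _).
have hA k Kk : (forall s t, 0 <= s -> s + 1 <= t -> mean P (fun w => (M k t w - M k s w) ^+ 8) <= Kk * (t - s) ^+ 4) ->
    0 <= Kk -> mean P (fun w => A k w ^+ 8) <= Kk * (r ^+ 2) ^+ 8.
  move=> h Kk0; have := h 0 s (lexx 0); rewrite add0r subr0 => /(_ (le_trans _ s2)) => /(_ ltac:(by rewrite ler1n)).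
  rewrite (@mean_ext _ _ _ P _ (fun w => A k w ^+ 8)) => [|w]; last by rewrite bracket0 subr0.
  move=> /le_trans; apply; apply: ler_wpM2l => //.
  have -> : (r ^+ 2) ^+ 8 = (r ^+ 4) ^+ 4 by rewrite -!exprM.
  by apply: lerXn2r; rewrite ?nnegrE// exprn_ge0// ltW.
have hmu k Kk : (forall s t, 0 <= s -> s + 1 <= t -> mean P (fun w => (M k t w - M k s w) ^+ 8) <= Kk * (t - s) ^+ 4) ->
    mean P (fun w => mu k w ^+ 8) <= Kk * r ^+ 8.
  by move=> /(_ s t s0 s1t); rewrite ts -exprM.
have hAi := hA i Ki hKi Ki0; have hAj := hA j Kj hKj Kj0.
have hmi := hmu i Ki hKi; have hmj := hmu j Kj hKj.
have rr0 : 0 < r ^+ 2 by rewrite exprn_gt0.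
have e0 : `|mean P (fun w => A i w * A j w * V w)| <= K / L * r ^+ 3.
  have pA : past s (fun w => A i w * A j w).
    by apply: (pastM ou); exact: (bracket_past ou).
  rewrite (mean_past_UU ou i j s0 st pA) -/Vs normrM ger0_norm ?expR_ge0// ts -/L.
  have h2 := mean_mul3_le rr0 rr0 (mA i) (mA j) mVs hAi hAj (hC s s0).
  apply: le_trans (ler_wpM2l (expR_ge0 _) h2) _; rewrite -/K.
  (* The decay exp(- x) <= 1 / x is enough here: it reduces the size r^4 of [A i * A j] to r^2. *)
  have h3 : expR (- L * r ^+ 2) <= (L * r ^+ 2)^-1.
    rewrite mulNr expRN lef_pV2 ?posrE ?expR_gt0 ?mulr_gt0//.
    by apply: le_trans (expR_ge1Dx _); rewrite lerDr.
  apply: le_trans (ler_wpM2r _ h3) _; first by apply: mulr_ge0 => //; exact: mulr_ge0 (ltW rr0) (ltW rr0).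
  have -> : (L * r ^+ 2)^-1 * (r ^+ 2 * r ^+ 2 * K) = K / L * r ^+ 2.
    by field; rewrite !gt_eqF.
  by apply: ler_wpM2l; [rewrite divr_ge0// ltW|rewrite ler_weXn2l].
have e1 := mean_mul3_le rr0 r0 (mA i) (mmu j) mV hAi hmj (hC t (ltW t0)).
have e2 := mean_mul3_le r0 rr0 (mmu i) (mA j) mV hmi hAj (hC t (ltW t0)).
have e3 := mean_mul3_le r0 r0 (mmu i) (mmu j) mV hmi hmj (hC t (ltW t0)).
have mAi := mA i; have mAj := mA j; have mmi := mmu i; have mmj := mmu j.
have mMi := mMt i; have mMj := mMt j.
have key : mean P (fun w => M i t w * M j t w * (U i t w * U j t w)) =
  mean P (fun w => A i w * A j w * V w) + mean P (fun w => A i w * mu j w * V w) +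
  mean P (fun w => mu i w * A j w * V w) + mean P (fun w => mu i w * mu j w * V w) +
  8 * ucov i j ^+ 2 * t.
  have -> : 8 * ucov i j ^+ 2 * t = mean P (fun w => ucov i j * (M i t w * M j t w)).
    rewrite meanZ; [|solve_moments].
    by rewrite (mean_bracketM ou i j (ltW t0)); ring.
  rewrite -!meanD; try solve_moments.
  apply: mean_ext => w; rewrite /A /mu /V.
  by move: (M i t w) (M j t w) (M i s w) (M j s w) => ? ? ? ?; ring.
rewrite key.
set a0 := mean P _ in e0 *; set a1 := mean P _ in e1 *; set a2 := mean P _ in e2 *; set a3 := mean P _ in e3 *.
have -> : (a0 + a1 + a2 + a3 + 8 * ucov i j ^+ 2 * t) / t - 8 * ucov i j ^+ 2 = (a0 + a1 + a2 + a3) / t.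
  by field; rewrite gt_eqF.
rewrite normrM [`|t^-1|]ger0_norm ?invr_ge0 ?(ltW t0)// ler_pdivrMr//.
have -> : (K / L + K + K + K) / r * t = (K / L + K + K + K) * r ^+ 3.
  by rewrite -r4; field; rewrite !gt_eqF.
have r3 : r * r <= r ^+ 3 by rewrite -expr2 ler_weXn2l.
rewrite -/K in e1 e2 e3; clearbody K; rewrite !mulrDl.
apply: le_trans (ler_normD _ _) _; apply: lerD; last first.
  by apply: le_trans e3 _; rewrite [leRHS]mulrC; apply: ler_wpM2r.
apply: le_trans (ler_normD _ _) _; apply: lerD; last first.
  by apply: le_trans e2 _; rewrite [leRHS]mulrC -exprS.
apply: le_trans (ler_normD _ _) _; apply: lerD => //.
by apply: le_trans e1 _; rewrite [leRHS]mulrC -exprSr.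
Qed.

(** The derivative of the log-likelihood in the eigenvalue [lam k], with the time integral
    eliminated in favour of [M k]. *)
Definition score_coord k t w : R := (2 * lam k)^-1 - M k t w / 4 - U k 0 w ^+ 2 / 2.

(** The terms [- M / 4] contribute 8 ucov t / 16. The rest of each score is bounded in L^2, so the
    cross terms are O(sqrt t) by Young's inequality with weight t^(1/2) or t^(-1/2). *)
Lemma mean_score i j : exists2 K, 0 <= K & forall t, 1 <= t ->
  `|mean P (fun w => score_coord i t w * score_coord j t w) / t - ucov i j / 2| <= K / Num.sqrt t.
Proof.
pose b k w := (2 * lam k)^-1 - U k 0 w ^+ 2 / 2.
have mb k : moments P (b k).
  by have mU0 := U_moments ou k (lexx 0); rewrite /b; solve_moments.
pose Kb k := mean P (fun w => b k w ^+ 2).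
have Kb0 k : 0 <= Kb k by apply: mean_ge0 => w; exact: sqr_ge0.
have u0 k : 0 <= ucov k k by rewrite /ucov divr_ge0// ltW// (lam_gt0 ou).
exists ((8 * ucov i i + Kb j) + (Kb i + 8 * ucov j j) + (Kb i + Kb j)) => [|t t1].
  by rewrite !addr_ge0// mulr_ge0.
have t0 : 0 < t by rewrite (lt_le_trans ltr01).
set r := Num.sqrt t; have r0 : 0 < r by rewrite sqrtr_gt0.
have r1 : 1 <= r by rewrite /r -[leLHS]sqrtr1; exact: ler_wsqrtr.
have rr : r * r = t by rewrite -expr2 sqr_sqrtr// ltW.
have mM k : moments P (M k t) by apply: (bracket_moments ou); exact: ltW.
have hM2 k : mean P (fun w => M k t w ^+ 2) = 8 * ucov k k * t.
  by rewrite -(mean_bracketM ou k k (ltW t0)); apply: mean_ext => w; rewrite expr2.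
have mMi := mM i; have mMj := mM j; have mbi := mb i; have mbj := mb j.
have key : mean P (fun w => score_coord i t w * score_coord j t w) =
  8 * ucov i j * t / 16 + (- 4^-1 * mean P (fun w => M i t w * b j w) +
    - 4^-1 * mean P (fun w => b i w * M j t w) + mean P (fun w => b i w * b j w)).
  rewrite -(mean_bracketM ou i j (ltW t0)) -[_ / 16]mulrC.
  rewrite -!meanZ; try solve_moments.
  rewrite -!meanD; try solve_moments.
  by apply: mean_ext => w; rewrite /score_coord /b; move: (M i t w) (M j t w) => ? ?; field; rewrite !gt_eqF// (lam_gt0 ou).
rewrite key; set a1 := mean P (fun w => M i t w * b j w); set a2 := mean P (fun w => b i w * M j t w).
set a3 := mean P (fun w => b i w * b j w).
have ri : 0 < r^-1 by rewrite invr_gt0.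
have h1 : `|a1| <= (8 * ucov i i + Kb j) * r.
  apply: le_trans (mean_norm (momentsM (mM i) (mb j))) _.
  apply: le_trans (mean_young ri (mM i) (mb j)) _; rewrite hM2 invrK -rr -/(Kb j).
  by rewrite (_ : _ + _ = (8 * ucov i i + Kb j) * r)//; field; rewrite gt_eqF.
have h2 : `|a2| <= (Kb i + 8 * ucov j j) * r.
  apply: le_trans (mean_norm (momentsM (mb i) (mM j))) _.
  apply: le_trans (mean_young r0 (mb i) (mM j)) _; rewrite hM2 -rr -/(Kb i).
  by rewrite (_ : _ + _ = (Kb i + 8 * ucov j j) * r)//; field; rewrite gt_eqF.
have h3 : `|a3| <= (Kb i + Kb j) * r.
  apply: le_trans (mean_mul_le (mb i) (mb j)) _.
  by rewrite -/(Kb i) -/(Kb j) ler_peMr// addr_ge0.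
have -> : (8 * ucov i j * t / 16 + (- 4^-1 * a1 + - 4^-1 * a2 + a3)) / t - ucov i j / 2 =
  (- 4^-1 * a1 + - 4^-1 * a2 + a3) / t by field; rewrite gt_eqF.
rewrite normrM [`|t^-1|]ger0_norm ?invr_ge0 ?(ltW t0)// ler_pdivrMr// -rr.
rewrite (_ : _ / r * (r * r) = (8 * ucov i i + Kb j) * r + (Kb i + 8 * ucov j j) * r + (Kb i + Kb j) * r); last first.
  by field; rewrite gt_eqF.
have q : `|- 4^-1| <= 1 :> R by rewrite normrN ger0_norm ?invr_ge0// invf_le1// ler1n.
have qq (x y : R) : `|x| <= y -> `|- 4^-1 * x| <= y.
  by move=> xy; rewrite normrM (le_trans _ xy)// ler_piMl.
apply: le_trans (ler_normD _ _) _; apply: lerD => //.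
by apply: le_trans (ler_normD _ _) _; apply: lerD; exact: qq.
Qed.

Section PlugIn.
(** [D i t] stands for exp(- h hat_i) - exp(- h lam_i). It is used only through its boundedness,
    which provides its moments, and its linear approximation by [kap i * M i t / t]. *)
Variables (kap : bool -> R) (C : R) (D : bool -> R -> T -> R).
Hypothesis D_meas : forall i t, 1 <= t -> measurable_fun setT (D i t).
Hypothesis D_le1 : forall i t w, `|D i t w| <= 1.
Hypothesis D_lin : forall i t, 1 <= t -> \forall w \ae P,
  `|D i t w - kap i * M i t w / t| <=
  C * (1 + M i t w ^+ 2 / t + U i t w ^+ 4 + U i 0 w ^+ 4) / t.

Let e i t w := D i t w * U i t w - kap i * M i t w / t * U i t w.

Let D_moments i t : 1 <= t -> moments P (D i t).
Proof. by move=> t1; apply: moments_bounded (D_meas i t1) (D_le1 i t). Qed.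

Let e_moments i t : 1 <= t -> moments P (e i t).
Proof.
move=> t1; have t0 : 0 <= t by rewrite (le_trans ler01).
have mM := bracket_moments ou i i t0; have mU := U_moments ou i t0.
by have mD := D_moments i t1; rewrite /e; solve_moments.
Qed.

(** The remainder is 1 / t times a polynomial in M / sqrt t, U(t) and U(0) with bounded moments. Its
    square contains M^4 U^2 / t^2, which is split into M^8 / t^4 + U^4: here the eighth moment of M
    is used. *)
Lemma sqr_mean_e i : exists2 K, 0 <= K & forall t, 1 <= t ->
  mean P (fun w => e i t w ^+ 2) <= K / t ^+ 2.
Proof.
have [K8 K80 hK8] := bracket_moment8_0 i.
have [B2 B20 hB2] := U_moment_bound i 2; have [B4 B40 hB4] := U_moment_bound i 4.
have [B10 B100 hB10] := U_moment_bound i 10; have [B16 B160 hB16] := U_moment_bound i 16.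
exists (C ^+ 2 * 4 * (B2 + (K8 + B4) + B10 + (B16 + B4))) => [|t t1].
  by rewrite mulr_ge0 ?addr_ge0// mulr_ge0// sqr_ge0.
have t0 : 0 < t by rewrite (lt_le_trans ltr01).
have mM := bracket_moments ou i i (ltW t0); have mU := U_moments ou i (ltW t0).
have mU0 := U_moments ou i (lexx 0).
have me := e_moments i t1.
pose Q w := C ^+ 2 * 4 / t ^+ 2 * (U i t w ^+ 2 + (t ^- 4 * M i t w ^+ 8 + U i t w ^+ 4) +
  U i t w ^+ 10 + (U i 0 w ^+ 16 + U i t w ^+ 4)).
apply: (@le_trans _ _ (mean P Q)).
  apply: mean_le_ae; [solve_moments|rewrite /Q; solve_moments|].
  apply: filterS (D_lin i t1) => w h.
  pose m := M i t w; pose u := U i t w; pose v := U i 0 w; pose z := m ^+ 2 / t.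
  have h2 : e i t w ^+ 2 <= (C * (1 + z + u ^+ 4 + v ^+ 4) / t) ^+ 2 * u ^+ 2.
    rewrite /e -mulrBl exprMn; apply: ler_wpM2r; first exact: sqr_ge0.
    rewrite -[leLHS]real_normK ?num_real//.
    apply: lerXn2r; rewrite ?nnegrE//; exact: le_trans h.
  apply: le_trans h2 _; rewrite /Q -/m -/u -/v.
  have h3 : (1 + z + u ^+ 4 + v ^+ 4) ^+ 2 <= 4 * (1 + z ^+ 2 + u ^+ 8 + v ^+ 8).
    have -> : u ^+ 8 = u ^+ 4 ^+ 2 by ring.
    have -> : v ^+ 8 = v ^+ 4 ^+ 2 by ring.
    clearbody z; move: (u ^+ 4) (v ^+ 4) => b c.
    have := sqr_ge0 (1 - z); have := sqr_ge0 (1 - b); have := sqr_ge0 (1 - c).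
    have := sqr_ge0 (z - b); have := sqr_ge0 (z - c); have := sqr_ge0 (b - c).
    by nra.
  have -> : (C * (1 + z + u ^+ 4 + v ^+ 4) / t) ^+ 2 * u ^+ 2 =
    C ^+ 2 / t ^+ 2 * ((1 + z + u ^+ 4 + v ^+ 4) ^+ 2 * u ^+ 2).
    by field; rewrite gt_eqF.
  have -> : C ^+ 2 * 4 / t ^+ 2 = C ^+ 2 / t ^+ 2 * 4 by ring.
  rewrite -[leRHS]mulrA; apply: ler_wpM2l; first by rewrite divr_ge0 ?sqr_ge0 ?exprn_ge0 ?(ltW t0).
  apply: le_trans (ler_wpM2r (sqr_ge0 u) h3) _.
  rewrite -mulrA ler_pM2l// !mulrDl mul1r.
  have prod_le (a b : R) : a * b <= a ^+ 2 + b ^+ 2.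
    by have := sqr_ge0 (a - b); have := sqr_ge0 (a + b); nra.
  have -> : t ^- 4 * m ^+ 8 = z ^+ 2 ^+ 2 by rewrite /z; field; rewrite gt_eqF.
  have -> : v ^+ 16 = v ^+ 8 ^+ 2 by ring.
  have -> : u ^+ 4 = u ^+ 2 ^+ 2 by ring.
  by rewrite -exprD; apply: lerD => //; apply: lerD => //; apply: lerD.
rewrite /Q meanZ; [|solve_moments].
rewrite meanD; [|solve_moments|solve_moments].
rewrite meanD; [|solve_moments|solve_moments].
rewrite meanD; [|solve_moments|solve_moments].
rewrite meanD; [|solve_moments|solve_moments].
rewrite meanD; [|solve_moments|solve_moments].
rewrite !meanZ; [|solve_moments].
rewrite [leRHS]mulrAC; apply: ler_wpM2l; first by rewrite mulr_ge0 ?invr_ge0 ?exprn_ge0 ?(ltW t0)// mulr_ge0// sqr_ge0.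
apply: lerD; last by apply: lerD; [exact: hB16 (lexx 0)|exact: hB4 (ltW t0)].
apply: lerD; last exact: hB10 (ltW t0).
apply: lerD; first exact: hB2 (ltW t0).
apply: lerD; last exact: hB4 (ltW t0).
by rewrite mulrC ler_pdivrMr ?exprn_gt0//; exact: hK8.
Qed.

Lemma sqr_mean_linear i : exists2 K, 0 <= K & forall t, 1 <= t ->
  mean P (fun w => (kap i * M i t w / t * U i t w) ^+ 2) <= K / t.
Proof.
have [K8 K80 hK8] := bracket_moment8_0 i.
have [B4 B40 hB4] := U_moment_bound i 4.
exists (kap i ^+ 2 * (1 + K8 + B4)) => [|t t1].
  by rewrite mulr_ge0 ?sqr_ge0// !addr_ge0.
have t0 : 0 < t by rewrite (lt_le_trans ltr01).
have mM := bracket_moments ou i i (ltW t0); have mU := U_moments ou i (ltW t0).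
pose Q w := kap i ^+ 2 / t * (1 + t ^- 4 * M i t w ^+ 8 + U i t w ^+ 4).
apply: (@le_trans _ _ (mean P Q)).
  apply: mean_le => [||w]; [solve_moments|rewrite /Q; solve_moments|].
  rewrite /Q; move: (M i t w) (U i t w) => m u.
  pose x := m ^+ 2 / t.
  have -> : (kap i * m / t * u) ^+ 2 = kap i ^+ 2 / t * (x * u ^+ 2).
    by rewrite /x; field; rewrite gt_eqF.
  have -> : t ^- 4 * m ^+ 8 = x ^+ 4 by rewrite /x; field; rewrite gt_eqF.
  apply: ler_wpM2l; first by rewrite divr_ge0 ?sqr_ge0 ?(ltW t0).
  have -> : u ^+ 4 = u ^+ 2 ^+ 2 by ring.
  have -> : x ^+ 4 = x ^+ 2 ^+ 2 by ring.
  have := sqr_ge0 (x - u ^+ 2); have := sqr_ge0 (x ^+ 2 - 1).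
  have := sqr_ge0 (x ^+ 2); have := sqr_ge0 (u ^+ 2).
  by move: x (u ^+ 2) => a b; nra.
rewrite /Q meanZ; [|solve_moments].
rewrite meanD; [|solve_moments|solve_moments].
rewrite meanD; [|solve_moments|solve_moments].
rewrite mean_cst meanZ; [|solve_moments].
rewrite [leRHS]mulrAC; apply: ler_wpM2l; first by rewrite divr_ge0 ?sqr_ge0 ?(ltW t0).
apply: lerD; last exact: hB4 (ltW t0).
rewrite lerD2l mulrC ler_pdivrMr ?exprn_gt0//; exact: hK8.
Qed.

(** D U = y + e, where the linear part y has size t^(-1/2) in L^2 and the error e size t^(-1).
    Young's inequality weighted by sqrt t makes the cross terms O(t^(-3/2)), negligible after
    multiplication by t, and E(y_i y_j) is given by [mean_bracketM_UU]. *)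
Lemma mean_plugin i j : exists2 K, 0 <= K & forall t, 4 <= t ->
  `|t * mean P (fun w => D i t w * D j t w * (U i t w * U j t w)) -
    8 * kap i * kap j * ucov i j ^+ 2| <= K / rt t.
Proof.
have [Ei Ei0 hEi] := sqr_mean_e i; have [Ej Ej0 hEj] := sqr_mean_e j.
have [Yi Yi0 hYi] := sqr_mean_linear i; have [Yj Yj0 hYj] := sqr_mean_linear j.
have [K K0 hK] := mean_bracketM_UU i j.
exists ((Ei + Yj) + (Ej + Yi) + (Ei + Ej) + `|kap i * kap j| * K) => [|t t4].
  by rewrite !addr_ge0// mulr_ge0.
have t1 : 1 <= t by rewrite (le_trans _ t4)// ler1n.
have t0 : 0 < t by rewrite (lt_le_trans ltr01).
set q := Num.sqrt t; have q0 : 0 < q by rewrite sqrtr_gt0.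
have q1 : 1 <= q by rewrite /q -[leLHS]sqrtr1; exact: ler_wsqrtr.
have qq : q ^+ 2 = t by rewrite sqr_sqrtr// ltW.
set r := Num.sqrt q; have r0 : 0 < r by rewrite sqrtr_gt0.
have r1 : 1 <= r by rewrite /r -[leLHS]sqrtr1; exact: ler_wsqrtr.
have rq : r <= q by rewrite -[q](@sqr_sqrtr R) ?(ltW q0)// -/r expr2 ler_peMr// ltW.
have mMi := bracket_moments ou i i (ltW t0); have mMj := bracket_moments ou j j (ltW t0).
have mUi := U_moments ou i (ltW t0); have mUj := U_moments ou j (ltW t0).
have mDi := D_moments i t1; have mDj := D_moments j t1.
have mei := e_moments i t1; have mej := e_moments j t1.
pose y k w := kap k * M k t w / t * U k t w.
have myi : moments P (y i) by rewrite /y; solve_moments.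
have myj : moments P (y j) by rewrite /y; solve_moments.
have key : mean P (fun w => D i t w * D j t w * (U i t w * U j t w)) =
  mean P (fun w => e i t w * y j w) + mean P (fun w => y i w * e j t w) +
  mean P (fun w => e i t w * e j t w) +
  kap i * kap j / t ^+ 2 * mean P (fun w => M i t w * M j t w * (U i t w * U j t w)).
  rewrite -meanZ; [|solve_moments].
  rewrite -!meanD; try solve_moments.
  apply: mean_ext => w; rewrite /e /y; move: (M i t w) (M j t w) => ? ?.
  by field; rewrite gt_eqF.
have := hK t t4; set A := mean P (fun w => M i t w * M j t w * (U i t w * U j t w)) in key * => hA.
rewrite key; set a1 := mean P _; set a2 := mean P _; set a3 := mean P _.
have -> : t * (a1 + a2 + a3 + kap i * kap j / t ^+ 2 * A) - 8 * kap i * kap j * ucov i j ^+ 2 =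
  t * a1 + t * a2 + t * a3 + kap i * kap j * (A / t - 8 * ucov i j ^+ 2).
  by field; rewrite gt_eqF.
have qr : q^-1 <= r^-1 by rewrite lef_pV2.
have tr : t^-1 <= r^-1.
  by rewrite lef_pV2// (le_trans rq)// -qq expr2 ler_peMr// ltW.
have tn (a : R) : `|t * a| = t * `|a| by rewrite normrM ger0_norm// ltW.
have h1 : `|t * a1| <= (Ei + Yj) / r.
  rewrite tn; apply: (@le_trans _ _ ((Ei + Yj) / q)); last by rewrite ler_wpM2l// addr_ge0.
  rewrite -ler_pdivlMl//.
  apply: le_trans (mean_norm (momentsM mei myj)) _; apply: le_trans (mean_young q0 mei myj) _.
  apply: (@le_trans _ _ (q * (Ei / t ^+ 2) + q^-1 * (Yj / t))).
    by apply: lerD; (apply: ler_wpM2l; first by rewrite ?invr_ge0 ltW); [exact: hEi|exact: hYj].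
  by rewrite (_ : _ + _ = t^-1 * ((Ei + Yj) / q))// -qq; field; rewrite gt_eqF.
have h2 : `|t * a2| <= (Ej + Yi) / r.
  rewrite tn; apply: (@le_trans _ _ ((Ej + Yi) / q)); last by rewrite ler_wpM2l// addr_ge0.
  rewrite -ler_pdivlMl//.
  have qi : 0 < q^-1 by rewrite invr_gt0.
  apply: le_trans (mean_norm (momentsM myi mej)) _; apply: le_trans (mean_young qi myi mej) _.
  apply: (@le_trans _ _ (q^-1 * (Yi / t) + q * (Ej / t ^+ 2))).
    by rewrite invrK; apply: lerD; (apply: ler_wpM2l; first by rewrite ?invr_ge0 ltW); [exact: hYi|exact: hEj].
  by rewrite (_ : _ + _ = t^-1 * ((Ej + Yi) / q))// -qq; field; rewrite gt_eqF.
have h3 : `|t * a3| <= (Ei + Ej) / r.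
  rewrite tn; apply: (@le_trans _ _ ((Ei + Ej) / t)); last by rewrite ler_wpM2l// addr_ge0.
  rewrite -ler_pdivlMl//; apply: le_trans (mean_mul_le mei mej) _.
  rewrite (_ : t^-1 * ((Ei + Ej) / t) = Ei / t ^+ 2 + Ej / t ^+ 2); last by field; rewrite gt_eqF.
  by apply: lerD; [exact: hEi|exact: hEj].
have h4 : `|kap i * kap j * (A / t - 8 * ucov i j ^+ 2)| <= `|kap i * kap j| * K / r.
  by rewrite normrM -mulrA ler_wpM2l.
move: h4; set a4 := kap i * kap j * (A / t - 8 * ucov i j ^+ 2) => h4; clearbody a4.
set k1 := Ei + Yj in h1 *; set k2 := Ej + Yi in h2 *; set k3 := Ei + Ej in h3 *.
set k4 := `|kap i * kap j| * K in h4 *; clearbody k1 k2 k3 k4; rewrite !mulrDl.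
apply: le_trans (ler_normD _ _) _; apply: lerD => //.
apply: le_trans (ler_normD _ _) _; apply: lerD => //.
by apply: le_trans (ler_normD _ _) _; apply: lerD.
Qed.

End PlugIn.

End OUPairAsymptotics.

(** * Linearization of the likelihood equation *)

Lemma expR_tangent {R : realType} (u v : R) : 0 <= u -> 0 <= v ->
  `|expR (- v) - expR (- u) + expR (- u) * (v - u)| <= (v - u) ^+ 2.
Proof.
move=> u0 v0; case: (leP u v) => uv.
  have -> : - v = - u + - (v - u) by ring.
  rewrite expRD.
  rewrite (_ : _ + _ = expR (- u) * (expR (- (v - u)) - (1 - (v - u)))); last by ring.
  have q := @expR_euler_err R (v - u) ltac:(by rewrite subr_ge0).
  rewrite normrM ger0_norm ?expR_ge0// (le_trans _ q)// ler_piMl//.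
  by rewrite -expR0 ler_expR oppr_le0.
pose z := u - v; have z0 : 0 <= z by rewrite subr_ge0 ltW.
have eu : expR (- u) = expR (- v) * expR (- z) by rewrite -expRD /z; congr expR; ring.
rewrite eu (_ : _ + _ = expR (- v) * (1 - (1 + z) * expR (- z))); last by rewrite /z; ring.
have -> : (v - u) ^+ 2 = z ^+ 2 by rewrite /z; ring.
have ee : expR z * expR (- z) = 1 by rewrite -expRD subrr expR0.
have e2 : (1 + z) * expR (- z) <= 1.
  by rewrite -[leRHS]ee ler_wpM2r ?expR_ge0// expR_ge1Dx.
have e3 : 1 - z ^+ 2 <= (1 + z) * expR (- z).
  rewrite (_ : 1 - z ^+ 2 = (1 + z) * (1 - z)); last by ring.
  by apply: ler_wpM2l; [exact: addr_ge0|exact: expR_ge1Dx].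
rewrite normrM !ger0_norm ?expR_ge0 ?subr_ge0//.
rewrite (@le_trans _ _ (1 - (1 + z) * expR (- z)))//; last by lra.
by rewrite ler_piMl ?subr_ge0// -expR0 ler_expR oppr_le0.
Qed.

(* [x], [y] stand for the squares at both ends of the path, [A] for the time
   integral of the square; the hypothesis on [ah] is the likelihood equation. *)
Lemma likelihood_eq_linearization {R : realType} (h a : R) : 0 < h -> 0 < a ->
  exists C : R, forall t x y A ah : R, 1 <= t -> 0 <= x -> 0 <= y -> 0 <= A -> 0 < ah ->
  (2 * ah)^-1 + t / 2 - (x + y) / 4 - ah * A / 2 = 0 ->
  let M := y - x + 2 * a * A - 2 * t in
  `|expR (- h * ah) - expR (- h * a) - h * a * expR (- h * a) / 2 * M / t| <=
  C * (1 + M ^+ 2 / t + y ^+ 2 + x ^+ 2) / t.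
Proof.
move=> h0 a0.
have ha0 : 0 < h * a by rewrite mulr_gt0.
pose cS := 3 * ((4 * a ^+ 2)^-1 + 1); pose k := h * a.
have cS0 : 0 <= cS by rewrite mulr_ge0// addr_ge0// invr_ge0 mulr_ge0// sqr_ge0.
pose c1 := 16 * (h * a) ^+ 2 * cS; pose c2 := 2 * a * (cS + 3) + 8 * (1 + cS) + 16 * a * cS.
pose c3 := h * (1 + a) * 2; pose C1 := c1 + h * c2 + c3.
have c10 : 0 <= c1 by rewrite mulr_ge0// mulr_ge0// sqr_ge0.
have a0' := ltW a0.
have c20 : 0 <= c2 by rewrite /c2; do ?[apply: addr_ge0 => //|apply: mulr_ge0 => //].
have c30 : 0 <= c3 by rewrite /c3; do ?[apply: addr_ge0 => //|apply: mulr_ge0 => //]; exact: ltW.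
have C10 : 0 <= C1 by rewrite /C1 !addr_ge0// mulr_ge0// ltW.
exists (C1 + (1 + k) * 3) => t x y A ah t1 x0 y0 A0 ah0 eqS /=.
have t0 : 0 < t by rewrite (lt_le_trans ltr01).
set M := _ - 2 * t; set E := expR (- h * a).
have E1 : E <= 1 by rewrite /E -expR0 ler_expR mulNr oppr_le0 ltW.
have E0 : 0 <= E by rewrite expR_ge0.
pose W : R := 1 + M ^+ 2 + y ^+ 2 + x ^+ 2.
have M2 := sqr_ge0 M; have x2 := sqr_ge0 x; have y2 := sqr_ge0 y.
have W0 : 0 <= W by rewrite /W !addr_ge0.
pose W' : R := 1 + M ^+ 2 / t + y ^+ 2 + x ^+ 2.
have W'0 : 0 <= W' by rewrite /W' !addr_ge0// divr_ge0// ltW.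
(* The estimates below come out as multiples of W / t^2. Since 1 <= t this is absorbed in W' / t,
   where only M^2 carries a factor 1 / t. *)
have WW : W / t ^+ 2 <= W' / t.
  rewrite ler_pdivrMr ?exprn_gt0//.
  rewrite (_ : W' / t * t ^+ 2 = t + M ^+ 2 + t * (y ^+ 2) + t * x ^+ 2); last by rewrite /W'; field; rewrite gt_eqF.
  by rewrite /W; apply: lerD; rewrite ?ler_peMl//; apply: lerD; rewrite ?ler_peMl// lerD2r.
pose S := (2 * a)^-1 - M / 4 - x / 2; pose del := ah - a.
pose Z : R := `|M| + x + y.
have Z0 : 0 <= Z by rewrite !addr_ge0.
have Z2 : Z ^+ 2 <= 3 * W.
  have := real_normK (num_real M); rewrite /Z /W.
  move: (`|M|) (M ^+ 2) => n _ <-.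
  have := sqr_ge0 (n - x); have := sqr_ge0 (n - y); have := sqr_ge0 (x - y).
  by nra.
have aA : a * A = (M - y + x) / 2 + t by rewrite /M; field.
case: (ltP A (t / (2 * a))) => [bad|good].
- (* the integral is small only if [Z] is large *)
  have Zt : t <= Z.
    have : a * A < t / 2.
      have -> : t / 2 = a * (t / (2 * a)) by field; rewrite gt_eqF.
      by rewrite ltr_pM2l.
    rewrite aA => h1; have : t < - (M - y + x) by lra.
    by have := ler_norm (- M); rewrite normrN /Z; lra.
  have Zt2 : t ^+ 2 <= Z ^+ 2 by apply: lerXn2r; rewrite ?nnegrE// ltW.
  have b1 : `|expR (- h * ah) - E| <= 3 * (W' / t).
    apply: (@le_trans _ _ 1).
      have e1 : expR (- h * ah) <= 1 by rewrite -expR0 ler_expR mulNr oppr_le0 mulr_ge0 ?ltW.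
      have e0 := expR_ge0 (- h * ah).
      by rewrite ler_norml; apply/andP; split; lra.
    apply: le_trans (ler_wpM2l _ WW) => //.
    by rewrite mulrA ler_pdivlMr ?exprn_gt0// mul1r (le_trans Zt2).
  have b2 : `|h * a * E / 2 * M / t| <= k * (3 * (W' / t)).
    apply: (@le_trans _ _ (k * (Z / t))).
      have -> : h * a * E / 2 * M / t = k * (E / 2 * (M / t)) by rewrite /k; field; rewrite gt_eqF.
      rewrite normrM [`|k|]gtr0_norm// ler_pM2l// normrM [`|M / t|]normf_div [`|t|]gtr0_norm//.
      rewrite mulrA ler_pM2r ?invr_gt0// ger0_norm ?divr_ge0//.
      by rewrite (@le_trans _ _ `|M|)//; [rewrite ler_piMl// ler_pdivrMr// mul1r (le_trans E1)// ler1n|rewrite /Z -addrA lerDl addr_ge0].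
    rewrite ler_pM2l//; apply: le_trans (ler_wpM2l _ WW) => //.
    rewrite mulrA ler_pdivlMr ?exprn_gt0// (le_trans _ Z2)//.
    by rewrite (_ : Z / t * t ^+ 2 = Z * t) ?expr2 ?ler_wpM2l//; field; rewrite gt_eqF.
  apply: le_trans (ler_normB _ _) _; apply: le_trans (lerD b1 b2) _.
  rewrite -/W' -[leRHS]mulrA [leLHS](_ : _ = (1 + k) * 3 * (W' / t)); last by ring.
  by apply: ler_wpM2r; [rewrite divr_ge0// ltW|rewrite lerDr].
(* [S] is the score at a. Subtracting the likelihood equation from it gives the exact identity (ah -
   a) D = S, with - D the slope of the chord of the score between a and ah. *)
- pose D := A / 2 + (2 * a * ah)^-1.
  have i0 : 0 < (2 * a * ah)^-1 by rewrite invr_gt0 !mulr_gt0.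
  have Dt : t / (4 * a) <= D.
    rewrite /D (_ : t / (4 * a) = t / (2 * a) / 2); last by field; rewrite gt_eqF.
    by have := good; move: (t / (2 * a)) => ? ?; lra.
  have t4a : 0 < t / (4 * a) by rewrite divr_gt0// mulr_gt0.
  have D0 : 0 < D by rewrite (lt_le_trans t4a).
  have DS : del * D = S.
    rewrite /del /D /S.
    have -> : (2 * a)^-1 - M / 4 - x / 2 = (2 * a)^-1 + t / 2 - (x + y) / 4 - a * A / 2.
      by rewrite /M; field; rewrite gt_eqF.
    rewrite -[RHS]subr0 -[X in _ = _ - X]eqS; field; by rewrite !gt_eqF.
  have Dinv : D^-1 <= 4 * a / t.
    by rewrite -[leRHS]invrK lef_pV2 ?posrE ?invr_gt0// ?divr_gt0 ?mulr_gt0// invf_div.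
  have dE : del = S / D by rewrite -DS mulfK// gt_eqF.
  have dS : `|del| <= 4 * a / t * `|S|.
    by rewrite dE normrM normfV [`|D|]gtr0_norm// mulrC ler_wpM2r.
  have t2aD : t - 2 * a * D = (y - x - M) / 2 - ah^-1.
    have -> : 2 * a * D = a * A + ah^-1 by rewrite /D; field; rewrite !gt_eqF.
    by rewrite aA; field; rewrite gt_eqF.
  (* An estimate ah near 0 makes 1 / ah large. If ah < a / 2, then D >= 1 / (2 a ah) yields 1 / (ah
     D) <= 2 a, while |ah - a| > a / 2; so the quotient is at most 4 |ah - a|, which is O(|S| /
     t). *)
  have ahD : ah^-1 / D <= 8 / t + 16 * a / t * `|S|.
    case: (leP (a / 2) ah) => ca.
      apply: (@le_trans _ _ (8 / t)); last by rewrite lerDl mulr_ge0// divr_ge0 ?mulr_ge0 ?ltW.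
      have ia : ah^-1 <= 2 / a by rewrite -[leRHS]invrK lef_pV2 ?posrE ?invr_gt0 ?divr_gt0// invf_div.
      rewrite (_ : 8 / t = 2 / a * (4 * a / t)); last by field; rewrite !gt_eqF.
      by apply: ler_pM => //; rewrite invr_ge0 ltW.
    apply: (@le_trans _ _ (16 * a / t * `|S|)); last by rewrite lerDr divr_ge0 ?ltW.
    have : ah^-1 / D <= 2 * a.
      rewrite ler_pdivrMr// /D mulrDr.
      have -> : 2 * a * (2 * a * ah)^-1 = ah^-1 by field; rewrite !gt_eqF.
      by rewrite lerDr mulr_ge0 ?divr_ge0// mulr_ge0.
    move/le_trans; apply; apply: (@le_trans _ _ (4 * `|del|)).
      by have := ler_norm (- del); rewrite normrN /del; lra.
    by rewrite (_ : _ * `|S| = 4 * (4 * a / t * `|S|)) ?ler_pM2l//; ring.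
  have S2 : S ^+ 2 <= cS * W.
    pose u := (2 * a)^-1.
    have -> : cS = 3 * (u ^+ 2 + 1) by rewrite /cS /u; field; rewrite gt_eqF.
    rewrite /S -/u /W.
    have : 0 <= u ^+ 2 by exact: sqr_ge0.
    have s1 : (u - M / 4 - x / 2) ^+ 2 <= 3 * (u ^+ 2 + M ^+ 2 + x ^+ 2).
      have := sqr_ge0 (u + M / 4); have := sqr_ge0 (u + x / 2); have := sqr_ge0 (M / 4 - x / 2).
      have := sqr_ge0 u.
      by nra.
    move=> u2; apply: le_trans s1 _; rewrite -mulrA ler_pM2l//.
    move: (u ^+ 2) (M ^+ 2) (x ^+ 2) (y ^+ 2) u2 M2 x2 y2 => p q r s *; nra.
  have S1 : `|S| <= (1 + cS) * W.
    have : `|S| <= 1 + S ^+ 2.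
      by rewrite -(real_normK (num_real S)); have := sqr_ge0 (`|S| - 1); have := normr_ge0 S; nra.
    have : 1 <= W by rewrite /W -!addrA lerDl !addr_ge0.
    by rewrite mulrDl mul1r; lra.
  have SZ : `|S| * Z <= (cS + 3) * W.
    have : `|S| * Z <= S ^+ 2 + Z ^+ 2.
      by rewrite -(real_normK (num_real S)); have := sqr_ge0 (`|S| - Z); have := normr_ge0 S; nra.
    by rewrite mulrDl; lra.
  have lin : `|del - 2 * a * S / t| <= c2 * (W / t ^+ 2).
    have -> : del - 2 * a * S / t = S / t * ((t - 2 * a * D) / D).
      by rewrite dE; field; rewrite !gt_eqF.
    rewrite normrM normf_div [`|t|]gtr0_norm//.
    have b : `|(t - 2 * a * D) / D| <= 2 * a / t * Z + (8 / t + 16 * a / t * `|S|).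
      rewrite t2aD mulrBl; apply: le_trans (ler_normB _ _) _; apply: lerD.
        rewrite normrM [`|D^-1|]ger0_norm ?invr_ge0 ?(ltW D0)//.
        rewrite (_ : 2 * a / t * Z = Z / 2 * (4 * a / t)); last by field; rewrite gt_eqF.
        apply: ler_pM => //; first by rewrite invr_ge0 ltW.
        rewrite normrM [`|2^-1|]ger0_norm// ler_pM2r// /Z.
        apply: le_trans (ler_normB _ _) _; apply: le_trans (lerD (ler_normB _ _) (lexx _)) _.
        by rewrite (ger0_norm x0) (ger0_norm y0); lra.
      by rewrite ger0_norm// divr_ge0 ?invr_ge0 ?ltW.
    apply: le_trans (ler_wpM2l _ b) _; first by rewrite divr_ge0// ltW.
    rewrite [leLHS](_ : _ = (2 * a * (`|S| * Z) + 8 * `|S| + 16 * a * `|S| ^+ 2) / t ^+ 2); last by field; rewrite gt_eqF.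
    rewrite mulrA ler_pM2r ?invr_gt0 ?exprn_gt0// real_normK ?num_real//.
    have -> : c2 * W = 2 * a * ((cS + 3) * W) + 8 * ((1 + cS) * W) + 16 * a * (cS * W).
      by rewrite /c2; ring.
    apply: lerD; first apply: lerD.
    - by apply: ler_wpM2l => //; exact: mulr_ge0.
    - exact: ler_wpM2l.
    - by apply: ler_wpM2l => //; exact: mulr_ge0.
  have exq : `|expR (- h * ah) - E + h * E * del| <= c1 * (W / t ^+ 2).
    apply: (@le_trans _ _ ((h * del) ^+ 2)).
      have := expR_tangent (mulr_ge0 (ltW h0) a0') (mulr_ge0 (ltW h0) (ltW ah0)).
      have -> : h * ah - h * a = h * del by rewrite /del; ring.
      rewrite -[- (h * ah)]mulNr -[- (h * a)]mulNr -/E.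
      by rewrite [E * (h * del)]mulrA [E * h]mulrC.
    have -> : c1 * (W / t ^+ 2) = (h * (4 * a / t)) ^+ 2 * (cS * W).
      by rewrite /c1; field; rewrite gt_eqF.
    apply: (@le_trans _ _ ((h * (4 * a / t)) ^+ 2 * S ^+ 2)).
      rewrite -exprMn -[leLHS]real_normK ?num_real// -[leRHS]real_normK ?num_real//.
      apply: lerXn2r; rewrite ?nnegrE// !normrM -mulrA ler_wpM2l// -!normrM.
      by rewrite [leRHS](_ : _ = 4 * a / t * `|S|)// normrM ger0_norm// divr_ge0 ?mulr_ge0 ?ltW.
    by apply: ler_wpM2l => //; exact: sqr_ge0.
  have rest : `|h * E * (2 * a / t) * ((2 * a)^-1 - x / 2)| <= c3 * (W' / t).
    have -> : h * E * (2 * a / t) * ((2 * a)^-1 - x / 2) = E * (h * (1 - a * x)) / t.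
      by field; rewrite !gt_eqF.
    rewrite normrM [`|t^-1|]ger0_norm ?invr_ge0 ?(ltW t0)// [leRHS]mulrA ler_pM2r ?invr_gt0//.
    rewrite normrM ger0_norm//; apply: le_trans (ler_piMl _ E1) _ => //.
    rewrite /c3 normrM gtr0_norm// -!mulrA ler_pM2l//.
    apply: (@le_trans _ _ ((1 + a) * (1 + x))).
      apply: le_trans (ler_normB _ _) _; rewrite normr1 normrM !ger0_norm ?(ltW a0)//.
      by have := mulr_ge0 (ltW a0) x0; have := ltW a0; nra.
    rewrite ler_pM2l ?addr_gt0//.
    have : 0 <= M ^+ 2 / t by rewrite divr_ge0// ltW.
    by rewrite /W'; have := sqr_ge0 (x - 1); nra.
  (* Three errors: the curvature of the exponential, the replacement of ah - a by 2 a S / t, and the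
     part of S other than - M / 4, which turns into the main term. *)
  have -> : expR (- h * ah) - E - h * a * E / 2 * M / t =
    (expR (- h * ah) - E + h * E * del) - h * E * (del - 2 * a * S / t) - h * E * (2 * a / t) * ((2 * a)^-1 - x / 2).
    by rewrite /S; field; rewrite !gt_eqF.
  set e1 := _ + h * E * del in exq *; set e2 := del - _ in lin *; set e3 := h * E * _ * _ in rest *.
  rewrite -/W' -[leRHS]mulrA.
  have Wt0 : 0 <= W' / t by rewrite divr_ge0// ltW.
  apply: (@le_trans _ _ (C1 * (W' / t))); last first.
    by apply: ler_wpM2r => //; rewrite lerDl mulr_ge0// addr_ge0// ltW.
  move: exq lin rest WW Wt0; move: (W / t ^+ 2) (W' / t) => B B' exq lin rest BB' B'0.
  rewrite /C1 2!mulrDl; apply: le_trans (ler_normB _ _) _; apply: lerD => //.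
  apply: le_trans (ler_normB _ _) _; apply: lerD.
    by apply: le_trans exq _; exact: ler_wpM2l.
  rewrite normrM ger0_norm ?mulr_ge0 ?(ltW h0)// -!mulrA ler_pM2l//.
  apply: le_trans (ler_piMl _ E1) _ => //; apply: le_trans lin _.
  exact: ler_wpM2l.
Qed.

(** * Gaussian laws *)

Section Density.
Local Open Scope ereal_scope.
Context {d} {T : measurableType d} {R : realType}.
Variables (mu nu : {measure set T -> \bar R}) (f : T -> R).
Hypothesis mf : measurable_fun setT f.
Hypothesis f0 : forall x, (0 <= f x)%R.
Hypothesis nuE : forall A, measurable A -> nu A = \int[mu]_(x in A) (f x)%:E.

Import HBNNSimple.

Let density_nnsfun (g : {nnsfun T >-> R}) :
  \int[nu]_x (g x)%:E = \int[mu]_x ((g x)%:E * (f x)%:E).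
Proof.
rewrite integralT_nnsfun sintegralE.
under [RHS]eq_integral => x _.
  rewrite fimfunE -fsumEFin// ge0_mule_fsuml; last first.
    by move=> r; rewrite EFinM; exact: nnfun_muleindic_ge0.
  over.
rewrite /= ge0_integral_fsum//; last 2 first.
- move=> r; apply: emeasurable_funM; last exact/measurable_EFinP.
  by apply/measurable_EFinP; apply: measurable_funM => //; exact: measurable_indic.
- move=> r x _; rewrite mule_ge0 ?lee_fin//.
  by rewrite -lee_fin EFinM; exact: nnfun_muleindic_ge0.
apply: eq_fsbigr => r /set_mem [x _ <-].
have r0 : (0 <= g x)%R by exact: fun_ge0.
rewrite nuE; last exact: measurable_sfunP.
under [RHS]eq_integral do rewrite EFinM -muleA.
rewrite ge0_integralZl//; last 2 first.
- by apply: emeasurable_funM; exact/measurable_EFinP.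
- by move=> y _; rewrite mule_ge0 ?lee_fin.
congr (_ * _); rewrite integral_mkcond; apply: eq_integral => y _.
by rewrite patchE indicE; case: ifPn => /=; rewrite ?mul1e ?mul0e.
Qed.

Lemma ge0_integral_density (g : T -> \bar R) : measurable_fun setT g ->
  (forall x, 0 <= g x) -> \int[nu]_x g x = \int[mu]_x (g x * (f x)%:E).
Proof.
move=> mg g0; pose g_ := nnsfun_approx measurableT mg.
have gnd x m n : (m <= n)%N -> (g_ m x <= g_ n x)%R.
  by move=> mn; exact/lefP/nd_nnsfun_approx.
transitivity (limn (fun n => \int[nu]_x (g_ n x)%:E)).
  rewrite -monotone_convergence//=.
  - apply: eq_integral => x _; apply/esym/cvg_lim => //.
    exact: cvg_nnsfun_approx.
  - by move=> n; exact/measurable_EFinP/measurable_funTS.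
  - by move=> n x _; rewrite lee_fin.
  - by move=> x _ m n mn; rewrite lee_fin; exact: gnd.
under eq_fun do rewrite density_nnsfun.
rewrite -monotone_convergence//=.
- apply: eq_integral => x _; apply/cvg_lim => //.
  under eq_fun do rewrite muleC; rewrite muleC.
  by apply: cvgeZl => //; exact: cvg_nnsfun_approx.
- move=> n; apply: emeasurable_funM; exact/measurable_EFinP/measurable_funTS.
- by move=> n x _; rewrite mule_ge0 ?lee_fin.
- by move=> x _ m n mn; rewrite lee_wpmul2r ?lee_fin//; exact: gnd.
Qed.

End Density.

(** * Moments from the moment generating function *)

Section CoshBounds.
Context {R : realType}.
Implicit Types x y : R.

(** The middle term is the square of exp(z) - exp(- z) with z = y / 2, and this difference lies
    between y exp(- z) and y exp(z) when y >= 0. With y = l X these bounds isolate the second moment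
    of X as l tends to 0. *)
Lemma cosh_bounds y : y ^+ 2 * expR (- `|y|) <= expR y + expR (- y) - 2 <= y ^+ 2 * expR `|y|.
Proof.
wlog y0 : y / 0 <= y.
  move=> h; have [/h//|y0] := leP 0 y.
  by have := h (- y); rewrite normrN sqrrN opprK oppr_ge0 addrC [expR y + _]addrC => /(_ (ltW y0)); rewrite addrC.
rewrite ger0_norm//; pose z := y / 2; have z0 : 0 <= z by rewrite divr_ge0.
have ab : expR z * expR (- z) = 1 by rewrite -expRD subrr expR0.
have yz : y = z + z by rewrite /z; field.
have ey : expR y = expR z ^+ 2 by rewrite yz expRD expr2.
have eNy : expR (- y) = expR (- z) ^+ 2 by rewrite yz opprD expRD expr2.
have h1 := expR_ge1Dx y; have h2 := expR_ge1Dx (- y).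
move: h1 h2; rewrite ey eNy.
have a0 := expR_gt0 z; have b0 := expR_gt0 (- z).
move: (expR z) (expR (- z)) a0 b0 ab => a b a0 b0 ab h1 h2.
have -> : a ^+ 2 + b ^+ 2 - 2 = (a - b) ^+ 2 by rewrite sqrrB ab; ring.
have l1 : y * b <= a - b.
  have -> : a - b = b * (a ^+ 2 - 1) by rewrite mulrBr mulr1 expr2 mulrA [b * a]mulrC ab mul1r.
  by rewrite mulrC ler_wpM2l ?(ltW b0)//; lra.
have l2 : a - b <= y * a.
  have -> : a - b = a * (1 - b ^+ 2) by rewrite mulrBr mulr1 expr2 mulrA ab mul1r.
  by rewrite mulrC ler_wpM2r ?(ltW a0)//; lra.
have l0 : 0 <= y * b by rewrite mulr_ge0// ltW.
have l3 := le_trans l0 l1; have l4 := le_trans l3 l2.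
by rewrite -!exprMn; apply/andP; split; apply: lerXn2r; rewrite ?nnegrE.
Qed.

Lemma powerX_le_expR n x : 0 <= x -> x ^+ n <= n`!%:R * expR x.
Proof.
move=> x0; case: n => [|n].
  by rewrite expr0 fact0 mul1r -expR0 ler_expR.
have f0 : 0 < (n.+1)`!%:R :> R by rewrite ltr0n fact_gt0.
rewrite mulrC -ler_pdivrMr//; apply: le_trans (expR_ge1Dxn n x0).
by rewrite lerDr.
Qed.

Lemma expR_norm_le x : expR `|x| <= expR x + expR (- x).
Proof.
by case: (ger0P x) => _; rewrite ?lerDl ?lerDr expR_ge0.
Qed.

Lemma expR_sub1_le y : 0 <= y -> y <= 2^-1 -> expR y - 1 <= y + 2 * y ^+ 2.
Proof.
move=> y0 y2; have h := expR_ge1Dx (- y).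
have e : expR y * expR (- y) = 1 by rewrite -expRD subrr expR0.
have p := expR_gt0 y.
have h3 : expR y * (1 - y) <= 1 by rewrite -[leRHS]e ler_wpM2l// ltW.
have : (expR y - 1) * (1 - y) <= (y + 2 * y ^+ 2) * (1 - y) by nra.
by rewrite ler_pM2r//; lra.
Qed.

End CoshBounds.

Lemma le_of_small {R : realFieldType} (x y K d : R) : 0 < d ->
  (forall l, 0 < l -> l <= d -> x <= y + l * K) -> x <= y.
Proof.
move=> d0 h; apply/ler_addgt0Pr => e e0.
pose l := Order.min d (e / (1 + `|K|)).
have K1 : 0 < 1 + `|K| by rewrite ltr_pwDl.
have l0 : 0 < l by rewrite lt_min d0 divr_gt0.
apply: le_trans (h l l0 _) _; first by rewrite ge_min lexx.
rewrite lerD2l; apply: (@le_trans _ _ (l * (1 + `|K|))).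
  by rewrite ler_wpM2l ?(ltW l0)// (le_trans (ler_norm _))// lerDr.
by rewrite -ler_pdivlMr// ge_min lexx orbT.
Qed.

Section ExponentialMoments.
Context {d} {T : measurableType d} {R : realType} (P : probability T R).
Variable X : T -> R.
Hypothesis mX : measurable_fun setT X.
Hypothesis mgf_lty : forall l : R, (\int[P]_w (expR (l * X w))%:E < +oo)%E.

Lemma moments_expR l : moments P (fun w => expR (l * X w)).
Proof.
have mE (k : R) : measurable_fun setT (fun w => expR (k * X w)).
  by apply: measurableT_comp => //; exact: measurable_funM.
split=> [|n]; first exact: mE.
rewrite (_ : (fun w => _) = (fun w => (expR ((n%:R * l) * X w))%:E)); last first.
  apply/funext => w; congr (_%:E).
  by rewrite ger0_norm ?expR_ge0// -expRM_natl mulrA.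
apply/integrableP; split; first exact/measurable_EFinP.
by under eq_integral do rewrite gee0_abs ?lee_fin ?expR_ge0//.
Qed.

Lemma moments_expR_norm : moments P (fun w => expR `|X w|).
Proof.
apply: (@moments_le _ _ _ P _ (fun w => expR (1 * X w) + expR ((-1) * X w))).
- by apply: measurableT_comp => //; exact: meas_norm.
- by apply: momentsD; exact: moments_expR.
- move=> w; rewrite [leLHS]ger0_norm ?expR_ge0// [leRHS]ger0_norm ?addr_ge0 ?expR_ge0// mul1r mulN1r.
  exact: expR_norm_le.
Qed.

(** |X| <= exp |X| <= exp X + exp(- X), and powers of these exponentials are again exponentials of
    multiples of X. *)
Lemma moments_mgf_lty : moments P X.
Proof.
apply: (moments_le mX moments_expR_norm) => w.
rewrite [leRHS]ger0_norm ?expR_ge0//.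
by rewrite (le_trans _ (expR_ge1Dx _))// lerDr.
Qed.

End ExponentialMoments.

Section GaussianMoments.
Context {d} {T : measurableType d} {R : realType} (P : probability T R).
Variables (X : T -> R) (v : R).
Hypothesis v0 : 0 < v.
Hypothesis mX : measurable_fun setT X.
Hypothesis mgf : forall l : R,
  (\int[P]_w (expR (l * X w))%:E = (expR (l ^+ 2 * v / 2))%:E)%E.

Let mgf_lty (l : R) : (\int[P]_w (expR (l * X w))%:E < +oo)%E.
Proof. by rewrite mgf ltry. Qed.

Let gaussian_moments_expR l : moments P (fun w => expR (l * X w)) :=
  moments_expR mX mgf_lty l.

Let gaussian_moments_expR_norm : moments P (fun w => expR `|X w|) :=
  moments_expR_norm mX mgf_lty.

Let gaussian_mean_expR l : mean P (fun w => expR (l * X w)) = expR (l ^+ 2 * v / 2).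
Proof. by rewrite /mean /Rintegral mgf. Qed.

Lemma gaussian_moments : moments P X.
Proof. exact: moments_mgf_lty mX mgf_lty. Qed.

(** From 1 + l X <= exp(l X) follows l E X <= exp(l^2 v / 2) - 1 = O(l^2). Dividing by l of either
    sign and letting it tend to 0 avoids differentiation under the integral. *)
Lemma gaussian_mean : mean P X = 0.
Proof.
have mXm := gaussian_moments.
have key l : l * mean P X <= expR (l ^+ 2 * v / 2) - 1.
  rewrite -gaussian_mean_expR -meanZ// -[X in _ - X](mean_cst P) -meanB; last 2 first.
  - exact: gaussian_moments_expR.
  - exact: moments_cst.
  apply: mean_le => [||w].
  - by apply: momentsM => //; exact: moments_cst.
  - by apply: momentsB; [exact: gaussian_moments_expR|exact: moments_cst].
  - by rewrite lerBrDl expR_ge1Dx.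
pose d0 : R := Order.min 1 v^-1.
have d00 : 0 < d0 by rewrite lt_min ltr01 invr_gt0.
have small l : 0 < l -> l <= d0 -> expR (l ^+ 2 * v / 2) - 1 <= l * (l * v).
  move=> l0; rewrite le_min => /andP[l1 lv].
  have lv1 : l * v <= 1 by rewrite -ler_pdivlMr// div1r.
  have lv0 : 0 < l * v by rewrite mulr_gt0.
  have y0 : 0 <= l ^+ 2 * v / 2 by rewrite !mulr_ge0 ?sqr_ge0// ltW.
  have y1 : l ^+ 2 * v / 2 <= 2^-1.
    by rewrite ler_piMl// expr2 -mulrA mulr_ile1// ltW.
  apply: le_trans (expR_sub1_le y0 y1) _.
  rewrite (_ : l * (l * v) = 2 * (l ^+ 2 * v / 2)); last by field.
  move: (l ^+ 2 * v / 2) y0 y1 => y y0 y1; nra.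
apply/eqP; rewrite eq_le; apply/andP; split.
- apply: (@le_of_small _ _ _ v d0) => // l l0 ld; rewrite add0r.
  by rewrite -(ler_pM2l l0) (le_trans (key l))// small.
- rewrite -oppr_le0; apply: (@le_of_small _ _ _ v d0) => // l l0 ld; rewrite add0r.
  rewrite -(ler_pM2l l0) mulrN -mulNr (le_trans (key (- l)))// sqrrN; exact: small.
Qed.

(** The mean of exp(l X) + exp(- l X) - 2 is 2 (exp(l^2 v / 2) - 1), about l^2 v, and the variable
    lies between l^2 X^2 (1 - l |X|) and l^2 X^2 (1 + l |X| exp |X|) for l <= 1. Divide by l^2 and
    let l tend to 0. *)
Lemma gaussian_mean_sqr : mean P (fun w => X w ^+ 2) = v.
Proof.
have mXm := gaussian_moments; have mXn := moments_norm mXm.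
have mXe := gaussian_moments_expR_norm.
have mp l := gaussian_moments_expR l.
pose d0 : R := Order.min 1 v^-1.
have d00 : 0 < d0 by rewrite lt_min ltr01 invr_gt0.
pose K3 := mean P (fun w => `|X w| ^+ 3); pose K3e := mean P (fun w => `|X w| ^+ 3 * expR `|X w|).
have ce l : mean P (fun w => expR (l * X w) + expR ((- l) * X w) - 2) = 2 * (expR (l ^+ 2 * v / 2) - 1).
  have m1 := mp l; have m2 := mp (- l).
  rewrite meanB; [|solve_moments|solve_moments].
  rewrite meanD; [|solve_moments|solve_moments].
  by rewrite !gaussian_mean_expR sqrrN mean_cst; ring.
apply/eqP; rewrite eq_le; apply/andP; split.
- apply: (@le_of_small _ _ _ (K3 + v) d0) => // l l0.
  rewrite le_min => /andP[l1 lv].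
  have m1 := mp l; have m2 := mp (- l).
  have lv1 : l * v <= 1 by rewrite -ler_pdivlMr// div1r.
  have lv0 : 0 < l * v by rewrite mulr_gt0.
  have y0 : 0 <= l ^+ 2 * v / 2 by rewrite !mulr_ge0 ?sqr_ge0// ltW.
  have y1 : l ^+ 2 * v / 2 <= 2^-1.
    by rewrite ler_piMl// expr2 -mulrA mulr_ile1// ltW.
  have l2 : 0 < l ^+ 2 by rewrite exprn_gt0.
  have h1 : l ^+ 2 * (mean P (fun w => X w ^+ 2) - l * K3) <= 2 * (expR (l ^+ 2 * v / 2) - 1).
    rewrite -ce /K3 -meanZ; [|solve_moments].
    rewrite -meanB; [|solve_moments|solve_moments].
    rewrite -meanZ; [|solve_moments].
    apply: mean_le => [||w]; [solve_moments|solve_moments|].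
    have /andP[h _] := cosh_bounds (l * X w).
    rewrite mulNr; apply: le_trans h; rewrite normrM gtr0_norm// exprMn -[leRHS]mulrA ler_pM2l//.
    have -> : X w ^+ 2 - l * `|X w| ^+ 3 = X w ^+ 2 * (1 - l * `|X w|).
      by rewrite -(real_normK (num_real (X w))); ring.
    by rewrite ler_wpM2l ?sqr_ge0// expR_ge1Dx.
  have h2 := expR_sub1_le y0 y1.
  have h3 : mean P (fun w => X w ^+ 2) - l * K3 <= v + l * v.
    rewrite -(ler_pM2l l2); apply: le_trans h1 _.
    apply: le_trans (ler_wpM2l _ h2) _ => //.
    have -> : 2 * (l ^+ 2 * v / 2 + 2 * (l ^+ 2 * v / 2) ^+ 2) = l ^+ 2 * (v + l * v * (l * v)) by field.
    rewrite ler_pM2l// lerD2l ler_piMr// ltW//.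
  by rewrite mulrDr; lra.
- apply: (@le_of_small _ _ _ K3e 1) => // l l0 l1.
  have m1 := mp l; have m2 := mp (- l).
  have l2 : 0 < l ^+ 2 by rewrite exprn_gt0.
  rewrite -(ler_pM2l l2).
  apply: (@le_trans _ _ (2 * (expR (l ^+ 2 * v / 2) - 1))).
    by have := expR_ge1Dx (l ^+ 2 * v / 2); lra.
  rewrite -ce /K3e -meanZ; [|solve_moments].
  rewrite -meanD; [|solve_moments|solve_moments].
  rewrite -meanZ; [|solve_moments].
  apply: mean_le => [||w]; [solve_moments|solve_moments|].
  have /andP[_ h] := cosh_bounds (l * X w).
  rewrite mulNr; apply: le_trans h _; rewrite normrM gtr0_norm// exprMn -[leLHS]mulrA ler_pM2l//.
  have -> : X w ^+ 2 + l * (`|X w| ^+ 3 * expR `|X w|) = X w ^+ 2 * (1 + l * `|X w| * expR `|X w|).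
    by rewrite -(real_normK (num_real (X w))); ring.
  rewrite ler_wpM2l ?sqr_ge0//.
  set a := l * `|X w|; have a0 : 0 <= a by rewrite mulr_ge0// ltW.
  have h1 := expR_ge1Dx (- a).
  have e : expR a * expR (- a) = 1 by rewrite -expRD subrr expR0.
  have h2 : expR a * (1 - a) <= 1 by rewrite -[leRHS]e ler_wpM2l ?expR_ge0.
  have h3 : expR a <= expR `|X w| by rewrite ler_expR /a ler_piMl.
  have h4 : a * expR a <= a * expR `|X w| by rewrite ler_wpM2l.
  by rewrite mulrBr mulr1 in h2; lra.
Qed.

(** x^4 <= 4! exp |x| applied to X / sqrt v, whose moment generating function is exp(1/2) at 1 and
    -1; hence 48 = 2 * 24. *)
Lemma gaussian_mean4 : mean P (fun w => `|X w| ^+ 4) <= 48 * expR 2^-1 * v ^+ 2.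
Proof.
have mXm := gaussian_moments; have mp l := gaussian_moments_expR l.
pose l := (Num.sqrt v)^-1.
have s0 : 0 < Num.sqrt v by rewrite sqrtr_gt0.
have l0 : 0 < l by rewrite invr_gt0.
have l2 : l ^+ 2 * v = 1.
  by rewrite /l -{2}(sqr_sqrtr (ltW v0)) -exprMn mulVf ?expr1n// gt_eqF.
have l4 : 0 < l ^+ 4 by rewrite exprn_gt0.
have m1 := mp l; have m2 := mp (- l).
rewrite -(ler_pM2l l4).
have -> : l ^+ 4 * (48 * expR 2^-1 * v ^+ 2) = 24 * (expR (l ^+ 2 * v / 2) + expR ((- l) ^+ 2 * v / 2)).
  rewrite sqrrN l2 div1r (_ : l ^+ 4 * _ = 48 * expR 2^-1 * (l ^+ 2 * v) ^+ 2); last by ring.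
  by rewrite l2; ring.
rewrite -!gaussian_mean_expR -meanD//.
rewrite -!meanZ; try solve_moments.
apply: mean_le => [||w]; [solve_moments|solve_moments|].
rewrite -{1}(gtr0_norm l0) -exprMn -normrM.
apply: le_trans (powerX_le_expR 4 (normr_ge0 _)) _.
apply: ler_wpM2l; first exact: ler0n.
by rewrite mulNr; exact: expR_norm_le.
Qed.

End GaussianMoments.

(** * Coordinates in the eigenbasis *)

Section PlaneCoordinates.
Context {R : realType}.
Implicit Types (i j : bool) (x y u : 'cV[R]_2) (z : R * R).

Lemma sum_ord2 (V : nmodType) (F : 'I_2 -> V) : \sum_(i < 2) F i = F 0 + F 1.
Proof. by rewrite !big_ord_recl big_ord0 addr0; congr (_ + F _); apply/val_inj. Qed.

Lemma ord2P (Q : 'I_2 -> Prop) : Q 0 -> Q 1 -> forall k, Q k.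
Proof.
move=> q0 q1 [[|[|k]] // kl].
- by rewrite (_ : Ordinal kl = 0)//; apply/val_inj.
- by rewrite (_ : Ordinal kl = 1)//; apply/val_inj.
Qed.

Lemma dotvE x y : dotv x y = x 0 0 * y 0 0 + x 1 0 * y 1 0.
Proof. by rewrite /dotv mxE sum_ord2 !mxE. Qed.

Lemma mulmx_col2 (A : 'M[R]_2) x k : (A *m x) k 0 = A k 0 * x 0 0 + A k 1 * x 1 0.
Proof. by rewrite mxE sum_ord2. Qed.

Lemma col_of_pair_of x : col_of (pair_of x) = x.
Proof. by apply/colP; apply: ord2P; rewrite mxE. Qed.

(* The coordinates in the eigenbasis (1, 1), (1, -1) of [Qmx theta]. *)
Definition eigc i x : R := x 0 0 + (-1) ^+ i * x 1 0.

Lemma eigcD i x y : eigc i (x + y) = eigc i x + eigc i y.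
Proof. by rewrite /eigc !mxE; ring. Qed.

Lemma eigcB i x y : eigc i (x - y) = eigc i x - eigc i y.
Proof. by rewrite /eigc !mxE; ring. Qed.

Lemma eigc_Qmx i u x : eigc i (Qmx u *m x) = eigc i u * eigc i x.
Proof. by rewrite /eigc !mulmx_col2 !mxE /=; case: i => /=; rewrite ?expr1 ?expr0; ring. Qed.

Lemma dotv_eigc x y : dotv x y = (eigc false x * eigc false y + eigc true x * eigc true y) / 2.
Proof. by rewrite dotvE /eigc /= expr0 expr1; field. Qed.

Lemma det_Qmx u : \det (Qmx u) = eigc false u * eigc true u.
Proof. by rewrite (expand_det_row _ 0) sum_ord2 /cofactor !det_mx11 !mxE /= /eigc expr0 !expr1; ring. Qed.

Lemma ThetaE u : Theta u <-> 0 < eigc false u /\ 0 < eigc true u.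
Proof.
split=> [[_ h]|[h0 h1]].
- have key (v : 'cV[R]_2) : v != 0 -> 0 < eigc false u * eigc false v ^+ 2 + eigc true u * eigc true v ^+ 2.
    by move=> /h; rewrite dotv_eigc !eigc_Qmx; lra.
  have n1 : col_of (1, 1) != 0 :> 'cV[R]_2.
    by apply/eqP => /colP/(_ 0); rewrite !mxE => /eqP; rewrite oner_eq0.
  have n2 : col_of (1, -1) != 0 :> 'cV[R]_2.
    by apply/eqP => /colP/(_ 0); rewrite !mxE => /eqP; rewrite oner_eq0.
  have := key _ n1; have := key _ n2.
  by rewrite /eigc !mxE /= expr0 expr1; lra.
- split=> [|v v0].
    by apply/matrixP; apply: ord2P; apply: ord2P; rewrite !mxE.
  rewrite dotv_eigc !eigc_Qmx.
  suff : 0 < eigc false u * eigc false v ^+ 2 + eigc true u * eigc true v ^+ 2 by lra.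
  have s0 := sqr_ge0 (eigc false v); have s1 := sqr_ge0 (eigc true v).
  have p0 := mulr_ge0 (ltW h0) s0; have p1 := mulr_ge0 (ltW h1) s1.
  rewrite lt_def (addr_ge0 p0 p1) andbT; apply: contra v0.
  rewrite (paddr_eq0 p0 p1) !mulf_eq0 (gt_eqF h0) (gt_eqF h1) /= !orbb.
  move=> /andP[/eqP e0 /eqP e1]; apply/eqP/colP; apply: ord2P; rewrite mxE.
    by move: e0 e1; rewrite /eigc /= expr0 expr1; lra.
  by move: e0 e1; rewrite /eigc /= expr0 expr1; lra.
Qed.

Lemma measurable_eigc_col i : measurable_fun setT (fun z : R * R => eigc i (col_of z)).
Proof.
rewrite (_ : (fun _ => _) = (fun z : R * R => z.1 + (-1) ^+ i * z.2)).
  by apply: measurable_funD => //; exact: measurable_funM.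
by apply/funext => z; rewrite /eigc !mxE.
Qed.

End PlaneCoordinates.

(** * Bivariate normal laws *)

Section NormalLaws.
Context {R : realType}.
Local Notation mu2 := (@lebesgue_measure R \x @lebesgue_measure R)%E.

Lemma normal2_ge0_integral (S : 'M[R]_2) (g : R * R -> \bar R) :
  measurable_fun setT g -> (forall z, 0 <= g z)%E ->
  (\int[normal2 S]_z g z = \int[mu2]_z (g z * (normal2_pdf S z)%:E))%E.
Proof.
move=> mg g0.
(* [lebesgue_measure] lives on an alias of R with another display, hence the
   transport along the identity. *)
pose idp (z : measurableTypeR R * measurableTypeR R) : R * R := z.
have mid : measurable_fun setT idp by move=> _ Y mY; rewrite setTI.
pose nu := pushforward mu2 idp.
have nuE A : measurable A -> normal2 S A = (\int[nu]_(z in A) (normal2_pdf S z)%:E)%E.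
  move=> mA; rewrite ge0_integral_pushforward//.
  - by apply/measurable_EFinP; apply: measurable_funTS; exact: measurable_normal2_pdf.
  - by move=> z _; rewrite lee_fin normal2_pdf_ge0.
rewrite (ge0_integral_density (measurable_normal2_pdf S) (normal2_pdf_ge0 S) nuE mg g0).
rewrite ge0_integral_pushforward//.
- by apply: emeasurable_funM => //; apply/measurable_EFinP; exact: measurable_normal2_pdf.
- by move=> z _; rewrite mule_ge0// lee_fin normal2_pdf_ge0.
Qed.

Lemma normal2_pdf_scalar (s : R) z : 0 < s ->
  normal2_pdf s%:M z = normal_pdf 0 (Num.sqrt s) z.1 * normal_pdf 0 (Num.sqrt s) z.2.
Proof.
move=> s0; have q0 : Num.sqrt s != 0 by rewrite gt_eqF// sqrtr_gt0.
rewrite !normal_pdfE//= /normal_peak /normal_fun /normal2_pdf.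
rewrite det_scalar sqrtr_sqr gtr0_norm// invmx_scalar mul_scalar_mx dotvE !mxE /= !subr0.
rewrite sqr_sqrtr ?(ltW s0)// mulrACA -expRD -invfM.
have p0 : 0 <= s * pi *+ 2 by rewrite mulrn_wge0// mulr_ge0 ?pi_ge0 ?ltW.
rewrite -expr2 sqr_sqrtr//; congr (_^-1 * expR _); first by rewrite -mulr_natl; ring.
by rewrite -mulr_natl; field; rewrite gt_eqF.
Qed.

(** Completing the square: an exponential weight only shifts the mean, so the generating function
    follows from the total mass of a normal density. *)
Lemma normal_pdf_tilt (s p x : R) : 0 < s ->
  expR (p * x) * normal_pdf 0 (Num.sqrt s) x =
  expR (p ^+ 2 * s / 2) * normal_pdf (p * s) (Num.sqrt s) x.
Proof.
move=> s0; have q0 : Num.sqrt s != 0 by rewrite gt_eqF// sqrtr_gt0.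
rewrite !normal_pdfE//= /normal_fun.
rewrite sqr_sqrtr ?(ltW s0)// mulrCA [RHS]mulrCA -!expRD; congr (_ * expR _).
by rewrite -mulr_natl; field; rewrite gt_eqF.
Qed.

Lemma normal2_mgf (s p q : R) : 0 < s ->
  (\int[normal2 s%:M]_z (expR (p * z.1 + q * z.2))%:E =
   (expR ((p ^+ 2 + q ^+ 2) * s / 2))%:E)%E.
Proof.
move=> s0; pose m (r : R) x := normal_pdf (r * s) (Num.sqrt s) x.
have mm r : measurable_fun setT (m r) by exact: measurable_normal_pdf.
have m0 r x : 0 <= m r x by exact: normal_pdf_ge0.
pose c := expR ((p ^+ 2 + q ^+ 2) * s / 2).
have mpq : measurable_fun setT (fun z : R * R => expR (p * z.1 + q * z.2)).
  by apply: measurableT_comp => //; apply: measurable_funD; exact: measurable_funM.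
rewrite normal2_ge0_integral; last 2 first.
- exact/measurable_EFinP.
- by move=> z; rewrite lee_fin expR_ge0.
under eq_integral => z _.
  rewrite -EFinM normal2_pdf_scalar// expRD mulrACA !normal_pdf_tilt// mulrACA -expRD.
  over.
rewrite /=.
have -> : (fun z : R * R => (expR (p ^+ 2 * s / 2 + q ^+ 2 * s / 2) *
    (normal_pdf (p * s) (Num.sqrt s) z.1 * normal_pdf (q * s) (Num.sqrt s) z.2))%:E) =
    (fun z => c%:E * (m p z.1 * m q z.2)%:E)%E.
  by apply/funext => z; rewrite -EFinM; congr ((expR _ * _)%:E); field.
have mmm : measurable_fun [set: measurableTypeR R * measurableTypeR R] (fun z => (m p z.1 * m q z.2)%:E).
  apply/measurable_EFinP; apply: measurable_funM.
    exact: (measurableT_comp (mm p) (@measurable_fst _ _ (measurableTypeR R) (measurableTypeR R))).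
  exact: (measurableT_comp (mm q) (@measurable_snd _ _ (measurableTypeR R) (measurableTypeR R))).
rewrite ge0_integralZl//; last by rewrite lee_fin expR_ge0.
  rewrite (@fubini_tonelli1 _ _ _ _ _ _ _ _ mmm); last by move=> z; rewrite lee_fin mulr_ge0.
  rewrite /fubini_F /=.
  have mI (r e : R) : 0 <= e -> (\int[lebesgue_measure]_x (e * m r x)%:E = e%:E)%E.
    move=> e0; under eq_integral do rewrite EFinM.
    rewrite ge0_integralZl//.
    - by rewrite integral_normal_pdf mule1.
    - by apply/measurable_EFinP; exact: mm.
    - by move=> y _; rewrite lee_fin.
  under eq_integral do rewrite mI//.
  under eq_integral do rewrite -[m _ _]mul1r.
  by rewrite mI// mule1.
by move=> z _; rewrite lee_fin mulr_ge0.
Qed.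

End NormalLaws.

Section Laws.
Context {d} {T : measurableType d} {R : realType} (P : probability T R).
Implicit Types (Z : T -> 'cV[R]_2).

Lemma has_law_ge0_integral Z (mu : {measure set (R * R) -> \bar R}) (g : R * R -> \bar R) :
  random_vector Z -> has_law P Z mu ->
  measurable_fun setT g -> (forall z, 0 <= g z)%E ->
  (\int[P]_w g (pair_of (Z w)) = \int[mu]_z g z)%E.
Proof.
move=> mZ hZ mg g0.
rewrite -[LHS](@ge0_integral_pushforward _ _ _ _ _ _ mZ P setT g)//.
by apply: eq_measure_integral => A mA _; exact: hZ.
Qed.

Lemma has_law_integral Z (mu : {measure set (R * R) -> \bar R}) (g : R * R -> R) :
  random_vector Z -> has_law P Z mu -> measurable_fun setT g ->
  (\int[P]_w (g (pair_of (Z w)))%:E = \int[mu]_z (g z)%:E)%E.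
Proof.
move=> mZ hZ mg; have mg' : measurable_fun setT (EFin \o g) by exact/measurable_EFinP.
rewrite integralE [RHS]integralE; congr (_ - _)%E.
- rewrite -(has_law_ge0_integral mZ hZ (measurable_funepos mg'))//.
  by apply: eq_integral => w _; rewrite !funeposE.
- rewrite -(has_law_ge0_integral mZ hZ (measurable_funeneg mg'))//.
  by apply: eq_integral => w _; rewrite !funenegE.
Qed.

Lemma measurable_coord0 Z : random_vector Z -> measurable_fun setT (fun w => Z w 0 0).
Proof. by move=> mZ; exact: (measurableT_comp measurable_fst mZ). Qed.

Lemma measurable_coord1 Z : random_vector Z -> measurable_fun setT (fun w => Z w 1 0).
Proof. by move=> mZ; exact: (measurableT_comp measurable_snd mZ). Qed.

Lemma measurable_eigc i Z : random_vector Z -> measurable_fun setT (fun w => eigc i (Z w)).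
Proof.
move=> mZ; apply: measurable_funD; first exact: measurable_coord0.
by apply: measurable_funM => //; exact: measurable_coord1.
Qed.

Section ScalarNormal.
Variables (Z : T -> 'cV[R]_2) (s : R).
Hypotheses (s0 : 0 < s) (mZ : random_vector Z) (hZ : has_law P Z (normal2 s%:M)).

Let comb p q w := p * Z w 0 0 + q * Z w 1 0.

Let mcomb p q : measurable_fun setT (comb p q).
Proof.
by apply: measurable_funD; apply: measurable_funM => //; [exact: measurable_coord0|exact: measurable_coord1].
Qed.

Let mgf p q (l : R) :
  (\int[P]_w (expR (l * comb p q w))%:E = (expR (l ^+ 2 * ((p ^+ 2 + q ^+ 2) * s) / 2))%:E)%E.
Proof.
pose g (z : R * R) := (expR (l * p * z.1 + l * q * z.2))%:E.
have mg : measurable_fun setT g.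
  apply/measurable_EFinP/measurableT_comp => //.
  by apply: measurable_funD; apply: measurable_funM.
transitivity (\int[P]_w g (pair_of (Z w)))%E.
  by apply: eq_integral => w _; rewrite /g /comb /= mulrDr !mulrA.
rewrite (has_law_ge0_integral mZ hZ mg)//; last by move=> z; rewrite lee_fin expR_ge0.
by rewrite /g normal2_mgf//; congr (expR _)%:E; ring.
Qed.

Lemma normal2_eigcE i : (fun w => eigc i (Z w)) = comb 1 ((-1) ^+ i).
Proof. by apply/funext => w; rewrite /comb mul1r. Qed.

Let v2 i : (1 ^+ 2 + ((-1) ^+ i) ^+ 2) * s = 2 * s.
Proof. by rewrite -exprM mulnC exprM sqrrN !expr1n -mulr2n. Qed.

Let s2 i : 0 < (1 ^+ 2 + ((-1) ^+ i) ^+ 2 : R) * s.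
Proof. by rewrite v2 mulr_gt0. Qed.

Lemma normal2_moments_eigc i : moments P (fun w => eigc i (Z w)).
Proof. by rewrite normal2_eigcE; exact: (gaussian_moments (mcomb _ _) (mgf _ _)). Qed.

Lemma normal2_mean_eigc i : mean P (fun w => eigc i (Z w)) = 0.
Proof. by rewrite normal2_eigcE; exact: (gaussian_mean (s2 i) (mcomb _ _) (mgf _ _)). Qed.

Lemma normal2_mean_eigc4 i :
  mean P (fun w => `|eigc i (Z w)| ^+ 4) <= 48 * expR 2^-1 * 4 * s ^+ 2.
Proof.
have := gaussian_mean4 (s2 i) (mcomb _ _) (mgf 1 ((-1) ^+ i)).
by rewrite -normal2_eigcE v2 exprMn -natrX mulrA.
Qed.

Lemma normal2_mean_eigcM i j :
  mean P (fun w => eigc i (Z w) * eigc j (Z w)) = (i == j)%:R * 2 * s.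
Proof.
have [<-|ij] := eqVneq i j.
  rewrite mul1r -(v2 i) -(gaussian_mean_sqr (s2 i) (mcomb _ _) (mgf 1 ((-1) ^+ i))) -normal2_eigcE.
  by apply: mean_ext => w; rewrite expr2.
rewrite !mul0r.
have m1 := gaussian_moments (mcomb 1 0) (mgf 1 0).
have m2 := gaussian_moments (mcomb 0 1) (mgf 0 1).
have v1 : 0 < (1 ^+ 2 + 0 ^+ 2 : R) * s by rewrite expr0n expr1n addr0 mul1r.
have v3 : 0 < (0 ^+ 2 + 1 ^+ 2 : R) * s by rewrite expr0n expr1n add0r mul1r.
(* Distinct eigencoordinates multiply to the difference of the squared coordinates, and both
   coordinates have variance s. *)
rewrite (@mean_ext _ _ _ P _ (fun w => comb 1 0 w ^+ 2 - comb 0 1 w ^+ 2)) => [|w].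
  rewrite meanB; try exact: momentsX.
  rewrite (gaussian_mean_sqr v1 (mcomb _ _) (mgf 1 0)) (gaussian_mean_sqr v3 (mcomb _ _) (mgf 0 1)).
  by ring.
by rewrite /comb /eigc; case: i j ij => [] [] //= _; ring.
Qed.

End ScalarNormal.

(** The inverse covariance 2 Q is bounded below by 2 m with m the smaller eigenvalue, so the scalar
    law of variance 1 / (2 m) dominates up to a constant. Finite exponential moments carry over from
    it. *)
Lemma normal2_pdf_le (theta : 'cV[R]_2) : Theta theta ->
  exists v C, [/\ 0 < v, 0 <= C & forall z,
  normal2_pdf (2^-1 *: invmx (Qmx theta)) z <= C * normal2_pdf v%:M z].
Proof.
move=> /ThetaE[l0 l1].
pose m := Order.min (eigc false theta) (eigc true theta).
have m0 : 0 < m by rewrite lt_min l0.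
pose v := (2 * m)^-1; have v0 : 0 < v by rewrite invr_gt0 mulr_gt0.
have Qu : Qmx theta \in unitmx by rewrite unitmxE det_Qmx unitfE gt_eqF// mulr_gt0.
pose S := 2^-1 *: invmx (Qmx theta).
have SV : invmx S = 2 *: Qmx theta.
  by rewrite invmxZ ?unitmxZ ?unitmx_inv ?unitfE ?invr_eq0// invmxK invrK.
pose c := (2 * pi * Num.sqrt (\det S))^-1.
have c0 : 0 <= c by rewrite invr_ge0 !mulr_ge0 ?pi_ge0 ?sqrtr_ge0.
have p0 : 0 < 2 * pi * v by rewrite !mulr_gt0 ?pi_gt0.
exists v, (c * (2 * pi * v)); split=> // [|z]; first by apply: mulr_ge0 => //; exact: ltW.
rewrite /normal2_pdf -/S -/c det_scalar sqrtr_sqr (gtr0_norm v0) mulrA.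
rewrite [leRHS](_ : _ = c * expR (- (2^-1 * dotv (col_of z) (invmx v%:M *m col_of z)))); last first.
  by rewrite mulfK// gt_eqF.
apply: ler_wpM2l => //; rewrite ler_expR lerN2; apply: ler_wpM2l => //.
rewrite invmx_scalar mul_scalar_mx SV -scalemxAl !dotv_eigc /v invrK.
set x := col_of z; have eZ i (a : R) (y : 'cV[R]_2) : eigc i (a *: y) = a * eigc i y.
  by rewrite /eigc !mxE; ring.
rewrite !eZ !eigc_Qmx; set e0 := eigc false x; set e1 := eigc true x.
have m1 : m <= eigc false theta by rewrite ge_min lexx.
have m2 : m <= eigc true theta by rewrite ge_min lexx orbT.
have := ler_wpM2r (sqr_ge0 e0) m1; have := ler_wpM2r (sqr_ge0 e1) m2.
by rewrite !expr2; lra.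
Qed.

Lemma stationary_law_moments (theta : 'cV[R]_2) Z i : Theta theta ->
  random_vector Z -> has_law P Z (mu_ theta) -> moments P (fun w => eigc i (Z w)).
Proof.
move=> th mZ hZ; have [v [C [v0 C0 hC]]] := normal2_pdf_le th.
apply: moments_mgf_lty => [|l]; first exact: measurable_eigc.
pose g (z : R * R) := (expR (l * z.1 + (l * (-1) ^+ i) * z.2))%:E.
have mg : measurable_fun setT g.
  apply/measurable_EFinP/measurableT_comp => //.
  by apply: measurable_funD; apply: measurable_funM.
have g0 z : (0 <= g z)%E by rewrite lee_fin expR_ge0.
rewrite (eq_integral (fun w => g (pair_of (Z w)))); last first.
  by move=> w _; rewrite /g /eigc /= mulrDr !mulrA.
rewrite (has_law_ge0_integral mZ hZ mg g0) normal2_ge0_integral//.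
have mpdf (S : 'M[R]_2) : measurable_fun [set: measurableTypeR R * measurableTypeR R] (fun z => (normal2_pdf S z)%:E).
  by apply/measurable_EFinP; exact: measurable_normal2_pdf.
have mg' : measurable_fun [set: measurableTypeR R * measurableTypeR R] g by exact: mg.
have p0 (S : 'M[R]_2) z : (0 <= (normal2_pdf S z)%:E)%E by rewrite lee_fin normal2_pdf_ge0.
apply: (@le_lt_trans _ _ (\int[(@lebesgue_measure R \x @lebesgue_measure R)]_z (C%:E * (g z * (normal2_pdf v%:M z)%:E)))%E).
  apply: ge0_le_integral => //.
  - by move=> z _; rewrite mule_ge0.
  - exact: emeasurable_funM.
  - by apply: emeasurable_funM => //; exact: emeasurable_funM.
  - by move=> z _; rewrite muleCA; apply: lee_wpmul2l => //; rewrite -EFinM lee_fin.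
rewrite ge0_integralZl//.
- by rewrite -normal2_ge0_integral// normal2_mgf// -EFinM ltry.
- exact: emeasurable_funM.
- by move=> z _; rewrite mule_ge0.
Qed.

End Laws.

(** * Histories and the Ornstein-Uhlenbeck process *)

Section SubSigmaAlgebras.
Context {d} {T : measurableType d} {R : realType}.
Implicit Types (F G : set (set T)).

Lemma measurable_fun_g_sigma {d'} {T' : measurableType d'} F (f : T -> T') :
  (forall B, measurable B -> <<s F >> (f @^-1` B)) ->
  measurable_fun [set: g_sigma_algebraType F] f.
Proof. by move=> h _ B mB; rewrite setTI; exact: h. Qed.

Lemma measurable_fun_g_sigmaP {d'} {T' : measurableType d'} F (f : T -> T') :
  measurable_fun [set: g_sigma_algebraType F] f ->
  forall B, measurable B -> <<s F >> (f @^-1` B).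
Proof. by move=> h B mB; have := h measurableT B mB; rewrite setTI. Qed.

Lemma g_sigma_measurable F : F `<=` measurable -> <<s F >> `<=` (measurable : set (set T)).
Proof. by move=> FM; apply: smallest_sub => //; exact: sigma_algebra_measurable. Qed.

Lemma g_sigma_mono F G : F `<=` <<s G >> -> <<s F >> `<=` <<s G >>.
Proof. by move=> FG; apply: smallest_sub => //; exact: smallest_sigma_algebra. Qed.

Lemma sigma_ofE (Y : T -> 'cV[R]_2) A :
  sigma_of Y A <-> exists2 B, measurable B & (pair_of \o Y) @^-1` B = A.
Proof.
by split=> -[B mB <-]; exists B => //; rewrite setTI.
Qed.

Lemma sigma_of_setT (Y : T -> 'cV[R]_2) : sigma_of Y setT.
Proof. by apply/sigma_ofE; exists setT. Qed.

Lemma sigma_of_setI (Y : T -> 'cV[R]_2) A B :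
  sigma_of Y A -> sigma_of Y B -> sigma_of Y (A `&` B).
Proof.
move=> /sigma_ofE[A' mA <-] /sigma_ofE[B' mB <-]; apply/sigma_ofE.
by exists (A' `&` B') => //; exact: measurableI.
Qed.

Lemma sigma_of_measurable (Y : T -> 'cV[R]_2) : random_vector Y ->
  sigma_of Y `<=` (measurable : set (set T)).
Proof. by move=> mY _ /sigma_ofE[B mB <-]; rewrite -[X in measurable X]setTI; exact: mY. Qed.

Lemma random_vector_g_sigma F (Y : T -> 'cV[R]_2) : sigma_of Y `<=` <<s F >> ->
  random_vector (Y : g_sigma_algebraType F -> _).
Proof. by move=> YF; apply: measurable_fun_g_sigma => B mB; apply: YF; apply/sigma_ofE; exists B. Qed.

Lemma random_vectorB {d'} {T' : measurableType d'} (Y Z : T' -> 'cV[R]_2) :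
  random_vector Y -> random_vector Z -> random_vector (fun w => Y w - Z w).
Proof.
move=> mY mZ; apply/measurable_fun_pairP; split; rewrite /comp /= /pair_of /=.
- rewrite (_ : (fun _ => _) = (fun w => Y w 0 0 - Z w 0 0)); last by apply/funext => w; rewrite !mxE.
  by apply: measurable_funB; exact: measurable_coord0.
- rewrite (_ : (fun _ => _) = (fun w => Y w 1 0 - Z w 1 0)); last by apply/funext => w; rewrite !mxE.
  by apply: measurable_funB; exact: measurable_coord1.
Qed.

End SubSigmaAlgebras.

Section History.
Context {d} {T : measurableType d} {R : realType} (P : probability T R)
  (theta : 'cV[R]_2) (W X : R -> T -> 'cV[R]_2) (XOU : stationary_ou P theta W X).

(** The intersections themselves and not the sigma-algebra they generate: a system closed under
    intersection, as the uniqueness of measures requires. *)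
Definition history (t : R) : set (set T) :=
  [set C | exists A B, [/\ sigma_of (X 0) A, sigma_of_family `[0, t] W B & C = A `&` B]].

Local Notation hist t := (g_sigma_algebraType (history t)).

Lemma sigma_of_family_mono (I J : set R) : I `<=` J ->
  sigma_of_family I W `<=` sigma_of_family J W.
Proof.
move=> IJ; apply: g_sigma_mono => A [t It At].
by apply: sub_sigma_algebra; exists t => //; exact: IJ.
Qed.

Lemma sigma_of_family_setT (I : set R) : sigma_of_family I W setT.
Proof. exact: (@measurableT _ (g_sigma_algebraType (\bigcup_(t in I) sigma_of (W t)))). Qed.

Lemma sigma_of_family_setI (I : set R) A B : sigma_of_family I W A ->
  sigma_of_family I W B -> sigma_of_family I W (A `&` B).
Proof. exact: (@measurableI _ (g_sigma_algebraType (\bigcup_(t in I) sigma_of (W t)))). Qed.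

Lemma sigma_of_family_measurable (I : set R) : I `<=` `[0, +oo[ ->
  sigma_of_family I W `<=` measurable.
Proof.
move=> I0; apply: g_sigma_measurable => A [t /I0]; rewrite /= in_itv /= andbT => t0.
exact: sigma_of_measurable (wiener_meas (ou_wiener XOU) t0) _.
Qed.

Lemma history_mono s t : s <= t -> <<s history s >> `<=` <<s history t >>.
Proof.
move=> st; apply: g_sigma_mono => _ [A [B [hA hB ->]]].
apply: sub_sigma_algebra; exists A, B; split=> //.
apply: sigma_of_family_mono hB => r /=; rewrite !in_itv /= => /andP[-> /=] rs.
exact: le_trans rs st.
Qed.

Lemma history_measurable t : history t `<=` measurable.
Proof.
move=> _ [A [B [hA hB ->]]]; apply: measurableI.
- exact: sigma_of_measurable (ou_meas XOU (lexx 0)) _ hA.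
- apply: sigma_of_family_measurable hB => r /=.
  by rewrite !in_itv /= andbT => /andP[].
Qed.

Lemma history_X0 t : random_vector (X 0 : hist t -> _).
Proof.
apply: random_vector_g_sigma => A hA; apply: sub_sigma_algebra.
by exists A, setT; rewrite setIT; split=> //; exact: sigma_of_family_setT.
Qed.

Lemma history_W r t : 0 <= r -> r <= t -> random_vector (W r : hist t -> _).
Proof.
move=> r0 rt; apply: random_vector_g_sigma => A hA; apply: sub_sigma_algebra.
exists setT, A; rewrite setTI; split=> //; first exact: sigma_of_setT.
by apply: sub_sigma_algebra; exists r => //=; rewrite in_itv /= r0.
Qed.

Lemma sigma_of_increment s t : 0 <= s -> 0 <= t ->
  sigma_of (fun w => W t w - W s w) `<=` sigma_of_family `[0, +oo[ W.
Proof.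
move=> s0 t0 _ /sigma_ofE[B mB <-].
have mW r : 0 <= r ->
    random_vector (W r : g_sigma_algebraType (\bigcup_(t in `[0, +oo[) sigma_of (W t)) -> _).
  move=> r0; apply: random_vector_g_sigma => A hA; apply: sub_sigma_algebra.
  by exists r => //=; rewrite in_itv /= r0.
exact: measurable_fun_g_sigmaP (random_vectorB (mW t t0) (mW s s0)) B mB.
Qed.

(** For fixed E both sides are finite measures in D. They agree on the intersections A [&] B of
    [history s] because X_0 is independent of the whole of W and the increment of W on [0, s];
    uniqueness of measures extends this to the generated sigma-algebra. *)
Lemma history_indep s t D E : 0 <= s -> s < t ->
  <<s history s >> D -> sigma_of (fun w => W t w - W s w) E ->
  P (D `&` E) = (P D * P E)%E.
Proof.
move=> s0 st hD hE; have t0 := le_trans s0 (ltW st).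
have hE' := sigma_of_increment s0 t0 hE.
have mE : measurable E by exact: sigma_of_family_measurable hE'.
have c0 : 0 <= fine (P E) by exact: fine_ge0.
pose c : {nonneg R} := NngNum c0.
have cE : (c%:num%:E = P E)%E by rewrite fineK// fin_num_measure.
rewrite -cE muleC.
apply: (@g_sigma_algebra_measure_unique _ R T (history s) (@history_measurable s)
  (fun=> setT) _ _ (mrestr P mE) (mscale c P)) => //.
- by move=> _; exists setT, setT; rewrite setIT; split=> //; [exact: sigma_of_setT|exact: sigma_of_family_setT].
- by rewrite bigcup_const.
- move=> _ _ [A [B [hA hB ->]]] [A' [B' [hA' hB' ->]]].
  exists (A `&` A'), (B `&` B'); rewrite setIACA; split=> //.
    exact: sigma_of_setI.
  exact: sigma_of_family_setI.
- move=> _ [A [B [hA hB ->]]]; rewrite /= /mrestr [RHS](_ : _ = P E * P (A `&` B))%E; last by rewrite -cE.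
  have hB' : sigma_of_family `[0, +oo[ W B.
    by apply: sigma_of_family_mono hB => r /=; rewrite !in_itv /= andbT => /andP[].
  rewrite -setIA (ou_indep XOU hA (sigma_of_family_setI hB' hE')) (ou_indep XOU hA hB').
  rewrite setIC (wiener_indep (ou_wiener XOU) s0 st hE hB).
  by rewrite muleCA.
- by move=> _; rewrite /mrestr /= (le_lt_trans (probability_le1 _ _)) ?ltry//; exact: measurableI.
Qed.

End History.

Section IndependentProduct.
Context {d} {T : measurableType d} {R : realType} (P : probability T R).

(** Independence identifies the joint law with the product of the two laws, and Fubini splits the
    integral of the product of coordinates. *)
Lemma mean_independent (G H : T -> R) : moments P G -> moments P H ->
  (forall A B : set R, measurable A -> measurable B ->
     P (G @^-1` A `&` H @^-1` B) = (P (G @^-1` A) * P (H @^-1` B))%E) ->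
  mean P (fun w => G w * H w) = mean P G * mean P H.
Proof.
move=> mG mH ind; have mG' := moments_meas mG; have mH' := moments_meas mH.
pose G' : {mfun T >-> R} := mfun_Sub (mem_set mG').
pose H' : {mfun T >-> R} := mfun_Sub (mem_set mH').
pose m1 := distribution P G'; pose m2 := distribution P H'.
pose phi w := (G w, H w).
have mphi : measurable_fun setT phi by apply/measurable_fun_pairP; split.
have iG := moments_integrable mG; have iH := moments_integrable mH.
have iGH := moments_integrable (momentsM mG mH).
pose f (z : R * R) := (z.1 * z.2)%:E.
have mf : measurable_fun setT f by apply/measurable_EFinP; exact: measurable_funM.
have unique A : measurable A -> (m1 \x m2)%E A = pushforward P phi A.
  apply: product_measure_unique => B C mB mC.
  rewrite /m1 /m2 /distribution /pushforward /= -ind//; congr (P _).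
have unique_int (g : R * R -> \bar R) : (\int[m1 \x m2]_z g z = \int[pushforward P phi]_z g z)%E.
  by apply: eq_measure_integral => A mA _; exact: unique.
have if' : (m1 \x m2)%E.-integrable setT f.
  apply/integrableP; split=> //; rewrite unique_int.
  have /integrableP[_] := integrable_pushforward mphi mf iGH measurableT; done.
have im (K : {mfun T >-> R}) : P.-integrable setT (EFin \o K) ->
    (distribution P K).-integrable setT EFin /\ (\int[distribution P K]_x x%:E = \int[P]_w (K w)%:E)%E.
  move=> iK; have mK : measurable_fun setT K by [].
  have mE : measurable_fun [set: R] (@EFin R) by exact/measurable_EFinP.
  split; first exact: (integrable_pushforward mK mE iK measurableT).
  exact: (integral_pushforward mK mE iK measurableT).
have [i1 e1] := im G' iG; have [i2 e2] := im H' iH.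
have fin1 := integrable_fin_num measurableT i1; have fin2 := integrable_fin_num measurableT i2.
have e12 : (\int[P]_w (G w * H w)%:E = \int[m1]_x x%:E * \int[m2]_y y%:E)%E.
  rewrite -[LHS](integral_pushforward mphi mf iGH measurableT) -unique_int -integral12_prod_meas1//.
  rewrite /fubini_F /f /=.
  under eq_integral => x _.
    under eq_integral do rewrite EFinM.
    rewrite integralZl//.
    over.
  rewrite -(fineK fin2).
  by under eq_integral do rewrite muleC; rewrite integralZl// muleC.
by rewrite /mean /Rintegral e12 fineM// e1 e2.
Qed.

End IndependentProduct.

(** * Pathwise solution of the linear integral equation *)

Section Volterra.
Context {R : realType}.

(* Integrating [expR (a r) * I' r + a * expR (a r) * I r] for [I t = pathint 0 t U]. *)
Lemma volterra_solution (a : R) (U g : R -> R) : cpos U -> cpos g ->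
  (forall t, 0 <= t -> U t = g t - a * pathint 0 t U) ->
  forall t, 0 <= t ->
  U t = g t - a * expR (- (a * t)) * pathint 0 t (fun r => expR (a * r) * g r).
Proof.
move=> cU cg eU t t0; rewrite {1}eU// -mulrA; congr (_ - _ * _).
have [<-|t_neq0] := eqVneq 0 t.
  by rewrite /pathint set_itv1 !Rintegral_set1 mulr0.
have tpos : 0 < t by rewrite lt_neqAle t_neq0.
have ce : continuous (fun r : R => expR (a * r)).
  by move=> r; apply: continuous_comp; [exact: mulrl_continuous|exact: continuous_expR].
pose V r := U (Num.max 0 r); pose I r := pathint 0 r V.
have cV : continuous V by exact: cU.
have IE r : I r = pathint 0 r U.
  by apply: eq_pathint => x /andP[x0 _]; rewrite /V max_r.
have iV u : lebesgue_measure.-integrable `[0, u] (EFin \o V).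
  exact: cpos_integrable (cpos_continuous cV).
have dI x : 0 < x -> derivable I x 1 /\ I^`()%classic x = V x.
  move=> x0; apply: (@continuous_FTC1 _ _ (BLeft 0) x (x + 1)) => //.
  - by rewrite ltrDl.
  - exact: cV.
have LI : derivable_oo_LRcontinuous I 0 t.
  split.
  - by move=> x; rewrite in_itv /= => /andP[x0 _]; exact: (dI x x0).1.
  - rewrite [I 0]/I /pathint set_itv1 Rintegral_set1; apply: cvg_at_right_filter.
    exact: (parameterized_integral_cvg_left tpos (iV t)).
  - apply: cvg_at_left_filter; apply: differentiable_continuous; apply/derivable1_diffP.
    exact: (dI t tpos).1.
pose G r := expR (a * r); pose dG r := a * expR (a * r).
have GD (r : R) : is_derive r (1 : R) G (dG r).
  by apply: is_derive_eq; rewrite /dG /GRing.scale /=; ring.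
have LG : derivable_oo_LRcontinuous G 0 t.
  split.
  - by move=> x _; exact: ex_derive.
  - apply: cvg_at_right_filter; exact: ce.
  - apply: cvg_at_left_filter; exact: ce.
have cdG : continuous dG.
  move=> r; apply: (@continuous_comp _ _ _ G ( *%R a)); first exact: ce.
  exact: mulrl_continuous.
have hI : {in `]0, t[, I^`()%classic =1 V}.
  by move=> x; rewrite in_itv /= => /andP[x0 _]; exact: (dI x x0).2.
have hG : {in `]0, t[, G^`()%classic =1 dG}.
  by move=> x _; rewrite derive1E; exact: derive_val.
have := integration_by_parts tpos (continuous_subspaceT cV) LI hI (continuous_subspaceT cdG) LG hG.
have cE := cpos_continuous ce.
have toR (f : R -> R) : cpos f -> (\int[lebesgue_measure]_(x in `[0%R, t]) (f x)%:E = (pathint 0 t f)%:E)%E.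
  by move=> cf; rewrite /pathint /Rintegral fineK//; apply: integrable_fin_num => //; exact: cpos_integrable.
have cgU : cpos (fun r => expR (a * r) * (g r - U r)) by exact: cposM cE (cposB cg cU).
have cUe : cpos (fun r => expR (a * r) * U r) by exact: cposM.
rewrite (@eq_integral _ (measurableTypeR R) _ _ _ (fun x => (expR (a * x) * (g x - U x))%:E)); last first.
  move=> x /set_mem /=; rewrite in_itv /= => /andP[x0 xt].
  by rewrite IE /dG {1}(eU x x0); congr (_%:E); ring.
rewrite toR// [X in (_ - X)%E](@eq_integral _ (measurableTypeR R) _ _ _ (fun x => (expR (a * x) * U x)%:E)); last first.
  by move=> x /set_mem /=; rewrite in_itv /= => /andP[x0 xt]; rewrite /V max_r// mulrC.
rewrite toR// -EFinB => -[].
rewrite (@eq_pathint _ _ _ _ (fun r => expR (a * r) * g r - expR (a * r) * U r)); last first.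
  by move=> r _; rewrite mulrBr.
rewrite pathintB//; last exact: cposM.
have -> : I 0 = 0 by rewrite /I /pathint set_itv1 Rintegral_set1.
rewrite mul0r subr0 IE => /subIr ->.
by rewrite mulrCA /G -expRD addNr expR0 mulr1.
Qed.

End Volterra.

Section PathContinuity.
Context {R : realType}.
Implicit Types (f g h : R -> R).

Lemma cpos_segment g : (forall b, 0 <= b -> {within `[0, b], continuous (g : R -> R)}) -> cpos g.
Proof.
move=> cg x; set y := Order.max 0 x.
have y0 : 0 <= y by rewrite /y le_max lexx.
have yb : `[0, y + 1]%classic y by rewrite /mkset in_itv /= lerDl ler01 andbT.
have cy : (Order.max 0 z) @[z --> x] --> y by exact: cvg_max0.
have gy : g r @[r --> within `[0, y + 1]%classic (nbhs y)] --> g y.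
  by have := cg _ (addr_ge0 y0 ler01) y; rewrite /continuous_at /nbhs/= /nbhs_subspace /= mem_set.
have near_b : \forall z \near x, Order.max 0 z < y + 1.
  by have := cvgr_lt _ cy (y + 1); apply; rewrite ltrDl.
move=> A /gy hA.
rewrite nbhs_filterE; have := cy _ hA; rewrite nbhs_filterE.
apply: (@filterS2 _ (nbhs x) _ _ _ _ _ near_b) => z zb h; apply: h.
by rewrite /mkset /= in_itv /= le_max lexx /= ltW.
Qed.

Lemma cpos_pathint f : cpos f -> cpos (fun t => pathint 0 t f).
Proof.
move=> cf; apply: cpos_segment => b b0.
exact: (parameterized_integral_continuous b0 (@cpos_integrable _ 0 b f (lexx 0) cf)).
Qed.

Lemma cpos_comp f h : cpos f -> continuous (h : R -> R) -> (forall r, 0 <= r -> 0 <= h r) ->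
  cpos (fun r => f (h r)).
Proof.
move=> cf ch h0 x; pose k z := h (Order.max 0 z).
have ck : continuous (k : R -> R) by exact: cpos_continuous.
have e : (fun r => f (h (Order.max 0 r))) = (fun r => f (Order.max 0 (k r))).
  by apply/funext => r; rewrite [Order.max 0 (k r)]max_r// h0// le_max lexx.
by rewrite e; exact: (@continuous_comp R R R k (fun z => f (Order.max 0 z)) x (ck x) (cf _)).
Qed.

Lemma cpos_min f (b : R) : 0 <= b -> cpos f -> cpos (fun r => f (Order.min r b)).
Proof.
move=> b0 cf; apply: cpos_comp => //= [r|r r0]; last by rewrite le_min r0.
by apply: (@continuous_min R R id (fun=> b) r); [exact: cvg_id|exact: cvg_cst].
Qed.

Lemma cpos_coord (k : 'I_2) (x : R -> 'cV[R]_2) : {within `[0, +oo[, continuous x} ->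
  cpos (fun r => x r k 0).
Proof.
move=> cx; apply: cpos_within.
apply: (@within_continuous_comp _ _ _ _ x (fun M : 'cV[R]_2 => M k 0) _ cx).
by move=> M _; exact: coord_continuous.
Qed.

Lemma cpos_eigc i (x : R -> 'cV[R]_2) : {within `[0, +oo[, continuous x} ->
  cpos (fun r => eigc i (x r)).
Proof.
by move=> cx; apply: cposD; [exact: cpos_coord|apply: cposM; [exact: cpos_cst|exact: cpos_coord]].
Qed.

End PathContinuity.

Lemma moments_ae_eq {d} {T : measurableType d} {R : realType} (P : probability T R)
    (G H : T -> R) : moments P G -> measurable_fun setT H ->
  (\forall w \ae P, G w = H w) -> moments P H.
Proof.
move=> [mG iG] mH GH; have mN (K : T -> R) n : measurable_fun setT K ->
    measurable_fun setT (fun w => `|(`|K w| ^+ n)%:E|)%E.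
  by move=> mK; apply: measurableT_comp => //; apply/measurable_EFinP/measurable_funX/meas_norm.
split=> // n; apply/integrableP; split; first by apply/measurable_EFinP/measurable_funX/meas_norm.
have /integrableP[_] := iG n; rewrite (ae_eq_integral (fun w => `|(`|H w| ^+ n)%:E|)%E) //.
- exact: mN.
- exact: mN.
- by apply: filterS GH => w ->.
Qed.

(** * The eigencoordinates as a pair of scalar processes *)

Section OUProcess.
Context {d} {T : measurableType d} {R : realType} (P : probability T R)
  (theta : 'cV[R]_2) (W X : R -> T -> 'cV[R]_2) (theta_in : Theta theta)
  (XOU : stationary_ou P theta W X).
Implicit Types (i j : bool) (G : T -> R).

Local Notation hist t := (g_sigma_algebraType (history W X t)).

Definition ou_rate i := eigc i theta.
Definition ou_coord i t w := eigc i (X t w).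
Definition ou_noise i t w := eigc i (W t w).

(* Up to null sets, since the integral equation only holds almost surely. *)
Definition ou_past s G := moments P G /\
  exists2 G' : T -> R, measurable_fun [set: hist s] G' & \forall w \ae P, G w = G' w.

Lemma ou_rate_gt0 i : 0 < ou_rate i.
Proof. by have /ThetaE[] := theta_in; case: i. Qed.

Lemma cpos_ou_coord i w : cpos (fun t => ou_coord i t w).
Proof. apply: (@cpos_eigc _ i (X ^~ w)); exact: ou_cont XOU w. Qed.

Lemma cpos_ou_noise i w : cpos (fun t => ou_noise i t w).
Proof. apply: (@cpos_eigc _ i (W ^~ w)); exact: wiener_cont (ou_wiener XOU) w. Qed.

Lemma ou_coord_eq i : \forall w \ae P, forall t, 0 <= t ->
  ou_coord i t w = (ou_coord i 0 w + ou_noise i t w) - ou_rate i * pathint 0 t (fun r => ou_coord i r w).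
Proof.
apply: filterS (ou_sde XOU) => w sde t t0.
rewrite {1}/ou_coord sde// eigcD eigcB addrAC; congr (_ + _ - _).
have cc k : cpos (fun r => (Qmx theta *m X r w) k 0).
  have cx k' : cpos (fun r => X r w k' 0).
    by apply: (@cpos_coord _ k' (X ^~ w)); exact: ou_cont XOU w.
  rewrite (_ : (fun _ => _) = (fun r => Qmx theta k 0 * X r w 0 0 + Qmx theta k 1 * X r w 1 0)); last first.
    by apply/funext => r; rewrite mulmx_col2.
  by apply: cposD; apply: cposM => //; exact: cpos_cst.
rewrite /eigc /integral_col !mxE -/(pathint _ _ _) -/(pathint _ _ _) -!pathintZ//; last first.
  exact: cpos_ou_coord.
rewrite -pathintD//; last by apply: cposM => //; exact: cpos_cst.
by apply: eq_pathint => r _; rewrite -[LHS]/(eigc i (Qmx theta *m X r w)) eigc_Qmx.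
Qed.

(** The explicit solution of the integral equation, written with X_0 and W only. Unlike [ou_coord]
    it is measurable with respect to the history on every path, and the two agree almost surely at
    all times simultaneously. *)
Definition ou_version i t w := (ou_coord i 0 w + ou_noise i t w) -
  ou_rate i * expR (- (ou_rate i * t)) *
  pathint 0 t (fun r => expR (ou_rate i * r) * (ou_coord i 0 w + ou_noise i r w)).

Let cpos_input i w : cpos (fun r => ou_coord i 0 w + ou_noise i r w).
Proof. by apply: cposD; [exact: cpos_cst|exact: cpos_ou_noise]. Qed.

Let cpos_expR (a : R) : cpos (fun r => expR (a * r)).
Proof.
apply: cpos_continuous => r.
by apply: continuous_comp; [exact: mulrl_continuous|exact: continuous_expR].
Qed.

Lemma ou_coord_version i : \forall w \ae P, forall t, 0 <= t ->
  ou_coord i t w = ou_version i t w.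
Proof.
apply: filterS (ou_coord_eq i) => w eU t t0.
apply: (@volterra_solution _ _ (fun r => ou_coord i r w) (fun r => ou_coord i 0 w + ou_noise i r w)) => //.
exact: cpos_ou_coord.
Qed.

Lemma cpos_ou_version i w : cpos (fun t => ou_version i t w).
Proof.
apply: cposB; first exact: cpos_input.
apply: cposM; last by apply: cpos_pathint; exact: cposM.
apply: cposM; first exact: cpos_cst.
by rewrite (_ : (fun _ => _) = (fun t => expR (- ou_rate i * t)))//; apply/funext => t; rewrite mulNr.
Qed.

(** [measurable_pathint] asks for a measurable integrand at all times r >= 0, but the history knows
    W only up to s; stopping the noise at [Order.min r t] meets this and leaves the integral over
    [0, t] unchanged. *)
Lemma measurable_ou_version i t s : 0 <= t -> t <= s ->
  measurable_fun [set: hist s] (ou_version i t).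
Proof.
move=> t0 ts.
have mX0 : measurable_fun [set: hist s] (ou_coord i 0).
  by apply: (@measurable_eigc _ (hist s) R i (X 0)); exact: history_X0.
have mN r : 0 <= r -> r <= s -> measurable_fun [set: hist s] (ou_noise i r).
  by move=> r0 rs; apply: (@measurable_eigc _ (hist s) R i (W r)); exact: history_W.
have mI : measurable_fun [set: hist s] (fun w =>
    pathint 0 t (fun r => expR (ou_rate i * r) * (ou_coord i 0 w + ou_noise i (Order.min r t) w))).
  apply: (@measurable_pathint _ (hist s) R) => // [r r0|w].
    apply: measurable_funM => //; apply: measurable_funD => //.
    by apply: mN; rewrite ?le_min ?r0// ge_min ts orbT.
  by apply: cposM => //; apply: cposD; [exact: cpos_cst|apply: (@cpos_min _ (fun r => ou_noise i r w)) => //; exact: cpos_ou_noise].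
rewrite (_ : ou_version i t = (fun w => (ou_coord i 0 w + ou_noise i t w) -
  ou_rate i * expR (- (ou_rate i * t)) *
  pathint 0 t (fun r => expR (ou_rate i * r) * (ou_coord i 0 w + ou_noise i (Order.min r t) w)))).
  apply: measurable_funB; last exact: measurable_funM.
  by apply: measurable_funD => //; exact: mN.
apply/funext => w; congr (_ - _ * _); apply: eq_pathint => r /andP[_ rt].
by rewrite (min_idPl rt).
Qed.

Lemma ou_law t : 0 <= t -> has_law P (X t) (mu_ theta).
Proof.
move=> t0 A mA; rewrite -(ou_law0 XOU mA).
have := ou_stationary XOU (n := 1) (t := fun=> 0) (A := fun=> A) (fun=> lexx 0) (fun=> mA) t0.
rewrite add0r (_ : \bigcap_(i in [set: 'I_1]) _ = (pair_of \o X t) @^-1` A); last first.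
  by apply/seteqP; split=> [w /(_ ord0 I)|w h i _].
rewrite (_ : \bigcap_(i in [set: 'I_1]) _ = (pair_of \o X 0) @^-1` A)//.
by apply/seteqP; split=> [w /(_ ord0 I)|w h i _].
Qed.

Lemma mean_ou_stationary (g : R * R -> R) t : 0 <= t -> measurable_fun setT g ->
  mean P (fun w => g (pair_of (X t w))) = mean P (fun w => g (pair_of (X 0 w))).
Proof.
move=> t0 mg; rewrite /mean /Rintegral.
by rewrite !(has_law_integral _ (ou_law _) mg)//; exact: (ou_meas XOU).
Qed.

Lemma ou_coordE i t w : ou_coord i t w = eigc i (col_of (pair_of (X t w))).
Proof. by rewrite col_of_pair_of. Qed.

Lemma ou_coord_moments i t : 0 <= t -> moments P (ou_coord i t).
Proof.
move=> t0; apply: (stationary_law_moments i theta_in) (ou_law t0).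
exact: (ou_meas XOU t0).
Qed.

(** Stationarity makes every absolute moment independent of time. *)
Lemma tame_ou_coord i : tame P (ou_coord i).
Proof.
split=> [r r0|w|n]; [exact: ou_coord_moments|exact: cpos_ou_coord|].
exists (mean P (fun w => `|ou_coord i 0 w| ^+ n)) => r r0.
rewrite (@mean_ext _ _ _ P _ (fun w => `|eigc i (col_of (pair_of (X r w)))| ^+ n)); last first.
  by move=> w; rewrite -ou_coordE.
rewrite (@mean_ext _ _ _ P (fun w => `|ou_coord i 0 w| ^+ n) (fun w => `|eigc i (col_of (pair_of (X 0 w)))| ^+ n)); last first.
  by move=> w; rewrite -ou_coordE.
rewrite (@mean_ou_stationary (fun z => `|eigc i (col_of z)| ^+ n))//.
by apply: measurable_funX; apply: measurableT_comp => //; exact: measurable_eigc_col.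
Qed.

Lemma measurable_history {d'} {T' : measurableType d'} s (f : T -> T') :
  measurable_fun [set: hist s] f -> measurable_fun [set: T] f.
Proof.
move=> mf _ B mB; rewrite setTI.
exact: g_sigma_measurable (history_measurable XOU (t := s)) _ (measurable_fun_g_sigmaP mf mB).
Qed.

(** [G] is exchanged for a version measurable with respect to the history, which is independent of
    the increment of W after s. *)
Lemma ou_past_mean s t G (phi : R * R -> R) : 0 <= s -> s < t -> ou_past s G ->
  measurable_fun setT phi -> moments P (fun w => phi (pair_of (W t w - W s w))) ->
  mean P (fun w => G w * phi (pair_of (W t w - W s w))) =
  mean P G * mean P (fun w => phi (pair_of (W t w - W s w))).
Proof.
move=> s0 st [mG [G' mG' GG']] mphi mH.
have mG'T := measurable_history mG'.
have mmG' := moments_ae_eq mG mG'T GG'.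
rewrite (@mean_eq_ae _ _ _ P G G')//; last exact: moments_meas mG.
rewrite -mean_independent//.
  apply: mean_eq_ae; last by apply: filterS GG' => w ->.
  - by apply: measurable_funM; exact: (@moments_meas _ _ _ P).
  - by apply: measurable_funM => //; exact: (@moments_meas _ _ _ P).
move=> A B mA mB; apply: (history_indep XOU s0 st).
- exact: measurable_fun_g_sigmaP mG' _ mA.
- apply/sigma_ofE; exists (phi @^-1` B) => //.
  by rewrite -[X in measurable X]setTI; exact: mphi.
Qed.

Lemma ou_increment_law s t : 0 <= s -> s < t ->
  random_vector (fun w => W t w - W s w) /\ has_law P (fun w => W t w - W s w) (normal2 (t - s)%:M).
Proof.
move=> s0 st; split; last by apply: (wiener_incr (ou_wiener XOU)).
apply: random_vectorB; apply: (wiener_meas (ou_wiener XOU)) => //.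
by rewrite (le_trans s0) ?ltW.
Qed.

Lemma ou_noiseB i s t w : ou_noise i t w - ou_noise i s w = eigc i (W t w - W s w).
Proof. by rewrite eigcB. Qed.

Lemma ou_noiseBE i s t w :
  ou_noise i t w - ou_noise i s w = eigc i (col_of (pair_of (W t w - W s w))).
Proof. by rewrite col_of_pair_of ou_noiseB. Qed.

Lemma ou_past_coord i s t : 0 <= s -> s <= t -> ou_past t (ou_coord i s).
Proof.
move=> s0 st; split; first exact: ou_coord_moments.
exists (ou_version i s); first exact: measurable_ou_version.
by apply: filterS (ou_coord_version i) => w; apply.
Qed.

Theorem ou_pair_eigc : ou_pair P ou_rate ou_coord ou_noise ou_past.
Proof.
split.
- exact: ou_rate_gt0.
- by move=> s G _ [].
- by move=> s c; split; [exact: moments_cst|exists (fun=> c) => //; exact: aeW].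
- move=> s G H [mG [G' mG' GG']] [mH [H' mH' HH']]; split; first exact: momentsD.
  exists (fun w => G' w + H' w); first exact: measurable_funD.
  by apply: filterS2 GG' HH' => w -> ->.
- move=> s G H [mG [G' mG' GG']] [mH [H' mH' HH']]; split; first exact: momentsM.
  exists (fun w => G' w * H' w); first exact: measurable_funM.
  by apply: filterS2 GG' HH' => w -> ->.
- move=> s t G s0 st [mG [G' mG' GG']]; split=> //; exists G' => //.
  apply: measurable_fun_g_sigma => B mB; apply: (history_mono st).
  exact: measurable_fun_g_sigmaP mG' _ mB.
- exact: tame_ou_coord.
- by move=> i s s0; exact: ou_past_coord.
- move=> i j s s0; split.
    by apply: moments_pathint => //; apply: tameM; exact: tame_ou_coord.
  exists (fun w => pathint 0 s (fun r => ou_version i (Order.min r s) w * ou_version j (Order.min r s) w)).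
    apply: (@measurable_pathint _ (hist s) R) => // [r r0|w].
      by apply: measurable_funM; apply: measurable_ou_version; rewrite ?le_min ?r0// ge_min lexx orbT.
    apply: (@cpos_min _ (fun r => ou_version i r w * ou_version j r w)) => //.
    by apply: cposM; exact: cpos_ou_version.
  apply: filterS2 (ou_coord_version i) (ou_coord_version j) => w ei ej.
  by apply: eq_pathint => r /andP[r0 rs]; rewrite (min_idPl rs) ei// ej.
- move=> i s t s0 st; have t0 := le_trans s0 st.
  apply: filterS (ou_coord_eq i) => w e; rewrite (e t t0) (e s s0).
  rewrite (pathint_split (lexx 0) s0 st); last exact: cpos_ou_coord.
  by ring.
- move=> i s t s0 st; have [mZ hZ] := ou_increment_law s0 st.
  rewrite (_ : (fun w => _) = (fun w => eigc i (W t w - W s w))).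
    by apply: (normal2_moments_eigc _ mZ hZ); rewrite subr_gt0.
  by apply/funext => w; rewrite ou_noiseB.
- move=> i s t G s0 st pG; have [mZ hZ] := ou_increment_law s0 st.
  have ts0 : 0 < t - s by rewrite subr_gt0.
  have mm := normal2_moments_eigc ts0 mZ hZ i.
  have e w : eigc i (W t w - W s w) = eigc i (col_of (pair_of (W t w - W s w))) by rewrite col_of_pair_of.
  rewrite (@mean_ext _ _ _ P _ (fun w => G w * eigc i (col_of (pair_of (W t w - W s w))))) => [|w].
    rewrite (@ou_past_mean s t G (fun z => eigc i (col_of z)))//; last 2 first.
    + exact: measurable_eigc_col.
    + by under eq_fun do rewrite -e.
    rewrite (@mean_ext _ _ _ P (fun w => eigc i (col_of _)) (fun w => eigc i (W t w - W s w)))//.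
    by rewrite (normal2_mean_eigc ts0 mZ hZ) mulr0.
  by rewrite ou_noiseBE.
- move=> i j s t G s0 st pG; have [mZ hZ] := ou_increment_law s0 st.
  have ts0 : 0 < t - s by rewrite subr_gt0.
  have mm k := normal2_moments_eigc ts0 mZ hZ k.
  have e k w : eigc k (W t w - W s w) = eigc k (col_of (pair_of (W t w - W s w))) by rewrite col_of_pair_of.
  pose phi (z : R * R) := eigc i (col_of z) * eigc j (col_of z).
  have ephi : (fun w => phi (pair_of (W t w - W s w))) = (fun w => eigc i (W t w - W s w) * eigc j (W t w - W s w)).
    by apply/funext => w; rewrite /phi -!e.
  rewrite (@mean_ext _ _ _ P _ (fun w => G w * phi (pair_of (W t w - W s w)))) => [|w].
    rewrite (@ou_past_mean s t G phi)//; last 2 first.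
    + by apply: measurable_funM; exact: measurable_eigc_col.
    + by rewrite ephi; exact: momentsM.
    by rewrite ephi (normal2_mean_eigcM ts0 mZ hZ) mulrC.
  by rewrite !ou_noiseBE.
- move=> i; exists (48 * expR 2^-1 * 4); first by rewrite !mulr_ge0 ?expR_ge0.
  move=> s t s0 st; have [mZ hZ] := ou_increment_law s0 st.
  rewrite (@mean_ext _ _ _ P _ (fun w => `|eigc i (W t w - W s w)| ^+ 4)) => [|w]; last by rewrite ou_noiseB.
  by apply: (normal2_mean_eigc4 _ mZ hZ); rewrite subr_gt0.
- move=> i j t t0; pose g (z : R * R) := eigc i (col_of z) * eigc j (col_of z).
  rewrite (@mean_ext _ _ _ P _ (fun w => g (pair_of (X t w)))); last by move=> w; rewrite /g -!ou_coordE.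
  rewrite (@mean_ou_stationary g)//; last by apply: measurable_funM; exact: measurable_eigc_col.
  by apply: mean_ext => w; rewrite /g -!ou_coordE.
Qed.

End OUProcess.

(** * Spectral form of the predictor and of the likelihood *)

Section SpectralCalculus.
Context {R : realType}.
Implicit Types (k l : bool) (i j : 'I_2) (u x : 'cV[R]_2) (a b : R).

(** Coordinate i of the eigenvector (1, 1) or (1, -1). Then [eproj k] is the orthogonal projection
    onto its line, and the matrices at hand are the combinations [spectral a b] of the two
    projections: products, inverses and exponentials act on the two coefficients. *)
Definition esgn i k : R := if k && (i == 1) then -1 else 1.

Lemma esgn0 k : esgn 0 k = 1.
Proof. by rewrite /esgn andbF. Qed.

Lemma esgn1 k : esgn 1 k = (-1) ^+ k.
Proof. by rewrite /esgn andbT; case: k; rewrite ?expr0 ?expr1. Qed.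

Definition eproj k : 'M[R]_2 := \matrix_(i, j) (2^-1 * (esgn i k * esgn j k)).

Definition spectral a b : 'M[R]_2 := a *: eproj false + b *: eproj true.

Lemma spectralE a b i j : spectral a b i j = a * eproj false i j + b * eproj true i j.
Proof. by rewrite /spectral; move: (eproj _) (eproj _) => A B; rewrite !mxE. Qed.

Lemma coord_eigc x i : x i 0 = 2^-1 * (esgn i false * eigc false x + esgn i true * eigc true x).
Proof. by move: i; apply: ord2P; rewrite ?esgn0 ?esgn1 /eigc expr0 expr1; field. Qed.

Lemma Qmx_spectral u : Qmx u = spectral (eigc false u) (eigc true u).
Proof.
apply/matrixP; apply: ord2P; apply: ord2P; rewrite !mxE ?esgn0 ?esgn1 /eigc /= expr0 expr1; by field.
Qed.

Lemma spectralM a b c d : spectral a b *m spectral c d = spectral (a * c) (b * d).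
Proof.
apply/matrixP; apply: ord2P; apply: ord2P; rewrite mxE sum_ord2 !mxE ?esgn0 ?esgn1 /= ?expr0 ?expr1; by field.
Qed.

Lemma spectral1 : spectral 1 1 = 1%:M.
Proof.
apply/matrixP; apply: ord2P; apply: ord2P; rewrite !mxE ?esgn0 ?esgn1 /= ?expr0 ?expr1; by field.
Qed.

Lemma spectralZ c a b : c *: spectral a b = spectral (c * a) (c * b).
Proof. by rewrite /spectral scalerDr !scalerA. Qed.

Lemma spectralX a b n : spectral a b ^+ n = spectral (a ^+ n) (b ^+ n).
Proof.
elim: n => [|n IH]; first by rewrite !expr0 spectral1.
by rewrite !exprS IH -spectralM.
Qed.

Lemma eigc_spectral k a b x : eigc k (spectral a b *m x) = (if k then b else a) * eigc k x.
Proof.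
rewrite /eigc !mulmx_col2 !mxE ?esgn0 ?esgn1 /=.
by case: k; rewrite ?expr0 ?expr1; field.
Qed.

Lemma invmx_spectral a b : a != 0 -> b != 0 -> invmx (spectral a b) = spectral a^-1 b^-1.
Proof.
move=> a0 b0; have h : spectral a^-1 b^-1 *m spectral a b = 1%:M.
  by rewrite spectralM !mulVf// spectral1.
have [_ u] := mulmx1_unit h.
by rewrite -[LHS]mul1mx -h mulmxK.
Qed.

Lemma trmx_spectral a b : (spectral a b)^T = spectral a b.
Proof. by apply/matrixP => i j; rewrite !mxE; ring. Qed.

Lemma expmx_spectral a b : expmx (spectral a b) = spectral (expR a) (expR b).
Proof.
rewrite /expmx; have -> : series (fun k : nat => (k`!%:R)^-1 *: spectral a b ^+ k) =
    (fun n => series (exp_coeff a) n *: eproj false + series (exp_coeff b) n *: eproj true).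
  apply/funext => n; rewrite /series /= !scaler_suml -big_split /=.
  by apply: eq_bigr => k _; rewrite spectralX spectralZ /exp_coeff /= ![_ / _]mulrC.
apply: cvg_lim; first exact: norm_hausdorff.
by apply: cvgD; apply: cvgZr_tmp; exact: is_cvg_series_exp_coeff.
Qed.

Lemma expmx_Qmx c u : expmx (c *: Qmx u) = spectral (expR (c * eigc false u)) (expR (c * eigc true u)).
Proof. by rewrite Qmx_spectral spectralZ expmx_spectral. Qed.

Lemma eigc_predictor h k x u : eigc k (predictor h x u) = expR (- h * eigc k u) * eigc k x.
Proof. by rewrite /predictor expmx_Qmx eigc_spectral; case: k. Qed.

Lemma predictor_coord h x u i : predictor h x u i 0 =
  2^-1 * (esgn i false * (expR (- h * eigc false u) * eigc false x) +
          esgn i true * (expR (- h * eigc true u) * eigc true x)).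
Proof. by rewrite coord_eigc !eigc_predictor. Qed.

Lemma outer_mxE x i j : (x *m x^T) i j = x i 0 * x j 0.
Proof. by rewrite mxE big_ord1 [x^T _ _]mxE; congr (x _ _ * x _ _); apply/val_inj. Qed.

(** Turns a directional derivative in the plane into the derivative at 0 of a function of one real
    variable, to which the rules for real functions apply. *)
Lemma partial_line j (f : 'cV[R]_2 -> R) u :
  partial j f u = 'D_(1 : R) ((fun z : R => f (z *: delta_mx j 0 + u)) : R -> R^o) 0.
Proof.
rewrite /partial /derive.
suff e : (fun z : R => z^-1 *: (((f : _ -> R^o) \o shift u) (z *: delta_mx j 0) - f u)) =
    (fun z : R => z^-1 *: ((((fun z => f (z *: delta_mx j 0 + u)) : R -> R^o) \o shift 0) (z *: (1 : R)) - f (0 *: delta_mx j 0 + u))).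
  by rewrite e.
by apply/funext => z; rewrite /= addr0 scale0r add0r [z *: (1 : R)]mulr1.
Qed.

Lemma eigc_line z j u k : eigc k (z *: delta_mx j 0 + u) = z * esgn j k + eigc k u.
Proof.
by move: j; apply: ord2P; rewrite /eigc !mxE ?esgn0 ?esgn1 /=; ring.
Qed.

Lemma jacobian_predictor h x u : jacobian_col (predictor h x) u =
  spectral (- h * expR (- h * eigc false u) * eigc false x)
           (- h * expR (- h * eigc true u) * eigc true x).
Proof.
apply/matrixP => i j; rewrite mxE partial_line.
pose D k : R := esgn j k * (- h * expR (- h * eigc k u) * eigc k x).
have dk k : is_derive (0 : R) (1 : R)
    (fun z : R => expR (- h * (z * esgn j k + eigc k u)) * eigc k x) (D k).
  apply: is_derive_eq; rewrite /D /GRing.scale /= mul0r add0r; ring.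
rewrite (_ : (fun z : R => _) = (fun z : R => 2^-1 *
   (esgn i false * (expR (- h * (z * esgn j false + eigc false u)) * eigc false x) +
    esgn i true * (expR (- h * (z * esgn j true + eigc true u)) * eigc true x)))); last first.
  by apply/funext => z; rewrite coord_eigc !eigc_predictor !eigc_line.
rewrite derive_val.
by rewrite !mxE /D /GRing.scale /=; ring.
Qed.

End SpectralCalculus.

(** * The log-likelihood in eigencoordinates *)

Section LogLikelihood.
Context {R : realType}.
Implicit Types (k : bool) (u v : 'cV[R]_2) (t a : R).

(** The share of one eigenvalue [a] with its coordinate path [y]. The denominators exceed those of
    the likelihood by a factor 2 because the eigenvectors have squared length 2. *)
Definition loglik t (y : R -> R) a := ln a / 2 + a * t / 2 -
  a * (y 0 ^+ 2 + y t ^+ 2) / 4 - a ^+ 2 * pathint 0 t (fun r => y r * y r) / 4.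

Definition dloglik t (y : R -> R) a := (2 * a)^-1 + t / 2 -
  (y 0 ^+ 2 + y t ^+ 2) / 4 - a * pathint 0 t (fun r => y r * y r) / 2.

Lemma is_derive_loglik t y a : 0 < a -> is_derive a (1 : R) (loglik t y) (dloglik t y a).
Proof.
move=> a0; have := is_derive1_ln a0 => dln.
apply: is_derive_eq; rewrite /dloglik /GRing.scale /=.
by field; rewrite gt_eqF.
Qed.

Lemma likelihood_gt0 t x u : Theta u -> 0 < likelihood t x u.
Proof.
move=> /ThetaE[u0 u1]; rewrite /likelihood mulr_gt0 ?expR_gt0// mulr_gt0// sqrtr_gt0 det_Qmx.
exact: mulr_gt0.
Qed.

Lemma ln_likelihood t (x : R -> 'cV[R]_2) u : 0 <= t ->
  {within `[0, +oo[, continuous x} -> Theta u ->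
  ln (likelihood t x u) = ln 2 + loglik t (fun r => eigc false (x r)) (eigc false u) +
    loglik t (fun r => eigc true (x r)) (eigc true u).
Proof.
move=> t0 cx; have cE k : cpos (fun r => eigc k (x r)) by exact: cpos_eigc.
move=> /ThetaE[u0 u1]; have d0 : 0 < \det (Qmx u) by rewrite det_Qmx mulr_gt0.
have s0 : 0 < Num.sqrt (\det (Qmx u)) by rewrite sqrtr_gt0.
have ls : ln (Num.sqrt (\det (Qmx u))) = (ln (eigc false u) + ln (eigc true u)) / 2.
  rewrite -lnM ?posrE// -det_Qmx -[in RHS](sqr_sqrtr (ltW d0)) lnXn//.
  by field.
rewrite /likelihood !lnM ?posrE ?expR_gt0 ?mulr_gt0// expRK ls.
have -> : \int[lebesgue_measure]_(s in `[0, t]) dotv (Qmx u *m x s) (Qmx u *m x s) =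
    eigc false u ^+ 2 / 2 * pathint 0 t (fun r => eigc false (x r) * eigc false (x r)) +
    eigc true u ^+ 2 / 2 * pathint 0 t (fun r => eigc true (x r) * eigc true (x r)).
  have cEE k : cpos (fun r => eigc k (x r) * eigc k (x r)) by exact: cposM.
  rewrite -/(pathint _ _ _) -!pathintZ// -pathintD//; last first.
  - by apply: cposM => //; exact: cpos_cst.
  - by apply: cposM => //; exact: cpos_cst.
  by apply: eq_pathint => r _; rewrite dotv_eigc !eigc_Qmx; field.
rewrite /loglik !dotv_eigc !eigc_Qmx /eigc /= expr0 expr1 mul1r mulN1r.
by field.
Qed.

(** In eigencoordinates [Theta] is a product of two open half-lines, so one eigenvalue may vary with
    the other held fixed; the maximum is interior and the derivative vanishes there. *)
Lemma mle_dloglik t (x : R -> 'cV[R]_2) u k : 0 <= t ->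
  {within `[0, +oo[, continuous x} -> is_mle t x u ->
  0 < eigc k u /\ dloglik t (fun r => eigc k (x r)) (eigc k u) = 0.
Proof.
move=> t0 cx [uT umax]; have /ThetaE[u0 u1] := uT.
have uk : 0 < eigc k u by case: k.
split=> //; set a := eigc k u; pose y := fun r => eigc k (x r).
have max b : 0 < b -> loglik t y b <= loglik t y a.
  move=> b0; pose c l := if l == k then b else eigc l u.
  have [v ev] : exists v : 'cV[R]_2, forall l, eigc l v = c l.
    exists (col_of ((c false + c true) / 2, (c false - c true) / 2)) => l.
    by rewrite /eigc !mxE /=; case: l; rewrite ?expr0 ?expr1; field.
  have vT : Theta v by apply/ThetaE; rewrite !ev /c; case: (k) => /=.
  have := umax v vT; rewrite -ler_ln ?posrE ?likelihood_gt0//.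
  have le_eq2 (p q r s : R) : p = r -> q = s -> p <= q -> r <= s by move=> -> ->.
  move/(le_eq2 _ _ _ _ (ln_likelihood t0 cx vT) (ln_likelihood t0 cx uT)).
  rewrite !ev /c /y /a.
  by case: (k) => /=; rewrite ?lerD2r ?lerD2l.
have := is_derive_loglik t y uk.
have [|b|||] := @derive1_at_max R (loglik t y) 0 (a + 1) a.
- by rewrite addr_ge0 ?ltW.
- rewrite in_itv /= => /andP[b0 _]; have := is_derive_loglik t y b0 => ?; exact: ex_derive.
- by rewrite in_itv /= ltrDl ltr01 andbT.
- by move=> b; rewrite in_itv /= => /andP[b0 _]; exact: max.
- by move=> _ <- [_ <-].
Qed.

Lemma score_loglik t (x : R -> 'cV[R]_2) u i : 0 <= t ->
  {within `[0, +oo[, continuous x} -> Theta u ->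
  score t x u i 0 = esgn i false * dloglik t (fun r => eigc false (x r)) (eigc false u) +
    esgn i true * dloglik t (fun r => eigc true (x r)) (eigc true u).
Proof.
move=> t0 cx uT; have /ThetaE[u0 u1] := uT.
rewrite mxE partial_line.
pose y k r := eigc k (x r).
have cvgL k : (z * esgn i k + eigc k u) @[z --> (0 : R)] --> eigc k u.
  have ck : continuous (fun z : R => z * esgn i k + eigc k u).
    by move=> z; apply: cvgD; [exact: mulrr_continuous|exact: cvg_cst].
  by have := ck 0; rewrite /continuous_at mul0r add0r.
(* The split formula for the log-likelihood holds only on [Theta], which must therefore contain a
   neighbourhood of the point of differentiation. *)
have nearT : \forall z \near (0 : R), Theta (z *: delta_mx i 0 + u).
  have near_gt k (uk : 0 < eigc k u) : \forall z \near (0 : R), 0 < z * esgn i k + eigc k u.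
    by have := cvgr_gt _ (cvgL k) 0; apply.
  by apply: filterS2 (near_gt _ u0) (near_gt _ u1) => z z0 z1; apply/ThetaE; rewrite !eigc_line.
pose F (z : R) : R^o := ln 2 + loglik t (y false) (z * esgn i false + eigc false u) +
    loglik t (y true) (z * esgn i true + eigc true u).
transitivity ('D_(1 : R) F 0).
  by apply: near_eq_derive; apply: filterS nearT => z zT; rewrite ln_likelihood// !eigc_line.
have dk k (uk : 0 < eigc k u) : is_derive (0 : R) (1 : R)
    (fun z => loglik t (y k) (z * esgn i k + eigc k u)) (esgn i k * dloglik t (y k) (eigc k u)).
  have e0 : eigc k u = 0 * esgn i k + eigc k u by rewrite mul0r add0r.
  have uk' : 0 < 0 * esgn i k + eigc k u by rewrite -e0.
  have dl := is_derive_loglik t (y k) uk'.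
  have dz : is_derive (0 : R) (1 : R) (fun z : R => z * esgn i k + eigc k u) (esgn i k).
    by apply: is_derive_eq; rewrite /GRing.scale /=; ring.
  by have := @is_derive1_comp _ (loglik t (y k)) (fun z : R => z * esgn i k + eigc k u) 0 _ _ dl dz; rewrite -e0 mulrC.
have d0 := dk _ u0; have d1 := dk _ u1.
by rewrite /F derive_val /y; ring.
Qed.

End LogLikelihood.

(** * Limits *)

Section RateLimits.
Context {R : realType}.

Lemma cvg_pinfty_rate (F : R -> \bar R) (f : R -> R) (l K c : R) : 0 <= K ->
  (forall t, c <= t -> F t = (f t)%:E) ->
  (forall t, c <= t -> `|f t - l| <= K / Num.sqrt (Num.sqrt t)) ->
  F t @[t --> +oo] --> l%:E.
Proof.
move=> K0 Ff hf; apply/fine_cvgP; split.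
  by near=> t; rewrite Ff//; near: t; apply: nbhs_pinfty_ge; exact: num_real.
apply/cvgrPdist_le => e e0; near=> t.
have ct : c <= t by near: t; apply: nbhs_pinfty_ge; exact: num_real.
have t0 : 0 < t by near: t; apply: nbhs_pinfty_gt; exact: num_real.
have et : (K / e) ^+ 4 <= t by near: t; apply: nbhs_pinfty_ge; exact: num_real.
rewrite /= Ff//= distrC (le_trans (hf t ct))//.
have x0 : 0 <= K / e by apply: divr_ge0 => //; exact: ltW.
rewrite ler_pdivrMr ?sqrtr_gt0 ?sqrtr_gt0// mulrC -ler_pdivrMr//.
rewrite -[leLHS](ger0_norm x0) -sqrtr_sqr ler_wsqrtr// -[leLHS]ger0_norm ?sqr_ge0//.
by rewrite -sqrtr_sqr ler_wsqrtr// -exprM.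
Unshelve. all: by end_near. Qed.

Lemma sqrt_le_rt (t K : R) : 1 <= t -> 0 <= K -> K / Num.sqrt t <= K / Num.sqrt (Num.sqrt t).
Proof.
move=> t1 K0; have s1 : 1 <= Num.sqrt t by rewrite -sqrtr1 ler_wsqrtr.
apply: ler_wpM2l => //; rewrite lef_pV2 ?posrE ?sqrtr_gt0 ?(lt_le_trans ltr01)//.
by rewrite -[leRHS]ger0_norm ?sqrtr_ge0// -sqrtr_sqr ler_wsqrtr// expr2 ler_peMl// (le_trans ler01).
Qed.

End RateLimits.

Section MeanExpectation.
Context {d} {T : measurableType d} {R : realType} (P : probability T R).
Implicit Types (X Y : T -> R).

Lemma integral_mean X : moments P X -> (\int[P]_w (X w)%:E = (mean P X)%:E)%E.
Proof.
by move=> mX; rewrite /mean /Rintegral fineK//; apply: integrable_fin_num => //; exact: moments_integrable.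
Qed.

Lemma expectation_mean X : moments P X -> ('E_P[X] = (mean P X)%:E)%E.
Proof. by move=> mX; rewrite unlock integral_mean. Qed.

Lemma expectation_ae_eq X Y : measurable_fun setT X -> measurable_fun setT Y ->
  (\forall w \ae P, X w = Y w) -> ('E_P[X] = 'E_P[Y])%E.
Proof.
move=> mX mY XY; rewrite unlock; apply: ae_eq_integral => //; try exact/measurable_EFinP.
by apply: filterS XY => w ->.
Qed.

Lemma moments_indic A : measurable A -> moments P (fun w => \1_A w : R).
Proof.
move=> mA; apply: (@moments_bounded _ _ _ P 1) => [|w]; first exact: measurable_indic.
by rewrite indicE; case: (_ \in _); rewrite ?normr1 ?normr0.
Qed.

Lemma integral_mean_indic A X : measurable A -> moments P X ->
  (\int[P]_(w in A) (X w)%:E = (mean P (fun w => \1_A w * X w))%:E)%E.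
Proof.
move=> mA mX; rewrite -integral_mean; last by apply: momentsM => //; exact: moments_indic.
rewrite integral_mkcond; apply: eq_integral => w _; rewrite patchE indicE.
by case: (_ \in _); rewrite ?mul1r ?mul0r.
Qed.

Section Quadratic.
Variables (Z : bool -> R -> T -> R) (c : R -> R) (L : bool -> bool -> R) (a b : bool -> R).
Hypothesis Z_moments : forall k t, 4 <= t -> moments P (Z k t).
Hypothesis Z_rate : forall k l, exists2 K, 0 <= K & forall t, 4 <= t ->
  `|c t * mean P (fun w => Z k t w * Z l t w) - L k l| <= K / Num.sqrt (Num.sqrt t).

Let comb (e : bool -> R) t w := e false * Z false t w + e true * Z true t w.

Lemma moments_combM t : 4 <= t -> moments P (fun w => comb a t w * comb b t w).
Proof.
by move=> t4; apply: momentsM; apply: momentsD; apply: momentsM; (exact: moments_cst || exact: Z_moments).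
Qed.

(** Bilinear expansion, leading from eigencoordinates back to matrix entries. Used with c t = 1 / t
    for the Fisher information and c t = t for the prediction error. *)
Lemma mean_comb_rate : exists2 K, 0 <= K & forall t, 4 <= t ->
  `|c t * mean P (fun w => comb a t w * comb b t w) -
    \sum_(k : bool) \sum_(l : bool) a k * b l * L k l| <= K / Num.sqrt (Num.sqrt t).
Proof.
have [K00 K00p h00] := Z_rate false false; have [K01 K01p h01] := Z_rate false true.
have [K10 K10p h10] := Z_rate true false; have [K11 K11p h11] := Z_rate true true.
exists (`|a false * b false| * K00 + `|a false * b true| * K01 +
        `|a true * b false| * K10 + `|a true * b true| * K11).
  by rewrite !addr_ge0// mulr_ge0.
move=> t t4; set r := Num.sqrt (Num.sqrt t).
have m k l : moments P (fun w => Z k t w * Z l t w) by apply: momentsM; exact: Z_moments.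
pose E k l := mean P (fun w => Z k t w * Z l t w).
have mc (x : R) k l : moments P (fun w => x * (Z k t w * Z l t w)).
  by apply: momentsM => //; exact: moments_cst.
have -> : mean P (fun w => comb a t w * comb b t w) =
    a false * b false * E false false + a false * b true * E false true +
    a true * b false * E true false + a true * b true * E true true.
  rewrite (@mean_ext _ _ _ P _ (fun w => a false * b false * (Z false t w * Z false t w) +
    a false * b true * (Z false t w * Z true t w) + a true * b false * (Z true t w * Z false t w) +
    a true * b true * (Z true t w * Z true t w))) => [|w]; last by rewrite /comb; ring.
  have m2 := momentsD (mc (a false * b false) false false) (mc (a false * b true) false true).
  have m3 := momentsD m2 (mc (a true * b false) true false).
  by rewrite (meanD m3) ?(meanD m2) ?meanD// !meanZ.
rewrite !big_bool /=.
have step x k l K : `|c t * E k l - L k l| <= K / r -> `|x * (c t * E k l - L k l)| <= `|x| * K / r.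
  by move=> h; rewrite normrM -mulrA; apply: ler_wpM2l.
have s00 := step (a false * b false) _ _ _ (h00 t t4); have s01 := step (a false * b true) _ _ _ (h01 t t4).
have s10 := step (a true * b false) _ _ _ (h10 t t4); have s11 := step (a true * b true) _ _ _ (h11 t t4).
rewrite !mulrDl.
set l00 := _ * (_ - _) in s00; set l01 := _ * (_ - _) in s01.
set l10 := _ * (_ - _) in s10; set l11 := _ * (_ - _) in s11.
rewrite (_ : _ - _ = l00 + l01 + l10 + l11); last by rewrite /l00 /l01 /l10 /l11; ring.
apply: le_trans (ler_normD _ _) _; apply: lerD => //.
apply: le_trans (ler_normD _ _) _; apply: lerD => //.
by apply: le_trans (ler_normD _ _) _; apply: lerD.
Qed.

End Quadratic.

End MeanExpectation.

(** * The predictor as a conditional expectation *)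

Section ConditionalExpectation.
Context {d} {T : measurableType d} {R : realType} (P : probability T R)
  (theta : 'cV[R]_2) (W X : R -> T -> 'cV[R]_2) (theta_in : Theta theta)
  (XOU : stationary_ou P theta W X).

Local Notation lam := (ou_rate theta).
Local Notation U := (ou_coord X).
Let ou : ou_pair P lam U (ou_noise W) (ou_past P W X) := ou_pair_eigc theta_in XOU.

(** The event is determined by X_t, which the inverse change of basis recovers almost surely from
    the two history-measurable versions. *)
Lemma ou_past_indic t A : 0 <= t -> sigma_of (X t) A -> ou_past P W X t (fun w => \1_A w).
Proof.
move=> t0 hA; have mA := sigma_of_measurable (ou_meas XOU t0) hA.
split; first exact: moments_indic.
move: hA => /sigma_ofE[B mB AB].
pose V w : R * R := (2^-1 * (ou_version theta W X false t w + ou_version theta W X true t w),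
   2^-1 * (ou_version theta W X false t w - ou_version theta W X true t w)).
have mV i : measurable_fun [set: g_sigma_algebraType (history W X t)] (ou_version theta W X i t).
  by apply: (measurable_ou_version XOU).
have mVV : measurable_fun [set: g_sigma_algebraType (history W X t)] V.
  apply/measurable_fun_pairP; split; apply: measurable_funM => //.
    exact: measurable_funD.
  exact: measurable_funB.
exists (fun w => \1_B (V w)).
  have mi : measurable_fun [set: R * R] (\1_B : R * R -> R) by exact: measurable_indic.
  exact: (measurableT_comp mi mVV).
apply: filterS2 (ou_coord_version XOU false) (ou_coord_version XOU true) => w e0 e1.
rewrite -AB /V -e0// -e1// !indicE; congr (_ %:R); congr (nat_of_bool _).
suff -> : (2^-1 * (U false t w + U true t w), 2^-1 * (U false t w - U true t w)) = pair_of (X t w).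
  by apply/idP/idP => /set_mem h; apply/mem_set.
rewrite /pair_of; congr (_, _); rewrite /ou_coord /eigc /= expr0 expr1; by field.
Qed.

Lemma coord_ou t w i : X t w i 0 = 2^-1 * (esgn i false * U false t w + esgn i true * U true t w).
Proof. exact: coord_eigc. Qed.

(** In each eigencoordinate [mean_past_U] with the indicator of the event as past variable gives the
    factor exp(- lam h), the eigenvalue of exp(- h Q). *)
Lemma predictor_cond_exp h t : 0 < h -> 0 <= t ->
  is_cond_exp P (X (t + h)) (X t) (fun x => predictor h x theta).
Proof.
move=> h0 t0; have th0 : 0 <= t + h by apply: addr_ge0 => //; exact: ltW.
have tth : t <= t + h by rewrite lerDl ltW.
have mU k r : 0 <= r -> moments P (U k r) by move=> r0; apply: (U_moments ou).
have mc (x : R) Y : moments P Y -> moments P (fun w => x * Y w).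
  by move=> mY; apply: momentsM => //; exact: moments_cst.
have mX i r : 0 <= r -> moments P (fun w => X r w i 0).
  move=> r0; rewrite (_ : (fun _ => _) = (fun w => 2^-1 * (esgn i false * U false r w + esgn i true * U true r w))).
    by apply: (mc _); apply: momentsD; apply: (mc _); exact: mU.
  by apply/funext => w; exact: coord_ou.
have pE i w : predictor h (X t w) theta i 0 = 2^-1 * (esgn i false * (expR (- h * lam false) * U false t w) +
          esgn i true * (expR (- h * lam true) * U true t w)) by exact: predictor_coord.
have mp i : moments P (fun w => predictor h (X t w) theta i 0).
  rewrite (_ : (fun _ => _) = (fun w => 2^-1 * (esgn i false * (expR (- h * lam false) * U false t w) +
          esgn i true * (expR (- h * lam true) * U true t w)))).
    by apply: (mc _); apply: momentsD; apply: (mc (esgn i _)); apply: (mc _); exact: mU.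
  exact/funext.
split=> [|i].
  have mpc i : measurable_fun setT (fun z : R * R => predictor h (col_of z) theta i 0).
    rewrite (_ : (fun _ => _) = (fun z : R * R => 2^-1 * (esgn i false * (expR (- h * eigc false theta) * eigc false (col_of z)) +
          esgn i true * (expR (- h * eigc true theta) * eigc true (col_of z))))).
      apply: measurable_funM => //; apply: measurable_funD; apply: measurable_funM => //;
        by apply: measurable_funM => //; exact: measurable_eigc_col.
    by apply/funext => z; exact: predictor_coord.
  by apply/measurable_fun_pairP; split; exact: mpc.
split; [exact/moments_integrable/mX|exact: moments_integrable (mp i)|].
move=> A hA; have mA := sigma_of_measurable (ou_meas XOU t0) hA.
have pA := ou_past_indic t0 hA; have m1 := past_moments ou t0 pA.
rewrite !integral_mean_indic//; last exact: mX.
have mAU k r : 0 <= r -> moments P (fun w => \1_A w * U k r w).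
  by move=> r0; apply: momentsM => //; exact: mU.
pose E k := mean P (fun w => \1_A w * U k t w).
congr (_%:E).
transitivity (2^-1 * (esgn i false * (expR (- h * lam false) * E false) + esgn i true * (expR (- h * lam true) * E true))).
  rewrite (@mean_ext _ _ _ P _ (fun w => 2^-1 * (esgn i false * (expR (- h * lam false) * (\1_A w * U false t w)) +
     esgn i true * (expR (- h * lam true) * (\1_A w * U true t w))))) => [|w]; last by rewrite pE; ring.
  rewrite meanZ; last by apply: momentsD; apply: (mc (esgn i _)); apply: (mc _); exact: mAU.
  rewrite meanD; try by apply: (mc (esgn i _)); apply: (mc _); exact: mAU.
  by rewrite !(meanZ (esgn i _)) ?meanZ//; try (apply: (mc _)); exact: mAU.
rewrite (@mean_ext _ _ _ P (fun w => \1_A w * X (t + h) w i 0) (fun w => 2^-1 * (esgn i false * (\1_A w * U false (t + h) w) +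
     esgn i true * (\1_A w * U true (t + h) w)))) => [|w]; last by rewrite coord_ou; ring.
rewrite meanZ; last by apply: momentsD; apply: (mc _); exact: mAU.
rewrite meanD; try by apply: (mc _); exact: mAU.
rewrite !meanZ; try exact: mAU.
rewrite !(mean_past_U ou _ t0 tth pA) /E [t + h]addrC addrK.
by rewrite ![- lam _ * h]mulNr ![- h * lam _]mulNr ![h * lam _]mulrC.
Qed.

End ConditionalExpectation.

(** * Fisher information and the efficiency bound *)

Section Efficiency.
Context {d} {T : measurableType d} {R : realType} (P : probability T R)
  (theta : 'cV[R]_2) (W X : R -> T -> 'cV[R]_2) (theta_in : Theta theta)
  (XOU : stationary_ou P theta W X).

Local Notation lam := (ou_rate theta).
Local Notation U := (ou_coord X).
Let ou : ou_pair P lam U (ou_noise W) (ou_past P W X) := ou_pair_eigc theta_in XOU.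

Let lam0 k : 0 < lam k := ou_rate_gt0 theta_in k.

Lemma score_coordE t w i : 0 <= t -> score t (X ^~ w) theta i 0 =
  esgn i false * score_coord lam U false t w + esgn i true * score_coord lam U true t w.
Proof.
move=> t0; rewrite (@score_loglik _ t (X ^~ w) theta i t0 _ theta_in); last exact: ou_cont XOU w.
rewrite /dloglik /score_coord /bracket /ou_coord /= -/(lam false) -/(lam true).
by congr (_ * _ + _ * _); field; rewrite gt_eqF.
Qed.

(** Entry (i, j) is the sum over k of [esgn i k * esgn j k / (2 * lam k)], that is, of
    [eproj k i j / lam k]: the spectral form of the inverse of Q. The off-diagonal terms vanish with
    [ucov]. *)
Lemma fisher_limit : is_asymptotic_fisher_info P X theta (invmx (Qmx theta)).
Proof.
move=> i j; pose c (t : R) := t^-1.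
pose S k t w := score_coord lam U k t w.
have mS k t : 4 <= t -> moments P (S k t).
  move=> t4; have t0 : 0 <= t by rewrite (le_trans _ t4).
  have mM := bracket_moments ou k k t0; have mU := U_moments ou k (lexx 0).
  apply: momentsB; first apply: momentsB; first exact: moments_cst.
    by apply: momentsM => //; exact: moments_cst.
  by apply: momentsM; [exact: momentsX|exact: moments_cst].
have rS k l : exists2 K, 0 <= K & forall t, 4 <= t ->
    `|c t * mean P (fun w => S k t w * S l t w) - ucov lam k l / 2| <= K / Num.sqrt (Num.sqrt t).
  have [K K0 hK] := mean_score ou k l; exists K => // t t4.
  have t1 : 1 <= t by rewrite (le_trans _ t4)// ler1n.
  by rewrite mulrC (le_trans (hK t t1))// sqrt_le_rt.
have [K K0 hK] := mean_comb_rate (esgn i) (esgn j) mS rS.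
pose comb e t w := e false * S false t w + e true * S true t w.
have -> : invmx (Qmx theta) i j = \sum_(k : bool) \sum_(l : bool) esgn i k * esgn j l * (ucov lam k l / 2).
  rewrite Qmx_spectral invmx_spectral ?gt_eqF//; last 2 first.
  - exact: (lam0 false).
  - exact: (lam0 true).
  by rewrite !big_bool /= !mxE /ucov /= !mul0r !mulr0 /ou_rate; field; rewrite !gt_eqF// -/(lam _).
apply: (cvg_pinfty_rate K0 _ hK) => t t4.
have t0 : 0 <= t by rewrite (le_trans _ t4).
rewrite /fisher_info (_ : (fun w => _) = (fun w => comb (esgn i) t w * comb (esgn j) t w)).
  by rewrite expectation_mean ?EFinM//; exact: moments_combM.
by apply/funext => w; rewrite outer_mxE !score_coordE.
Qed.

Lemma jacobian_form h x i j :
  (jacobian_col (predictor h x) theta *m Qmx theta *m (jacobian_col (predictor h x) theta)^T) i j =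
  h ^+ 2 * (expR (- (2 * h) * lam false) * lam false * (eigc false x * eigc false x)) * eproj false i j +
  h ^+ 2 * (expR (- (2 * h) * lam true) * lam true * (eigc true x * eigc true x)) * eproj true i j.
Proof.
rewrite jacobian_predictor trmx_spectral Qmx_spectral !spectralM spectralE -!/(lam _).
have e k : expR (- (2 * h) * lam k) = expR (- h * lam k) * expR (- h * lam k) by rewrite -expRD; congr expR; ring.
by rewrite !e; ring.
Qed.

(** The integral against the stationary law is read as a mean over X_0, where E U_k^2 = 1 / lam_k
    cancels the eigenvalue contributed by [Qmx theta]. *)
Lemma bound_value h i j :
  (\int[mu_ theta]_z ((jacobian_col (predictor h (col_of z)) theta *m Qmx theta *m
      (jacobian_col (predictor h (col_of z)) theta)^T) i j)%:E)%E =
  ((h ^+ 2 *: expmx (- (2 * h) *: Qmx theta)) i j)%:E.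
Proof.
pose q k (z : R * R) := eigc k (col_of z) * eigc k (col_of z).
pose a k := h ^+ 2 * (expR (- (2 * h) * lam k) * lam k).
pose g (z : R * R) := a false * eproj false i j * q false z + a true * eproj true i j * q true z.
have mg : measurable_fun setT g.
  by apply: measurable_funD; apply: measurable_funM => //; apply: measurable_funM; exact: measurable_eigc_col.
transitivity (\int[mu_ theta]_z (g z)%:E)%E.
  by apply: eq_integral => z _; rewrite jacobian_form; congr (_%:E); rewrite /g /a /q; ring.
rewrite -(has_law_integral (ou_meas XOU (lexx 0)) (ou_law0 XOU) mg).
have mUU k : moments P (fun w => U k 0 w * U k 0 w) by apply: momentsM; exact: U_moments ou _ _ (lexx 0).
have mc (x : R) k : moments P (fun w => x * (U k 0 w * U k 0 w)).
  by apply: momentsM => //; exact: moments_cst.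
have -> : (fun w => (g (pair_of (X 0 w)))%:E) =
    EFin \o (fun w => a false * eproj false i j * (U false 0 w * U false 0 w) +
                    a true * eproj true i j * (U true 0 w * U true 0 w)).
  by apply/funext => w; rewrite /g /q col_of_pair_of.
rewrite integral_mean; last exact: momentsD.
congr (_%:E); rewrite meanD// !meanZ// !(mean_UU ou)// /ucov !eqxx.
rewrite expmx_Qmx spectralZ spectralE -!/(lam _).
by rewrite /a /= mulr1n; field; rewrite !gt_eqF.
Qed.

End Efficiency.

(** * Limit of the prediction error *)

Section PlugInError.
Context {d} {T : measurableType d} {R : realType} (P : probability T R)
  (theta : 'cV[R]_2) (W X : R -> T -> 'cV[R]_2) (h : R) (hat : R -> T -> 'cV[R]_2)
  (theta_in : Theta theta) (XOU : stationary_ou P theta W X) (h_gt0 : 0 < h)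
  (hat_meas : forall t, 0 < t -> random_vector (hat t))
  (hat_mle : forall t, 0 < t -> \forall w \ae P, is_mle t (X ^~ w) (hat t w)).

Local Notation lam := (ou_rate theta).
Local Notation U := (ou_coord X).
Let ou : ou_pair P lam U (ou_noise W) (ou_past P W X) := ou_pair_eigc theta_in XOU.

Let lam0 k : 0 < lam k := ou_rate_gt0 theta_in k.

Let delta k t w := expR (- h * eigc k (hat t w)) - expR (- h * lam k).

(* Almost surely equal to [delta], but bounded everywhere. *)
Let D k t w := Order.max (-1) (Order.min 1 (delta k t w)).

Let kap k := h * lam k * expR (- h * lam k) / 2.

Let expR_le1 a : 0 < a -> expR (- h * a) <= 1.
Proof. by move=> a0; rewrite expR_le1 mulNr oppr_le0 ltW// mulr_gt0. Qed.

Let deltaE t w k : Theta (hat t w) -> D k t w = delta k t w.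
Proof.
move=> /ThetaE[h0 h1]; have hk : 0 < eigc k (hat t w) by case: k.
have := expR_le1 hk; have := expR_le1 (lam0 k).
have := expR_gt0 (- h * eigc k (hat t w)); have := expR_gt0 (- h * lam k).
rewrite /D /delta => a1 a2 a3 a4.
by rewrite min_r ?max_r//; lra.
Qed.

Let delta_meas k t : 0 < t -> measurable_fun setT (delta k t).
Proof.
move=> t0; apply: measurable_funB => //; apply: measurableT_comp => //.
by apply: measurable_funM => //; apply: measurable_eigc; exact: hat_meas.
Qed.

Let D_meas k t : 1 <= t -> measurable_fun setT (D k t).
Proof.
move=> t1; apply: measurable_maxr => //; apply: measurable_minr => //.
by apply: delta_meas; rewrite (lt_le_trans ltr01).
Qed.

Let D_le1 k t w : `|D k t w| <= 1.
Proof.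
rewrite ler_norml /D le_max lexx /= ge_max.
by rewrite ge_min lexx andbT lerN10 || (apply/andP; split; [lra|rewrite ge_min lexx]).
Qed.

(** The deterministic linearization with U_k(0)^2 and U_k(t)^2 as end points, on the almost sure
    event where the estimate maximizes the likelihood. Each eigenvalue has its own constant; the sum
    of their absolute values serves both. *)
Let D_lin : exists C, forall k t, 1 <= t -> \forall w \ae P,
  `|D k t w - kap k * bracket lam U k k t w / t| <=
  C * (1 + bracket lam U k k t w ^+ 2 / t + U k t w ^+ 4 + U k 0 w ^+ 4) / t.
Proof.
have [C0 hC0] := likelihood_eq_linearization h_gt0 (lam0 false).
have [C1 hC1] := likelihood_eq_linearization h_gt0 (lam0 true).
exists (`|C0| + `|C1|) => k t t1; have t0 : 0 < t by rewrite (lt_le_trans ltr01).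
apply: filterS (hat_mle t0) => w mle.
have cX : {within `[0, +oo[, continuous (X ^~ w)} by exact: ou_cont XOU w.
have [hk eqk] := @mle_dloglik _ t (X ^~ w) (hat t w) k (ltW t0) cX mle.
rewrite (deltaE k (proj1 mle)).
pose A := pathint 0 t (fun r => U k r w * U k r w).
have A0 : 0 <= A by apply: pathint_ge0 => r _; rewrite -expr2 sqr_ge0.
have eM : bracket lam U k k t w = U k t w ^+ 2 - U k 0 w ^+ 2 + 2 * lam k * A - 2 * t.
  by rewrite /bracket eqxx -/A /= mulr1n; ring.
have eq0 : (2 * eigc k (hat t w))^-1 + t / 2 - (U k 0 w ^+ 2 + U k t w ^+ 2) / 4 - eigc k (hat t w) * A / 2 = 0.
  exact: eqk.
have pos : 0 <= 1 + bracket lam U k k t w ^+ 2 / t + U k t w ^+ 4 + U k 0 w ^+ 4.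
  have q x : 0 <= x ^+ 4 :> R by rewrite -[4%N]/(2 * 2)%N exprM sqr_ge0.
  by rewrite !addr_ge0 ?q// divr_ge0 ?sqr_ge0 ?ltW.
have le4 C : C <= `|C0| + `|C1| ->
    `|delta k t w - kap k * bracket lam U k k t w / t| <=
    C * (1 + bracket lam U k k t w ^+ 2 / t + (U k t w ^+ 2) ^+ 2 + (U k 0 w ^+ 2) ^+ 2) / t ->
    `|delta k t w - kap k * bracket lam U k k t w / t| <=
    (`|C0| + `|C1|) * (1 + bracket lam U k k t w ^+ 2 / t + U k t w ^+ 4 + U k 0 w ^+ 4) / t.
  move=> CC; rewrite -!exprM => /le_trans; apply.
  by rewrite ler_pM2r ?invr_gt0//; apply: ler_wpM2r.
have nC0 : C0 <= `|C0| + `|C1| by rewrite (le_trans (ler_norm _))// lerDl.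
have nC1 : C1 <= `|C0| + `|C1| by rewrite (le_trans (ler_norm _))// lerDr.
move: eM eq0 hk A0 le4; clear pos eqk; case: k @A => A eM eq0 hk A0 le4.
- apply: (le4 C1) => //; rewrite eM.
  exact: (hC1 t _ _ A (eigc true (hat t w)) t1 (sqr_ge0 _) (sqr_ge0 _) A0 hk eq0).
- apply: (le4 C0) => //; rewrite eM.
  exact: (hC0 t _ _ A (eigc false (hat t w)) t1 (sqr_ge0 _) (sqr_ge0 _) A0 hk eq0).
Qed.

Lemma plugin_error_limit i j :
  let err t w := predictor h (X t w) (hat t w) - predictor h (X t w) theta in
  (t%:E * 'E_P[fun w => (err t w *m (err t w)^T) i j])%E @[t --> +oo] -->
  ((h ^+ 2 *: expmx (- (2 * h) *: Qmx theta)) i j)%:E.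
Proof.
move=> err; have [C hD] := D_lin.
pose Z k t w := D k t w * U k t w.
have mZ k t : 4 <= t -> moments P (Z k t).
  move=> t4; have t1 : 1 <= t by rewrite (le_trans _ t4)// ler1n.
  apply: momentsM; first exact: moments_bounded (D_meas k t1) (D_le1 k t).
  by apply: (U_moments ou); rewrite (le_trans ler01).
have rZ k l : exists2 K, 0 <= K & forall t, 4 <= t ->
    `|t * mean P (fun w => Z k t w * Z l t w) - 8 * kap k * kap l * ucov lam k l ^+ 2| <= K / Num.sqrt (Num.sqrt t).
  have [K K0 hK] := mean_plugin ou D_meas D_le1 hD k l; exists K => // t t4.
  rewrite (@mean_ext _ _ _ P _ (fun w => D k t w * D l t w * (U k t w * U l t w))); first exact: hK.
  by move=> w; rewrite /Z; ring.
pose a i k : R := 2^-1 * esgn i k.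
have [K K0 hK] := mean_comb_rate (a i) (a j) mZ rZ.
pose comb e t w := e false * Z false t w + e true * Z true t w.
(* On the diagonal 8 kap^2 / lam^2 = 2 h^2 exp(- 2 h lam): the eigenvalue cancels, and the two
   factors 1/2 in [a] turn the signs into [eproj k i j]. Off the diagonal [ucov] is 0. *)
have -> : (h ^+ 2 *: expmx (- (2 * h) *: Qmx theta)) i j =
    \sum_(k : bool) \sum_(l : bool) a i k * a j l * (8 * kap k * kap l * ucov lam k l ^+ 2).
  rewrite expmx_Qmx spectralZ spectralE -!/(lam _).
  have e k : expR (- (2 * h) * lam k) = expR (- h * lam k) * expR (- h * lam k) by rewrite -expRD; congr expR; ring.
  rewrite !e !big_bool /= !mxE /ucov /kap /a /= mulr1n mulr0n.
  by field; rewrite !gt_eqF.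
apply: (cvg_pinfty_rate K0 _ hK) => t t4.
have t1 : 1 <= t by rewrite (le_trans _ t4)// ler1n.
have t0 : 0 < t by rewrite (lt_le_trans ltr01).
have mcomb := moments_combM (a i) (a j) mZ t4.
rewrite (@expectation_ae_eq _ _ _ P _ (fun w => comb (a i) t w * comb (a j) t w)).
- by rewrite expectation_mean// EFinM.
- have mp k (v : T -> 'cV[R]_2) : random_vector v -> measurable_fun setT (fun w => predictor h (X t w) (v w) k 0).
    move=> mv; have mX := ou_meas XOU (ltW t0).
    rewrite (_ : (fun _ => _) = (fun w => 2^-1 * (esgn k false * (expR (- h * eigc false (v w)) * eigc false (X t w)) +
       esgn k true * (expR (- h * eigc true (v w)) * eigc true (X t w))))); last first.
      by apply/funext => w; exact: predictor_coord.
    apply: measurable_funM => //; apply: measurable_funD; apply: measurable_funM => //;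
      apply: measurable_funM; try (by apply: measurable_eigc);
      by apply: measurableT_comp => //; apply: measurable_funM => //; apply: measurable_eigc.
  rewrite (_ : (fun _ => _) = (fun w =>
    (predictor h (X t w) (hat t w) i 0 - predictor h (X t w) theta i 0) *
    (predictor h (X t w) (hat t w) j 0 - predictor h (X t w) theta j 0))); last first.
    by apply/funext => w; rewrite outer_mxE /err; congr (_ * _); rewrite mxE [X in _ + X]mxE.
  have mth : random_vector (fun _ : T => theta) by exact: measurable_cst.
  have mh k := mp k _ (hat_meas t0); have mt k := mp k _ mth.
  by apply: measurable_funM; (apply: measurable_funB; [exact: mh|exact: mt]).
- exact: (@moments_meas _ _ _ P _ mcomb).
- apply: filterS (hat_mle t0) => w [wT _].
  have ek k : err t w k 0 = comb (a k) t w.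
    rewrite /err [LHS]mxE [X in _ + X]mxE !predictor_coord /comb /Z /a !(deltaE _ wT) /delta /ou_coord -!/(lam _).
    by ring.
  by rewrite outer_mxE !ek.
Qed.

End PlugInError.

Theorem mainTheorem7 (R : realType) (d : measure_display)
    (T : measurableType d) (P : probability T R)
    (theta : 'cV[R]_2) (W X : R -> T -> 'cV[R]_2)
    (h : R) (hat : R -> T -> 'cV[R]_2)
    (theta_in : Theta theta)
    (XOU : stationary_ou P theta W X)
    (h_gt0 : 0 < h)
    (hat_meas : forall t, 0 < t -> random_vector (hat t))
    (hat_mle : forall t, 0 < t ->
       \forall w \ae P, is_mle t (X ^~ w) (hat t w)) :
  (forall t, 0 <= t ->
     is_cond_exp P (X (t + h)) (X t) (fun x => predictor h x theta)) /\
  exists I : 'M[R]_2,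
    [/\ is_asymptotic_fisher_info P X theta I,
        I = invmx (Qmx theta) &
        forall i j : 'I_2,
          let err t w :=
            predictor h (X t w) (hat t w) - predictor h (X t w) theta in
          let J x := jacobian_col (predictor h x) theta in
          let bound :=
            (\int[mu_ theta]_z
               ((J (col_of z) *m invmx I *m (J (col_of z))^T) i j)%:E)%E in
          ((t%:E * 'E_P[fun w => (err t w *m (err t w)^T) i j])%E
             @[t --> +oo%R] --> bound) /\
          bound = ((h ^+ 2 *: expmx (- (2 * h) *: Qmx theta)) i j)%:E].
Proof.
split=> [t t0|]; first exact: (predictor_cond_exp theta_in XOU h_gt0 t0).
exists (invmx (Qmx theta)); split=> // [|i j err J bound].
  exact: (fisher_limit theta_in XOU).
have e : bound = ((h ^+ 2 *: expmx (- (2 * h) *: Qmx theta)) i j)%:E.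
  by rewrite /bound /J invmxK; exact: (bound_value theta_in XOU).
by split=> //; rewrite e; exact: (plugin_error_limit theta_in XOU h_gt0 hat_meas hat_mle).
Qed.
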